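(* Let $n\ge 2$ and let $X_n$ be the $n$-faceted banana. Let $A$ be the (completed) free graded Lie algebra over $\mathbb{Q}$ on generators $a,b$ (grading $-1$), $e_1,\dots,e_n$ (grading $0$), $f_1,\dots,f_n$ (grading $1$), $h$ (grading $2$), with indices of $e_i,f_i$ taken modulo $n$. Write $E_i=\mathrm{ad}_{e_i}$, $v_i=\mu_2(e_i,e_{i+1})$, $v=\mu_n(e_1,\dots,e_n)$, $x_i=u_{\frac12 v_i}(a)$, $x=u_{\frac12 v}(a)$, $f'_i=e^{\frac12\mathrm{ad}_{v_i}}f_i$. Let $Q$ be a formal power series in two non-commuting variables, with lowest order terms $\frac12X+\frac1{12}(X^2-YX)+\cdots$, such that $\mathrm{BCH}(x,y)=x+y+Q(\mathrm{ad}_x,\mathrm{ad}_y)\,y$ in the completed free Lie algebra on two (ungraded) symbols $x,y$. Define the differential $\partial$ on generators by $$\partial a=-\tfrac12[a,a],\qquad \partial b=-\tfrac12[b,b],\qquad \partial e_i=\frac{E_i}{1-e^{E_i}}a+\frac{E_i}{1-e^{-E_i}}b,$$ $$\partial f_i=\mathrm{BCH}(-\tfrac12v_i,e_i,-e_{i+1},\tfrac12v_i)-[x_i,f_i],$$ $$e^{\frac12\mathrm{ad}_v}\partial_xh=\sum_{i=1}^nf'_i+\frac1{2n}\sum_{\substack{i,j=1\\ j\not\equiv i,\,i+1 \ (\mathrm{mod}\ n)}}^n\Big(Q\big(\mathrm{BCH}(E_j,-E_i),\mathrm{BCH}(E_i,-E_{i+1})\big)+Q\big(\mathrm{BCH}(E_j,-E_{i+1}),\mathrm{BCH}(E_{i+1},-E_i)\big)\Big)f'_i,$$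 where $\partial_xh=\partial h+[x,h]$. Then $A$ with $\partial$ is a DGLA model of $X_n$ which is symmetric under the geometric symmetries of the cell fixing the two vertices (that is, under $D_n=\langle\sigma,\tau\rangle$). In this model the 3-cell $h$ is localised at $x$, and each bi-gon 2-cell $f_i$ is localised at its centre $x_i$.
   Context: **DGLA.** A DGLA over $\mathbb{Q}$ is a $\mathbb{Z}$-graded vector space $A=\oplus_nA_n$ with a grading-preserving bilinear bracket and a linear map $\partial$ of degree $-1$ with $\partial^2=0$, satisfying $[b,a]=-(-1)^{|a||b|}[a,b]$, the graded Jacobi identity $\mathrm{ad}_{[a,b]}=\mathrm{ad}_a\mathrm{ad}_b-(-1)^{|a||b|}\mathrm{ad}_b\mathrm{ad}_a$ (where $\mathrm{ad}_a(c)=[a,c]$), and $\partial[a,b]=[\partial a,b]+(-1)^{|a|}[a,\partial b]$. All free graded Lie algebras are completed with respect to the number of Lie brackets (infinite formal sums of terms with increasing numbers of brackets are allowed); $\partial$ is determined by its values on generators. **Model.** A (DGLA) model of a regular CW complex $X$ is a DGLA $A(X)$ over $\mathbb{Q}$ such that: as a Lie algebra it is freely generated by one generator for each cell, with grading one less than the dimension of the cell; each 0-cell generator $a$ satisfies $\partial a+\frac12[a,a]=0$; for each cell $y$ of positive dimension (oriented), the part of $\partial y$ containing no Lie brackets is the geometric boundary $\partial_0y$; and $\partial y$ lies in the Lie algebra generated by the generators of the cells in the closure $\bar y$. **Points, flows, localisation.** A point is an $a\in A_{-1}$ with $\partial a+\frac12[a,a]=0$; then $\partial_a:=\partial+\mathrm{ad}_a$.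 For $e\in A_0$ and $a\in A_{-1}$, $u_e(a)=e^{-\mathrm{ad}_e}a+\frac{1-e^{-\mathrm{ad}_e}}{\mathrm{ad}_e}\partial e$, where the quotient means $\sum_{m\ge0}\frac{(-1)^m}{(m+1)!}(\mathrm{ad}_e)^m(\partial e)$. Expressions such as $\frac{E}{1-e^{E}}$ are likewise formal power series in $E$. In a model, a $k$-cell $f$ ($k>1$) is localised at a point $a$ if $\partial_af=\partial f+[a,f]$ lies in the Lie algebra generated by the cells of the closure of the geometric boundary of $f$. **BCH.** $\mathrm{BCH}(x,y)$ is the Baker–Campbell–Hausdorff series, $\exp(x)\exp(y)=\exp\mathrm{BCH}(x,y)$; $\mathrm{BCH}(x_1,\dots,x_m)$ is the iterated (associative) version. Applied to the operators $E_i=\mathrm{ad}_{e_i}$, $\mathrm{BCH}(E_j,-E_i)=\mathrm{ad}_{\mathrm{BCH}(e_j,-e_i)}$. **Universal averages.** $\mu_n(x_1,\dots,x_n)$ is the universal average of Lawrence–Siboni, a formal Lie series over $\mathbb{Q}$ in $x_1,\dots,x_n$ which is totally symmetric in its arguments, satisfies $\mu_n(-x_1,\dots,-x_n)=-\mu_n(x_1,\dots,x_n)$, has $u_{\mu_n(x_1,\dots,x_n)}(a)=b$ in any DGLA model with points $a,b$ such that $u_{x_i}(a)=b$ for all $i$, and has expansion $\frac1n\sum_ix_i-\frac1{12n^2}\sum_{i\ne j}[x_i,[x_i,x_j]]+\cdots$. For $n=2$, $\mu_2(x,y)=\mathrm{BCH}(x,\frac12\mathrm{BCH}(-x,y))$.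 **The banana $X_n$.** $X_n$ has two 0-cells $a,b$; $n$ 1-cells $e_1,\dots,e_n$, each from $a$ to $b$; $n$ bi-gon 2-cells $f_1,\dots,f_n$ with $\partial_0f_i=e_i-e_{i+1}$ ($e_{n+1}\equiv e_1$); and one 3-cell $h$ with $\partial_0h=f_1+\cdots+f_n$. The symmetries fixing the vertices form the group $D_n=\langle\sigma,\tau\rangle$, acting on generators by $\tau:\ e_i\mapsto e_{i+1},\ f_i\mapsto f_{i+1}$, with $a,b,h$ fixed; $\sigma:\ e_i\mapsto e_{n-i},\ f_i\mapsto-f_{n-i-1},\ h\mapsto-h$, with $a,b$ fixed (indices modulo $n$). The model is symmetric (invariant) under a symmetry if the induced automorphism of the graded Lie algebra commutes with $\partial$. *)

(* Defs.v *)
From HB Require Import structures.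
From mathcomp Require Import all_boot all_order all_algebra perm.
From mathcomp Require Import all_classical.

Set Implicit Arguments.
Unset Strict Implicit.
Unset Printing Implicit Defensive.

Import Order.TTheory GRing.Theory Num.Theory.
Local Open Scope classical_set_scope.
Local Open Scope ring_scope.

(** * Non-commutative formal power series over the rationals

    The completed free graded Lie algebra on a finite set [G] of generators is
    realised inside the algebra of non-commutative formal power series in [G]
    with its graded commutator: an element is a series each of whose parts of
    given word length is a Lie polynomial.  A Lie monomial with k.-1 brackets
    is homogeneous of word length k, so completing with respect to the number
    of brackets means allowing one Lie polynomial in every word length. *)

Definition ser (G : finType) : Type := seq G -> rat^o.

(* Infinite formal sum, coefficient by coefficient.  In all uses below only
   finitely many terms contribute to a given word, because an operator [ad e]
   (or a multiplication) by a series without constant term raises word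
   length. *)
Definition ssum (G : finType) (I : choiceType) (s : I -> ser G) : ser G :=
  fun w => \sum_(i \in [set: I]) s i w.

Definition gen (G : finType) (x : G) : ser G := fun w => (w == [:: x])%:R.

Definition sone (G : finType) : ser G := fun w => (w == [::])%:R.
Arguments sone : clear implicits.

Definition smul (G : finType) (f g : ser G) : ser G :=
  fun w => \sum_(k < (size w).+1) f (take k w) * g (drop k w).

Definition sexp (G : finType) (f : ser G) : ser G :=
  ssum (fun m : nat => (m`!%:R)^-1 *: iter m (smul f) (sone G)).

Definition slog (G : finType) (f : ser G) : ser G :=
  ssum (fun m : nat =>
    ((-1) ^+ m / m.+1%:R) *: iter m.+1 (smul (f - sone G)) (sone G)).

Definition bch (G : finType) (x y : ser G) : ser G :=
  slog (smul (sexp x) (sexp y)).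

Definition bchs (G : finType) (s : seq (ser G)) : ser G := foldr (@bch G) 0 s.

Definition mu2 (G : finType) (x y : ser G) : ser G :=
  bch x ((1 / 2) *: bch (- x) y).

(* The value of a series [p] in the letters [I] at the series [x i]. *)
Definition seval (I G : finType) (x : I -> ser G) (p : ser I) : ser G :=
  ssum (fun u : seq I => p u *: foldr (@smul G) (sone G) [seq x i | i <- u]).

(* The value of a series [p] in the letters [I] at the operators [T i], acting
   on [f]; a word acts by composition, its last letter first. *)
Definition opeval (I G : finType) (T : I -> ser G -> ser G) (p : ser I)
    (f : ser G) : ser G :=
  ssum (fun u : seq I => p u *: foldr (fun i y => T i y) f u).

(* The length-[k] part of a series, that is, its part with k.-1 brackets. *)
Definition hpart (G : finType) (k : nat) (f : ser G) : ser G :=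
  fun w => if size w == k then f w else 0.

(** * Gradings and brackets *)

Definition sgn (m : int) : rat := (-1) ^ m.

Definition wdeg (G : finType) (deg : G -> int) (w : seq G) : int :=
  \sum_(x <- w) deg x.

Definition br (G : finType) (deg : G -> int) (f g : ser G) : ser G :=
  fun w => \sum_(k < (size w).+1)
    (f (take k w) * g (drop k w)
     - sgn (wdeg deg (take k w) * wdeg deg (drop k w))
         * (g (take k w) * f (drop k w))).

Inductive lie_poly (G : finType) (deg : G -> int) (S : set G) : ser G -> Prop :=
| lp_gen x : S x -> lie_poly deg S (gen x)
| lp_zero : lie_poly deg S 0
| lp_add f g : lie_poly deg S f -> lie_poly deg S g -> lie_poly deg S (f + g)
| lp_scale (c : rat) f : lie_poly deg S f -> lie_poly deg S (c *: f)
| lp_br f g :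
    lie_poly deg S f -> lie_poly deg S g -> lie_poly deg S (br deg f g).

(* The (completed) Lie algebra generated by the generators in [S]. *)
Definition lie_gen (G : finType) (deg : G -> int) (S : set G) (f : ser G)
    : Prop :=
  forall k : nat, lie_poly deg S (hpart k f).

Definition homog (G : finType) (deg : G -> int) (m : int) (f : ser G) : Prop :=
  forall w, f w != 0 -> wdeg deg w = m.

(* [cfree deg m] is the degree-[m] piece of the completed free graded Lie
   algebra, [pfree deg m] that of the uncompleted one. *)
Definition cfree (G : finType) (deg : G -> int) (m : int) : set (ser G) :=
  [set f | homog deg m f /\ lie_gen deg [set: G] f].

Definition pfree (G : finType) (deg : G -> int) (m : int) : set (ser G) :=
  [set f | homog deg m f /\ lie_poly deg [set: G] f].

(** * Differential graded Lie algebras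

    A graded vector space is a family of independent subspaces [A m] of an
    ambient space; the algebra is their direct sum, so the bracket and the
    differential only matter on the [A m]. *)

Record graded_lie (V : lmodType rat) (A : int -> set V) (b : V -> V -> V)
    : Prop := GradedLie {
  gl_zero : forall m, A m 0;
  gl_sub : forall m (c : rat) x y, A m x -> A m y -> A m (c *: x + y);
  gl_direct : forall (s : seq int) (x : int -> V), uniq s ->
    (forall m, A m (x m)) -> \sum_(m <- s) x m = 0 ->
    forall m, m \in s -> x m = 0;
  gl_br : forall m n x y, A m x -> A n y -> A (m + n) (b x y);
  gl_linl : forall m n (c : rat) x x' y, A m x -> A m x' -> A n y ->
    b (c *: x + x') y = c *: b x y + b x' y;
  gl_linr : forall m n (c : rat) x y y', A m x -> A n y -> A n y' ->
    b x (c *: y + y') = c *: b x y + b x y';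
  gl_anti : forall m n x y, A m x -> A n y -> b y x = - (sgn (m * n) *: b x y);
  gl_jacobi : forall m n p x y z, A m x -> A n y -> A p z ->
    b (b x y) z = b x (b y z) - sgn (m * n) *: b y (b x z) }.

Record derivation (V : lmodType rat) (A : int -> set V) (b : V -> V -> V)
    (d : V -> V) : Prop := Derivation {
  der_deg : forall m x, A m x -> A (m - 1) (d x);
  der_lin : forall m (c : rat) x y, A m x -> A m y ->
    d (c *: x + y) = c *: d x + d y;
  der_leibniz : forall m n x y, A m x -> A n y ->
    d (b x y) = b (d x) y + sgn m *: b x (d y) }.

Record dgla (V : lmodType rat) (A : int -> set V) (b : V -> V -> V)
    (d : V -> V) : Prop := DGLA {
  dgla_lie : graded_lie A b;
  dgla_der : derivation A b d;
  dgla_sq : forall m x, A m x -> d (d x) = 0 }.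

Record lie_morphism (V W : lmodType rat) (A : int -> set V) (b : V -> V -> V)
    (B : int -> set W) (c : W -> W -> W) (psi : V -> W) : Prop := LieMorphism {
  lm_deg : forall m x, A m x -> B m (psi x);
  lm_lin : forall m (k : rat) x y, A m x -> A m y ->
    psi (k *: x + y) = k *: psi x + psi y;
  lm_br : forall m n x y, A m x -> A n y -> psi (b x y) = c (psi x) (psi y) }.

(* Universal property of the graded Lie algebra generated by [G], before
   completion. *)
Definition freely_generated (G : finType) (deg : G -> int) : Prop :=
  graded_lie (pfree deg) (br deg) /\
  forall (W : lmodType rat) (B : int -> set W) (c : W -> W -> W),
    graded_lie B c ->
    forall phi : G -> W, (forall x, B (deg x) (phi x)) ->
    exists psi : ser G -> W,
      [/\ lie_morphism (pfree deg) (br deg) B c psi,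
          forall x, psi (gen x) = phi x
        & forall psi', lie_morphism (pfree deg) (br deg) B c psi' ->
            (forall x, psi' (gen x) = phi x) ->
            forall m f, pfree deg m f -> psi' f = psi f].

(* A derivation of the completed free graded Lie algebra, compatible with the
   completion: it is then determined by its values on the generators. *)
Record cderivation (G : finType) (deg : G -> int) (d : ser G -> ser G)
    : Prop := CDerivation {
  cder_der : derivation (cfree deg) (br deg) d;
  cder_filt : forall m (k : nat) f, cfree deg m f ->
    (forall w, (size w < k)%N -> f w = 0) ->
    forall w, (size w < k)%N -> d f w = 0 }.

Definition is_point (G : finType) (deg : G -> int) (d : ser G -> ser G)
    (a : ser G) : Prop :=
  cfree deg (-1) a /\ d a + (1 / 2) *: br deg a a = 0.

Definition dpt (G : finType) (deg : G -> int) (d : ser G -> ser G)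
    (a f : ser G) : ser G :=
  d f + br deg a f.

(* The formal power series with coefficients [c], in the operator [ad e]. *)
Definition adser (G : finType) (deg : G -> int) (c : nat -> rat)
    (e f : ser G) : ser G :=
  ssum (fun m : nat => c m *: iter m (br deg e) f).

Definition expad (G : finType) (deg : G -> int) (e f : ser G) : ser G :=
  adser deg (fun m => (m`!%:R)^-1) e f.

Definition flow (G : finType) (deg : G -> int) (d : ser G -> ser G)
    (e a : ser G) : ser G :=
  expad deg (- e) a + adser deg (fun m => (-1) ^+ m / (m.+1)`!%:R) e (d e).

(* [psinv c] is the multiplicative inverse of the power series with
   coefficients [c] (where [c 0 != 0]); [psinv_seq c m] lists its first [m]
   coefficients. *)
Fixpoint psinv_seq (c : nat -> rat) (m : nat) : seq rat :=
  if m is k.+1 then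
    let s := psinv_seq c k in
    rcons s (((k == 0)%:R - \sum_(i < k) c (k - i)%N * s`_i) / c 0%N)
  else [::].

Definition psinv (c : nat -> rat) (m : nat) : rat := (psinv_seq c m.+1)`_m.

(* E / (1 - exp E) and E / (1 - exp (- E)), as inverses of the power series
   (1 - exp E) / E and (1 - exp (- E)) / E. *)
Definition todd_neg : nat -> rat := psinv (fun m => - ((m.+1)`!%:R)^-1).
Definition todd_pos : nat -> rat :=
  psinv (fun m => (-1) ^+ m / (m.+1)`!%:R).

(** * Cell complexes and their models

    A finite regular CW complex with oriented cells is given by the
    coefficients [inc y z] of the cells [z] in the geometric boundary of [y].
    By regularity every face of a cell is reached through successive boundaries,
   so these coefficients determine the closures.  [regular_cw] collects the
   combinatorial properties of the incidence numbers of such a complex. *)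

Record cellcx := CellCx {
  cell :> finType;
  cdim : cell -> nat;
  inc : cell -> cell -> int }.

Definition cdeg (X : cellcx) (y : X) : int := (cdim y)%:Z - 1.

Definition bdry (X : cellcx) (y : X) : ser X :=
  \sum_(z : X) (inc y z)%:~R *: gen z.

Definition closure_of (X : cellcx) (y : X) : set X :=
  [set z | connect (fun s t : X => inc s t != 0) y z].

Definition bdry_closure (X : cellcx) (y : X) : set X :=
  [set z | exists2 t : X, inc y t != 0 & closure_of t z].

Record regular_cw (X : cellcx) : Prop := RegularCW {
  rcw_dim : forall y z : X, inc y z != 0 -> cdim y = (cdim z).+1;
  rcw_sign : forall y z : X, inc y z \in [:: -1; 0; 1];
  rcw_bdry : forall y : X, (0 < cdim y)%N -> exists z : X, inc y z != 0;
  rcw_edge : forall y : X, cdim y = 1%N ->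
    #|[pred z : X | inc y z != 0]| = 2%N /\ \sum_(z : X) inc y z = 0;
  rcw_diamond : forall y z : X, closure_of y z -> cdim y = (cdim z).+2 ->
    #|[pred t : X | (inc y t != 0) && (inc t z != 0)]| = 2%N;
  rcw_sq : forall y z : X, \sum_(t : X) inc y t * inc t z = 0 }.

Record is_model (X : cellcx) (d : ser X -> ser X) : Prop := IsModel {
  mod_regular : regular_cw X;
  mod_free : freely_generated (@cdeg X);
  mod_dgla : dgla (cfree (@cdeg X)) (br (@cdeg X)) d;
  mod_cder : cderivation (@cdeg X) d;
  mod_vertex : forall a : X, cdim a = 0%N -> is_point (@cdeg X) d (gen a);
  mod_linear : forall y : X, (0 < cdim y)%N -> hpart 1 (d (gen y)) = bdry y;
  mod_local : forall y : X, lie_gen (@cdeg X) (closure_of y) (d (gen y)) }.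

Definition localised (X : cellcx) (d : ser X -> ser X) (y : X) (p : ser X)
    : Prop :=
  [/\ (1 < cdim y)%N, is_point (@cdeg X) d p
    & lie_gen (@cdeg X) (bdry_closure y) (dpt (@cdeg X) d p (gen y))].

(** * Universal averages and the series Q

    Ordinary Lie series are taken with all letters in degree 0. *)

Definition deg0 (I : finType) (i : I) : int := 0.

Record universal_average (n : nat) (mu : ser 'I_n) : Prop := UniversalAverage {
  ua_lie : lie_gen (@deg0 'I_n) [set: 'I_n] mu;
  ua_sym : forall s : 'S_n, seval (fun i : 'I_n => gen (s i)) mu = mu;
  ua_odd : seval (fun i => - gen i) mu = - mu;
  ua_flow : forall (X : cellcx) (d : ser X -> ser X), is_model d ->
    forall a b : ser X, is_point (@cdeg X) d a -> is_point (@cdeg X) d b ->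
    forall x : 'I_n -> ser X, (forall i, cfree (@cdeg X) 0 (x i)) ->
    (forall i, flow (@cdeg X) d (x i) a = b) ->
    flow (@cdeg X) d (seval x mu) a = b;
  ua_lin : hpart 1 mu = n%:R^-1 *: \sum_(i < n) gen i;
  ua_quad : hpart 2 mu = 0;
  ua_cubic : hpart 3 mu = - ((12 * n ^ 2)%:R^-1 *:
    \sum_(i < n) \sum_(j < n | j != i)
      br (@deg0 'I_n) (gen i) (br (@deg0 'I_n) (gen i) (gen j)));
  ua_two : n = 2%N -> forall i j : 'I_n, val i = 0%N -> val j = 1%N ->
    mu = mu2 (gen i) (gen j) }.

(* The two letters of a series in two non-commuting variables. *)
Definition lX : bool := false.
Definition lY : bool := true.

(* BCH as a formal series in two letters, to be applied to operators. *)
Definition bch_ser : ser bool := bch (gen lX) (gen lY).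

Definition two_ops (V : Type) (S T : V -> V) (l : bool) : V -> V :=
  if l then T else S.

(* Associative words: [:: lY; lX] is YX, which acts as X followed by Y. *)
Record bch_remainder (Q : ser bool) : Prop := BchRemainder {
  q_const : Q [::] = 0;
  q_X : Q [:: lX] = 1 / 2;
  q_Y : Q [:: lY] = 0;
  q_XX : Q [:: lX; lX] = 1 / 12;
  q_XY : Q [:: lX; lY] = 0;
  q_YX : Q [:: lY; lX] = - (1 / 12);
  q_YY : Q [:: lY; lY] = 0;
  q_bch : bch (gen lX) (gen lY) = gen lX + gen lY +
    opeval (fun l => br (@deg0 bool) (gen l)) Q (gen lY) }.

(** * The banana

    The residue of i modulo n is represented in 'I_n, so 0 stands for the index
    n; the residue i + 1 is [ordS i], and - i - 1 is [rev_ord i]. *)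

Inductive banana_cell (n : nat) : Type :=
  Va | Vb | Ve of 'I_n | Vf of 'I_n | Vh.

Arguments Va {n}.
Arguments Vb {n}.
Arguments Vh {n}.

Definition banana_enc (n : nat) (c : banana_cell n)
    : bool + ('I_n + 'I_n) + unit :=
  match c with
  | Va => inl (inl false)
  | Vb => inl (inl true)
  | Ve i => inl (inr (inl i))
  | Vf i => inl (inr (inr i))
  | Vh => inr tt
  end.

Definition banana_dec (n : nat) (c : bool + ('I_n + 'I_n) + unit)
    : banana_cell n :=
  match c with
  | inl (inl false) => Va
  | inl (inl true) => Vb
  | inl (inr (inl i)) => Ve i
  | inl (inr (inr i)) => Vf i
  | inr tt => Vh
  end.

Lemma banana_encK (n : nat) : cancel (@banana_enc n) (@banana_dec n).
Proof. by case. Qed.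

HB.instance Definition _ (n : nat) :=
  Finite.copy (banana_cell n) (can_type (@banana_encK n)).

Definition banana_dim (n : nat) (c : banana_cell n) : nat :=
  match c with Va | Vb => 0 | Ve _ => 1 | Vf _ => 2 | Vh => 3 end.

Definition banana_inc (n : nat) (y z : banana_cell n) : int :=
  match y, z with
  | Ve _, Va => -1
  | Ve _, Vb => 1
  | Vf i, Ve j => (j == i)%:Z - (j == ordS i)%:Z
  | Vh, Vf _ => 1
  | _, _ => 0
  end.

Definition banana (n : nat) : cellcx :=
  CellCx (@banana_dim n) (@banana_inc n).

Definition bdeg (n : nat) : banana_cell n -> int := @cdeg (banana n).

Definition bser (n : nat) : Type := ser (banana_cell n).

Definition ga (n : nat) : bser n := gen Va.
Definition gb (n : nat) : bser n := gen Vb.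
Definition ge (n : nat) (i : 'I_n) : bser n := gen (Ve i).
Definition gf (n : nat) (i : 'I_n) : bser n := gen (Vf i).
Definition gh (n : nat) : bser n := gen Vh.

Arguments ga : clear implicits.
Arguments gb : clear implicits.
Arguments gh : clear implicits.

Definition bbr (n : nat) : bser n -> bser n -> bser n := br (@bdeg n).

Definition vedge (n : nat) (i : 'I_n) : bser n := mu2 (ge i) (ge (ordS i)).

Definition vmean (n : nat) (mu : ser 'I_n) : bser n := seval (@ge n) mu.

Definition xface (n : nat) (d : bser n -> bser n) (i : 'I_n) : bser n :=
  flow (@bdeg n) d ((1 / 2) *: vedge i) (ga n).

Definition xcentre (n : nat) (mu : ser 'I_n) (d : bser n -> bser n) : bser n :=
  flow (@bdeg n) d ((1 / 2) *: vmean mu) (ga n).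

Definition gf' (n : nat) (i : 'I_n) : bser n :=
  expad (@bdeg n) ((1 / 2) *: vedge i) (gf i).

(* The operator BCH(E_j, - E_i), where E_i = ad e_i. *)
Definition bchE (n : nat) (j i : 'I_n) : bser n -> bser n :=
  opeval (two_ops (bbr (ge j)) (fun f => - bbr (ge i) f)) bch_ser.

Record banana_differential (n : nat) (mu : ser 'I_n) (Q : ser bool)
    (d : bser n -> bser n) : Prop := BananaDifferential {
  bd_der : cderivation (@bdeg n) d;
  bd_a : d (ga n) = - ((1 / 2) *: bbr (ga n) (ga n));
  bd_b : d (gb n) = - ((1 / 2) *: bbr (gb n) (gb n));
  bd_e : forall i : 'I_n, d (ge i) =
    adser (@bdeg n) todd_neg (ge i) (ga n) + adser (@bdeg n) todd_pos (ge i) (gb n);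
  bd_f : forall i : 'I_n, d (gf i) =
    bchs [:: - ((1 / 2) *: vedge i); ge i; - ge (ordS i); (1 / 2) *: vedge i]
    - bbr (xface d i) (gf i);
  bd_h : expad (@bdeg n) ((1 / 2) *: vmean mu)
           (dpt (@bdeg n) d (xcentre mu d) (gh n)) =
    \sum_(i < n) gf' i
    + (2 * n)%:R^-1 *:
      \sum_(i < n) \sum_(j < n | (j != i) && (j != ordS i))
        (opeval (two_ops (bchE j i) (bchE i (ordS i))) Q (gf' i)
         + opeval (two_ops (bchE j (ordS i)) (bchE (ordS i) i)) Q (gf' i)) }.

Definition tau_gen (n : nat) (c : banana_cell n) : bser n :=
  match c with
  | Va => ga n
  | Vb => gb n
  | Ve i => ge (ordS i)
  | Vf i => gf (ordS i)
  | Vh => gh n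
  end.

Definition sigma_gen (n : nat) (c : banana_cell n) : bser n :=
  match c with
  | Va => ga n
  | Vb => gb n
  | Ve i => ge (ordS (rev_ord i))
  | Vf i => - gf (rev_ord i)
  | Vh => - gh n
  end.

(* The automorphisms of the Lie algebra induced by the elements of the group
   generated by sigma and tau, extended to all series by substitution. *)
Inductive Dn (n : nat) : (bser n -> bser n) -> Prop :=
| Dn_sigma : Dn (seval (@sigma_gen n))
| Dn_tau : Dn (seval (@tau_gen n))
| Dn_id : Dn id
| Dn_comp g g' : Dn g -> Dn g' -> Dn (g \o g')
| Dn_inv g g' : Dn g -> cancel g g' -> cancel g' g -> Dn g'.

(* Main.v *)
Require Import Defs.
From HB Require Import structures.
From mathcomp Require Import all_boot all_order all_algebra perm ring.
From mathcomp Require Import all_classical.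

Set Implicit Arguments.
Unset Strict Implicit.
Unset Printing Implicit Defensive.

Import Order.TTheory GRing.Theory Num.Theory.
Local Open Scope ring_scope.

(** Everything takes place in the associative algebra of non-commutative power
    series, where the bracket is the graded commutator.  A map from
    generators to series without constant term extends uniquely to an odd
    derivation of this whole algebra, and the identities to be proved become
    identities between exponentials.

    Edges as parallel transport.  For a derivation [D] call [p] a gauge
    transformation from [s] to [t] when [D p = p t - s p].  These compose like
    paths, they are inverted like paths, and the flow of [a] along [e] is the
    target of the gauge transformation [exp e] with source [a]
    ([gauge_flow]).  The Todd series in the definition of [D e_i] say exactly
    that [exp e_i] goes from [a] to [b] ([flow_todd]); hence
    [D (D (exp e_i)) = 0], and [D (D e_i) = 0] by taking logarithms.  Every flow
    of [a] along a series in the edges is then a point ([flow_point]).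

    Faces.  The product [exp e_i exp (- e_j)] is a gauge transformation from [a]
    to itself, so the twisted differential at [a] kills it and its logarithm
    [L i j = BCH (e_i, - e_j)] ([dpt_loop]).  Transporting [L i (i+1)] to the
    centre [x_i] gives the value of the twisted differential on [f_i]
    ([hol_conj], [dpt_face]).  As the twisted differential at a point squares
    to [D^2] ([dpt_dpt]), this gives [D (D f_i) = 0].

    The 3-cell.  Let [R] be the sum over faces and correction terms.  After
    transport to [a] the statement [D (D h) = 0] reads [d_a R = 0].  The
    operators to which [Q] is applied are brackets with the series [L j i]
    ([bchE_loop]), which commute with [d_a]; and [d_a f'_i = L i (i+1)].  By the
    defining property of [Q] the two corrections for [(i, j)] are both sent to
    [L j (i+1) - L j i - L i (i+1)] ([rterm_loop], [rterm_pair]).  This vanishes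
    for [j = i] and [j = i+1], so the sum may be taken over all [j]; there the
    first two terms telescope around the banana and the third cancels the main
    term ([sum_cycle], [dpt_sphere]).

    Symmetry.  Rotations only shift indices.  A reflection exchanges the two
    edges of each face, hence inverts [L i (i+1)] and exchanges the two kinds of
    correction terms; it permutes the centres of the faces because [mu2] is
    symmetric ([mu2C]), and fixes that of the 3-cell because the universal
    average is.  A substitution commutes with [D] as soon as it does on
    generators ([od_seval_comm]).

    The values of [D] are Lie series because the defining property of [Q]
    writes BCH as a sum of brackets ([bch_opeval]).  That Lie polynomials form
    the free graded Lie algebra follows from Dynkin's argument ([dynkin_br_aux],
    [freely_generated_pfree]).  Analytic identities are reduced to recursions:
    one along the first letter whose steps raise the word length has at most one
    solution ([opeval_unique]), and identities in one variable are differential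
    equations for the derivation [euler]. *)

(** * Power series as an algebra *)

HB.instance Definition _ (G : finType) :=
  GRing.Lmodule.copy (ser G) (seq G -> rat^o).

(** The left quotient of a series by a letter.  A series is the sum of its
    constant term and of the products of the letters with these quotients, and
    nearly every identity below is proved by recursion along this
    decomposition. *)
Definition lquo (G : finType) (x : G) (f : ser G) : ser G := fun w => f (x :: w).

Section SeriesRing.
Variable G : finType.
Implicit Types (f g h : ser G) (x : G) (w : seq G).

Lemma addsE f g w : (f + g) w = f w + g w. Proof. by []. Qed.
Lemma oppsE f w : (- f) w = - f w. Proof. by []. Qed.
Lemma scalesE (c : rat) f w : (c *: f) w = c * f w. Proof. by []. Qed.
Lemma smul_nil f g : smul f g [::] = f [::] * g [::].
Proof. by rewrite /smul big_ord_recl big_ord0 /= addr0. Qed.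

Lemma smul_cons f g x w :
  smul f g (x :: w) = smul (lquo x f) g w + f [::] * g (x :: w).
Proof. by rewrite /smul big_ord_recl /= addrC. Qed.

Fact smulDl : left_distributive (@smul G) +%R.
Proof.
move=> f g h; apply/funext => w; rewrite addsE -big_split /=.
by apply: eq_bigr => k _; rewrite mulrDl.
Qed.

Fact smulDr : right_distributive (@smul G) +%R.
Proof.
move=> f g h; apply/funext => w; rewrite addsE -big_split /=.
by apply: eq_bigr => k _; rewrite mulrDr.
Qed.

Fact smulZl (c : rat) f g : c *: smul f g = smul (c *: f) g.
Proof.
apply/funext => w; rewrite scalesE /smul mulr_sumr.
by apply: eq_bigr => k _; rewrite mulrA.
Qed.

Fact smulZr (c : rat) f g : c *: smul f g = smul f (c *: g).
Proof.
apply/funext => w; rewrite scalesE /smul mulr_sumr.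
by apply: eq_bigr => k _; rewrite scalesE mulrCA.
Qed.

Lemma lquo_smul x f g :
  lquo x (smul f g) = smul (lquo x f) g + f [::] *: lquo x g.
Proof. by apply/funext => w; rewrite /lquo smul_cons. Qed.

Fact smulA : associative (@smul G).
Proof.
move=> f g h; apply/funext => w; elim: w f g h => [|x w IH] f g h.
  by rewrite !smul_nil mulrA.
rewrite smul_cons IH [RHS]smul_cons lquo_smul smulDl -smulZl addsE scalesE.
by rewrite smul_cons smul_nil mulrDr addrA mulrA.
Qed.

Fact smul1s : left_id (sone G) (@smul G).
Proof.
move=> f; apply/funext => -[|x w]; first by rewrite smul_nil mul1r.
rewrite smul_cons mul1r -[RHS]add0r; congr (_ + _).
by rewrite /smul big1 // => k _; rewrite mul0r.
Qed.

Fact smuls1 : right_id (sone G) (@smul G).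
Proof.
move=> f; apply/funext => w; elim: w f => [|x w IH] f.
  by rewrite smul_nil mulr1.
by rewrite smul_cons IH mulr0 addr0.
Qed.

HB.instance Definition _ := GRing.Zmodule_isPzRing.Build (ser G)
  smulA smul1s smuls1 smulDl smulDr.

Fact sone_neq0 : (1 : ser G) != 0.
Proof. by apply/eqP => /(congr1 (@^~ [::])). Qed.

HB.instance Definition _ := GRing.PzSemiRing_isNonZero.Build (ser G) sone_neq0.
HB.instance Definition _ :=
  GRing.Lmodule_isLalgebra.Build rat (ser G) smulZl.
HB.instance Definition _ :=
  GRing.Lalgebra_isAlgebra.Build rat (ser G) smulZr.

End SeriesRing.

Section Basics.
Variable G : finType.
Implicit Types (f g h : ser G) (x : G) (w : seq G).

Lemma mulsE f g : smul f g = f * g. Proof. by []. Qed.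
Lemma mul_sE f g w :
  (f * g) w = \sum_(k < (size w).+1) f (take k w) * g (drop k w).
Proof. by []. Qed.

Lemma mul_nil f g : (f * g) [::] = f [::] * g [::].
Proof. exact: smul_nil. Qed.

Lemma mul_cons f g x w :
  (f * g) (x :: w) = (lquo x f * g) w + f [::] * g (x :: w).
Proof. exact: smul_cons. Qed.

Lemma lquoM x f g : lquo x (f * g) = lquo x f * g + f [::] *: lquo x g.
Proof. exact: lquo_smul. Qed.

Lemma lquoD x f g : lquo x (f + g) = lquo x f + lquo x g. Proof. by []. Qed.
Lemma lquoZ x (c : rat) f : lquo x (c *: f) = c *: lquo x f. Proof. by []. Qed.
Lemma lquo1 x : lquo x 1 = 0. Proof. by []. Qed.

Lemma lquo_gen x y : lquo x (gen y) = (x == y)%:R.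
Proof.
apply/funext => w; rewrite /lquo /gen eqseq_cons.
by case: (x == y); case: w.
Qed.

Lemma gen_nil x : gen x [::] = 0. Proof. by []. Qed.

Lemma sum_sE (I : Type) (r : seq I) (P : pred I) (F : I -> ser G) w :
  (\sum_(i <- r | P i) F i) w = \sum_(i <- r | P i) F i w.
Proof. by elim/big_rec2: _ => // i y z _ <-. Qed.

Lemma gen_mul_cons x y f w : (gen x * f) (y :: w) = (y == x)%:R * f w.
Proof.
rewrite mul_cons lquo_gen gen_nil mul0r addr0.
by case: eqP => _; rewrite ?mul1r ?mul0r.
Qed.

Lemma gen_mul_nil x f : (gen x * f) [::] = 0.
Proof. by rewrite mul_nil gen_nil mul0r. Qed.

Lemma lquo_rec f : f = f [::] *: 1 + \sum_x gen x * lquo x f.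
Proof.
apply/funext => -[|y w]; rewrite addsE scalesE sum_sE.
  by rewrite big1 ?addr0 ?mulr1 // => x _; rewrite gen_mul_nil.
rewrite mulr0 add0r (bigD1 y) //= gen_mul_cons eqxx mul1r big1 ?addr0 //.
by move=> x /negPf xy; rewrite gen_mul_cons eq_sym xy mul0r.
Qed.

(** Congruence modulo the words of length at least [k]: the topology of the
    completion. *)
Definition eqm (k : nat) f g := forall w, (size w < k)%N -> f w = g w.

Lemma eqm_refl k f : eqm k f f. Proof. by []. Qed.

Lemma eqm_sym k f g : eqm k f g -> eqm k g f.
Proof. by move=> fg w /fg. Qed.

Lemma eqm_trans k g f h : eqm k f g -> eqm k g h -> eqm k f h.
Proof. by move=> fg gh w wk; rewrite fg // gh. Qed.

Lemma eqmP f g : (forall k, eqm k f g) -> f = g.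
Proof. by move=> fg; apply/funext => w; apply: (fg (size w).+1). Qed.

Lemma eqm_le k l f g : (k <= l)%N -> eqm l f g -> eqm k f g.
Proof. by move=> kl fg w wk; apply: fg; apply: leq_trans wk kl. Qed.

Lemma eqmD k f f' g g' : eqm k f f' -> eqm k g g' -> eqm k (f + g) (f' + g').
Proof. by move=> ff gg w wk; rewrite !addsE ff ?gg. Qed.

Lemma eqmZ k (c : rat) f f' : eqm k f f' -> eqm k (c *: f) (c *: f').
Proof. by move=> ff w wk; rewrite !scalesE ff. Qed.

Lemma eqm_sum k (I : Type) (r : seq I) (P : pred I) (F F' : I -> ser G) :
  (forall i, P i -> eqm k (F i) (F' i)) ->
  eqm k (\sum_(i <- r | P i) F i) (\sum_(i <- r | P i) F' i).
Proof.
by move=> FF w wk; rewrite !sum_sE; apply: eq_bigr => i Pi; apply: FF.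
Qed.

Lemma eqm0_sum k (I : Type) (r : seq I) (P : pred I) (F : I -> ser G) :
  (forall i, P i -> eqm k (F i) 0) -> eqm k (\sum_(i <- r | P i) F i) 0.
Proof.
move=> F0 w wk; rewrite sum_sE; apply: big1 => i Pi; exact: F0.
Qed.

Lemma eqm_subr k f g : eqm k (f - g) 0 <-> eqm k f g.
Proof.
split=> fg w /fg; first by rewrite addsE oppsE => /eqP; rewrite subr_eq0 => /eqP.
by rewrite addsE oppsE => ->; rewrite subrr.
Qed.

Lemma eqmM k f f' g g' : eqm k f f' -> eqm k g g' -> eqm k (f * g) (f' * g').
Proof.
move=> ff gg w wk; apply: eq_bigr => i _.
rewrite ff ?gg // ?size_drop ?size_take_min.
  exact: leq_ltn_trans (leq_subr _ _) wk.
exact: leq_ltn_trans (geq_minr _ _) wk.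
Qed.

Lemma eqm0_lquo k f : f [::] = 0 -> (forall x, eqm k (lquo x f) 0) ->
  eqm k.+1 f 0.
Proof. by move=> f0 fq [|x w] wk //; rewrite -[LHS]/(lquo x f w) fq. Qed.

Lemma lquo_eqm k f x : eqm k.+1 f 0 -> eqm k (lquo x f) 0.
Proof. by move=> f0 w wk; apply: f0. Qed.

Lemma eqm0M k l f g : eqm k f 0 -> eqm l g 0 -> eqm (k + l) (f * g) 0.
Proof.
elim: k f => [|k IH] f fk gl.
  have -> : (0 : ser G) = f * 0 by rewrite mulr0.
  by apply: eqmM.
rewrite addSn; apply: eqm0_lquo => [|x]; first by rewrite mul_nil fk ?mul0r.
by rewrite lquoM fk // scale0r addr0; apply: IH => //; apply: lquo_eqm.
Qed.

Lemma eqm1 f g : eqm 1 f g <-> f [::] = g [::].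
Proof. by split=> [|fg []//]; apply. Qed.

Lemma eqmM_pos k f g h : f [::] = 0 -> eqm k g h -> eqm k.+1 (f * g) (f * h).
Proof.
move=> f0 /eqm_subr gh; apply/eqm_subr; rewrite -mulrBr -add1n.
by apply: eqm0M => //; apply/eqm1.
Qed.

Lemma eqmM_posr k f g h : f [::] = 0 -> eqm k g h -> eqm k.+1 (g * f) (h * f).
Proof.
move=> f0 /eqm_subr gh; apply/eqm_subr; rewrite -mulrBl -addn1.
by apply: eqm0M => //; apply/eqm1.
Qed.

End Basics.

Section Linear.
Variables (I G : finType).
Variable M : ser I -> ser G.
Hypothesis linM : linear M.

Lemma lin0 : M 0 = 0.
Proof.
have := linM 1 0 0; rewrite scaler0 addr0 scale1r => M0.
by apply: (addrI (M 0)); rewrite -M0 addr0.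
Qed.

Lemma linZ (c : rat) f : M (c *: f) = c *: M f.
Proof. by rewrite -[c *: f]addr0 linM lin0 addr0. Qed.

Lemma linD f g : M (f + g) = M f + M g.
Proof. by rewrite -[f in LHS]scale1r linM scale1r. Qed.

Lemma linN f : M (- f) = - M f.
Proof. by rewrite -scaleN1r linZ scaleN1r. Qed.

Lemma linB f g : M (f - g) = M f - M g.
Proof. by rewrite linD linN. Qed.

Lemma lin_sum (J : Type) (r : seq J) (P : pred J) (F : J -> ser I) :
  M (\sum_(i <- r | P i) F i) = \sum_(i <- r | P i) M (F i).
Proof. by elim/big_rec2: _ => [|i y z _ <-]; [exact: lin0 | rewrite linD]. Qed.

End Linear.

(** An operator which raises word length can be substituted into formal power
    series. *)
Record contraction (G : finType) (T : ser G -> ser G) : Prop := Contraction {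
  contr_lin : linear T;
  contr_len : forall k f, eqm k f 0 -> eqm k.+1 (T f) 0 }.

Lemma contr_eqm (G : finType) (T : ser G -> ser G) k f g :
  contraction T -> eqm k f g -> eqm k.+1 (T f) (T g).
Proof.
move=> [linT lenT] /eqm_subr fg; apply/eqm_subr.
by rewrite -linB //; apply: lenT.
Qed.

Lemma contrM (G : finType) (x : ser G) : x [::] = 0 -> contraction (smul x).
Proof.
move=> x0; split=> [c f g|k f f0]; first by rewrite mulsE mulrDr scalerAr.
by rewrite mulsE -add1n; apply: eqm0M => //; apply/eqm1.
Qed.

Lemma contrZ (G : finType) (T : ser G -> ser G) (c : rat) :
  contraction T -> contraction (fun f => c *: T f).
Proof.
move=> [linT lenT]; split=> [d f g|k f f0].
  by rewrite linT scalerDr !scalerA mulrC.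
by move=> w wk; rewrite scalesE (lenT _ _ f0) ?mulr0.
Qed.

(** * Infinite sums *)

Lemma ssum_seqE (G : finType) (I : choiceType) (s : I -> ser G) (r : seq I) w :
  uniq r -> (forall i, i \notin r -> s i w = 0) ->
  ssum s w = \sum_(i <- r) s i w.
Proof.
move=> ur s0; rewrite /ssum [RHS]fsbig_seq //; apply/esym/fsbig_widen => //.
by move=> i [_] /= /negP /s0.
Qed.

Lemma ssum_natE (G : finType) (s : nat -> ser G) N w :
  (forall m, (N <= m)%N -> s m w = 0) -> ssum s w = \sum_(m < N) s m w.
Proof.
move=> s0; rewrite (@ssum_seqE _ _ _ (iota 0 N)) ?iota_uniq //.
  by rewrite -(big_mkord xpredT (fun m => s m w)) /index_iota subn0.
by move=> m; rewrite mem_iota add0n /= -leqNgt => /s0.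
Qed.

Fixpoint words (I : finType) (N : nat) : seq (seq I) :=
  if N is N'.+1 then [::] :: [seq i :: u | i <- enum I, u <- words I N']
  else [::].

Lemma mem_words (I : finType) N (u : seq I) : (u \in words I N) = (size u < N)%N.
Proof.
elim: N u => [|N IH] [|i u] //=; rewrite inE /= ltnS -IH.
apply/allpairsP/idP => [[[j v] /= [_ vN [_ ->]]] //|uN].
by exists (i, u); rewrite mem_enum.
Qed.

Lemma uniq_words (I : finType) N : uniq (words I N).
Proof.
elim: N => //= N IH; apply/andP; split; first by apply/allpairsP => -[[? ?] []].
apply: allpairs_uniq => //; first exact: enum_uniq.
by move=> [i u] [j v] _ _ [-> ->].
Qed.

Lemma ssum_wordsE (G I : finType) (s : seq I -> ser G) N w :
  (forall u, (N <= size u)%N -> s u w = 0) ->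
  ssum s w = \sum_(u <- words I N) s u w.
Proof.
move=> s0; apply: ssum_seqE (uniq_words _ _) _ => u.
by rewrite mem_words -leqNgt; apply: s0.
Qed.

Lemma big_words (R : nmodType) (I : finType) N (F : seq I -> R) :
  \sum_(u <- words I N.+1) F u =
  F [::] + \sum_i \sum_(u <- words I N) F (i :: u).
Proof. by rewrite big_cons big_allpairs_dep /= big_enum. Qed.

(** * Substituting operators into formal power series *)

Section Opeval.
Variables (I G : finType) (T : I -> ser G -> ser G).
Hypothesis contrT : forall i, contraction (T i).
Implicit Types (p q : ser I) (f : ser G).

Lemma opword_eqm0 k f u : eqm k f 0 ->
  eqm (size u + k) (foldr (fun i y => T i y) f u) 0.
Proof. by move=> f0; elim: u => //= i u IH; apply: contr_len. Qed.

Lemma opeval_wordsE p f N : eqm N (opeval T p f)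
  (\sum_(u <- words I N) p u *: foldr (fun i y => T i y) f u).
Proof.
move=> w wN; rewrite sum_sE; apply: ssum_wordsE => u uN.
rewrite scalesE (@opword_eqm0 0) ?mulr0 // addn0.
exact: leq_trans wN uN.
Qed.

Lemma opeval_rec p f :
  opeval T p f = p [::] *: f + \sum_i T i (opeval T (lquo i p) f).
Proof.
apply: eqmP => k; case: k => // k.
apply: (eqm_trans (@opeval_wordsE p f k.+1)); rewrite big_words.
apply: eqmD => //; apply: eqm_sum => i _; apply/eqm_sym.
apply: (eqm_trans (contr_eqm (contrT i) (@opeval_wordsE (lquo i p) f k))).
have linTi := contr_lin (contrT i).
by rewrite (lin_sum linTi); apply: eqm_sum => u _; rewrite (linZ linTi).
Qed.

(** The recursion determines the value, since every step raises the length;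
    it takes the place of rearrangements of infinite sums. *)
Lemma opeval_unique f (P : ser I -> ser G) :
  (forall p, P p = p [::] *: f + \sum_i T i (P (lquo i p))) ->
  forall p, P p = opeval T p f.
Proof.
move=> recP p; apply: eqmP => k; elim: k p => // k IH p.
rewrite recP opeval_rec; apply: eqmD => //.
by apply: eqm_sum => i _; apply: contr_eqm.
Qed.

Lemma linear_opeval f : linear (fun p => opeval T p f).
Proof.
move=> c p q; apply: eqmP => k; elim: k p q => // k IH p q.
rewrite [opeval T (_ + _) _]opeval_rec [opeval T p _]opeval_rec.
rewrite [opeval T q _]opeval_rec.
have -> : (c *: p + q) [::] *: f + \sum_i T i (opeval T (lquo i (c *: p + q)) f)
  = c *: (p [::] *: f) + q [::] *: f
    + \sum_i T i (opeval T (c *: lquo i p + lquo i q) f).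
  by rewrite addsE scalesE scalerDl scalerA.
rewrite scalerDr addrACA; apply: eqmD => //.
rewrite scaler_sumr -big_split /=; apply: eqm_sum => i _.
by rewrite -(contr_lin (contrT i)); apply: contr_eqm.
Qed.

Lemma opeval_linear p : linear (opeval T p).
Proof.
move=> c f g; apply: eqmP => k; elim: k p => // k IH p.
rewrite opeval_rec [opeval T p f]opeval_rec [opeval T p g]opeval_rec.
rewrite [X in eqm _ _ (X + _)]scalerDr addrACA; apply: eqmD.
  by rewrite scalerDr !scalerA mulrC.
rewrite scaler_sumr -big_split /=; apply: eqm_sum => i _.
by rewrite -(contr_lin (contrT i)); apply: contr_eqm.
Qed.

Lemma opeval1 f : opeval T 1 f = f.
Proof.
rewrite opeval_rec [X in X *: _]/= scale1r big1 ?addr0 // => i _.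
by rewrite lquo1 (lin0 (linear_opeval f)) (lin0 (contr_lin (contrT i))).
Qed.

Lemma opeval_mul p q f : opeval T (p * q) f = opeval T p (opeval T q f).
Proof.
apply: (opeval_unique (P := fun p => opeval T (p * q) f)) => {}p.
rewrite opeval_rec mul_nil; under eq_bigr => i _.
  rewrite lquoM (linD (linear_opeval f)) (linZ (linear_opeval f)).
  rewrite (linD (contr_lin (contrT i))) (linZ (contr_lin (contrT i))).
  over.
rewrite big_split /= addrCA addrC; congr (_ + _).
by rewrite -scaler_sumr -scalerA -scalerDr -opeval_rec.
Qed.

Lemma opeval_gen i f : opeval T (gen i) f = T i f.
Proof.
rewrite opeval_rec gen_nil scale0r add0r (bigD1 i) //= lquo_gen eqxx opeval1.
rewrite big1 ?addr0 // => j /negPf ji.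
by rewrite lquo_gen ji (lin0 (linear_opeval f)) (lin0 (contr_lin (contrT j))).
Qed.

Lemma opeval_eqm k p q f : eqm k p q -> eqm k (opeval T p f) (opeval T q f).
Proof.
elim: k p q => // k IH p q pq; rewrite opeval_rec [opeval T q f]opeval_rec pq //.
apply: eqmD => //; apply: eqm_sum => i _; apply: contr_eqm => //.
by apply: IH => w wk; apply: pq.
Qed.

Lemma opeval_nil p f : opeval T p f [::] = p [::] * f [::].
Proof.
rewrite opeval_rec addsE sum_sE big1 ?addr0 // => i _.
by apply: (contr_len (contrT i) (f:=opeval T (lquo i p) f) (k := 0)).
Qed.

End Opeval.

(** With the uniqueness of the recursion, this shows at once that substitutions
    are multiplicative and can be composed, and that derivations and
    conjugations pass through power series of operators. *)
Lemma opeval_intertwine (I G H : finType) (M : ser G -> ser H)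
    (T : I -> ser G -> ser G) (T' : I -> ser H -> ser H) p f :
  (forall i, contraction (T i)) -> (forall i, contraction (T' i)) ->
  linear M -> (forall i g, M (T i g) = T' i (M g)) ->
  M (opeval T p f) = opeval T' p (M f).
Proof.
move=> cT cT' linM MT.
apply: (opeval_unique cT' (P := fun p => M (opeval T p f))) => {}p.
rewrite opeval_rec // (linD linM) (linZ linM) (lin_sum linM).
by under eq_bigr do rewrite MT.
Qed.

Lemma eq_opeval (I G : finType) (T T' : I -> ser G -> ser G) p f :
  (forall i g, T i g = T' i g) -> opeval T p f = opeval T' p f.
Proof.
by move=> TT; congr (opeval _ p f); apply/funext => i; apply/funext => g.
Qed.

(** Every series is built from constants by left multiplications by letters, so
    a linear map intertwining these with contractions is determined by its value
    at [1]. *)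
Lemma lin_eq0 (I G : finType) (M : ser I -> ser G) (T : I -> ser G -> ser G) :
  (forall i, contraction (T i)) -> linear M -> M 1 = 0 ->
  (forall i f, M (gen i * f) = T i (M f)) -> forall f, M f = 0.
Proof.
move=> cT linM M1 MT f.
rewrite (opeval_unique cT (f := 0) (P := M)) => [|p].
  by rewrite (lin0 (opeval_linear cT f)).
rewrite [in LHS](lquo_rec p) (linD linM) (linZ linM) M1 (lin_sum linM) scaler0.
by congr (_ + _); apply: eq_bigr => i _; rewrite MT.
Qed.

(** * Substitution into formal power series *)

Section Seval.
Variables (I G : finType) (x : I -> ser G).
Hypothesis x0 : forall i, x i [::] = 0.
Implicit Types p q : ser I.

Let cx i : contraction (smul (x i)). Proof. exact: contrM. Qed.

Lemma sevalE p : seval x p = opeval (fun i => smul (x i)) p 1.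
Proof.
congr ssum; apply/funext => u; congr (_ *: _).
by elim: u => //= i u ->.
Qed.

Lemma linear_seval : linear (seval x).
Proof. by move=> c p q; rewrite !sevalE (linear_opeval cx). Qed.

Lemma seval1 : seval x 1 = 1. Proof. by rewrite sevalE opeval1. Qed.

Lemma seval_gen i : seval x (gen i) = x i.
Proof. by rewrite sevalE opeval_gen // smuls1. Qed.

Lemma opeval_smul p f : opeval (fun i => smul (x i)) p f = seval x p * f.
Proof.
rewrite sevalE (@opeval_intertwine _ _ _ (fun g : ser G => g * f)
  _ (fun i => smul (x i))) ?mul1r // => [c g h|i g].
- by rewrite mulrDl scalerAl.
- by rewrite !mulsE mulrA.
Qed.

Lemma sevalM p q : seval x (p * q) = seval x p * seval x q.
Proof. by rewrite -opeval_smul !sevalE opeval_mul. Qed.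

Lemma seval_nil p : seval x p [::] = p [::].
Proof. by rewrite sevalE opeval_nil // mulr1. Qed.

Lemma seval_eqm k p q : eqm k p q -> eqm k (seval x p) (seval x q).
Proof. by rewrite !sevalE; apply: opeval_eqm. Qed.

End Seval.

Lemma seval_comp (I J G : finType) (y : J -> ser G) (x : I -> ser J) p :
  (forall j, y j [::] = 0) -> (forall i, x i [::] = 0) ->
  seval y (seval x p) = seval (fun i => seval y (x i)) p.
Proof.
move=> y0 x0; rewrite [seval x p]sevalE //.
have z0 i : seval y (x i) [::] = 0 by rewrite seval_nil.
rewrite (opeval_intertwine (T' := fun i => smul (seval y (x i)))).
- by rewrite seval1 // -sevalE.
- by move=> i; apply: contrM.
- by move=> i; apply: contrM.
- exact: linear_seval.
- by move=> i g; rewrite mulsE sevalM.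
Qed.

Lemma seval_id (G : finType) (p : ser G) : seval (@gen G) p = p.
Proof.
pose M (p : ser G) := seval (@gen G) p - p.
suff /eqP : M p = 0 by rewrite subr_eq0 => /eqP.
apply: (@lin_eq0 _ _ M (fun i => smul (gen i))) => [i|c f g||i f].
- exact: contrM.
- by rewrite /M (linear_seval (@gen_nil G)) scalerBr opprD addrACA.
- by rewrite /M (seval1 (@gen_nil G)) subrr.
- by rewrite /M (sevalM (@gen_nil G)) (seval_gen (@gen_nil G)) -mulrBr.
Qed.

(** * Exponential and logarithm *)

(** The power series in one variable with coefficients [c], as a series in a
    one-letter alphabet: substitution and composition of operators are then
    the ones studied above. *)
Definition pw (c : nat -> rat) : ser unit := fun u => c (size u).

Lemma big_words_unit (R : nmodType) N (F : nat -> R) :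
  \sum_(u <- words unit N) F (size u) = \sum_(m < N) F m.
Proof.
elim: N F => [|N IH] F; first by rewrite big_ord0 big_nil.
rewrite big_words big_ord_recl (big_pred1 tt) => [|[]] //=.
by rewrite (IH (fun m => F m.+1)).
Qed.

Lemma opser_pw (G : finType) (c : nat -> rat) (T : ser G -> ser G) f :
  contraction T ->
  ssum (fun m => c m *: iter m T f) = opeval (fun=> T) (pw c) f.
Proof.
move=> cT; apply: eqmP => N w wN.
rewrite (opeval_wordsE (T := fun=> T) (fun=> cT) (pw c) f wN).
rewrite (@ssum_natE _ _ N); last first.
  move=> m Nm; rewrite scalesE (_ : iter _ _ _ _ = 0) ?mulr0 //.
  suff: eqm m (iter m T f) 0 by apply; apply: leq_trans Nm.
  by elim: m {Nm} => //= m IH; apply: contr_len.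
rewrite sum_sE -(big_words_unit N (fun m => (c m *: iter m T f) w)); apply: eq_bigr => u _; congr (_ * _ w).
by elim: u => //= i u ->.
Qed.

Lemma word_unit (u : seq unit) : u = nseq (size u) tt.
Proof. by elim: u => //= [[] u {1}->]. Qed.

Lemma mulsC (f g : ser unit) : f * g = g * f.
Proof.
apply/funext => w; rewrite [w]word_unit; set n := size w.
rewrite !mul_sE size_nseq.
rewrite (reindex_inj rev_ord_inj) /=; apply: eq_bigr => k _.
have kn : (k <= n)%N by rewrite -ltnS.
by rewrite subSS !take_nseq ?leq_subr // !drop_nseq subKn // mulrC.
Qed.

Section Euler.
Variable G : finType.
Implicit Types f g : ser G.

(** Multiplication by word length is a derivation, so that identities between
    one-variable series follow from differential equations. *)
Definition euler f : ser G := fun w => (size w)%:R * f w.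

Lemma euler_linear : linear euler.
Proof.
move=> c f g; apply/funext => w; rewrite /euler !addsE !scalesE.
by rewrite mulrDr mulrCA.
Qed.

Lemma eulerM f g : euler (f * g) = euler f * g + f * euler g.
Proof.
apply/funext => w; rewrite addsE /euler !mul_sE mulr_sumr.
rewrite -big_split /=; apply: eq_bigr => k _.
have kw : (k <= size w)%N by rewrite -ltnS.
rewrite size_take_min (minn_idPl kw) size_drop natrB //.
by ring.
Qed.

Lemma euler_gen x : euler (gen x) = gen x.
Proof.
apply/funext => w; rewrite /euler /gen.
by case: eqP => [->|_]; rewrite ?mul1r ?mulr0.
Qed.

Lemma euler1 : euler 1 = 0.
Proof. by apply/funext => -[|x w]; rewrite /euler ?mul0r ?mulr0. Qed.

Lemma euler_inj f g : euler f = euler g -> f [::] = g [::] -> f = g.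
Proof.
move=> fg fg0; apply/funext => -[|x w] //.
have /(congr1 (@^~ (x :: w))) := fg; rewrite /euler /=.
by apply: mulfI; rewrite pnatr_eq0.
Qed.

(** The equation raises the order of vanishing of [F] by one. *)
Lemma euler_eq0 (A F : ser G) : A [::] = 0 -> F [::] = 0 ->
  euler F = A * F -> F = 0.
Proof.
move=> A0 F0 eF; apply: eqmP; elim=> // k IH.
have {}IH := eqmM_pos A0 IH; rewrite -eF mulr0 in IH.
move=> [|x w] wk //; have /eqP := IH _ wk.
by rewrite /euler mulf_eq0 pnatr_eq0 /= => /eqP.
Qed.

End Euler.

Local Notation t1 := (gen tt).

(** The formal derivative of a series in one variable. *)
Definition dser (p : ser unit) : ser unit :=
  fun u => (size u).+1%:R * p (tt :: u).

Lemma dser_euler p : t1 * dser p = euler p.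
Proof.
apply/funext => -[|[] u]; first by rewrite gen_mul_nil /euler mul0r.
by rewrite gen_mul_cons mul1r.
Qed.

Lemma euler_dser p q : euler p = t1 * q -> dser p = q.
Proof.
move=> epq; apply/funext => u.
have /(congr1 (@^~ (tt :: u))) := epq.
by rewrite -dser_euler !gen_mul_cons !mul1r.
Qed.

Lemma t1_lreg (f g : ser unit) : t1 * f = t1 * g -> f = g.
Proof.
move=> fg; apply/funext => u; have /(congr1 (@^~ (tt :: u))) := fg.
by rewrite !gen_mul_cons !mul1r.
Qed.

Lemma dser_t1 p : dser (t1 * p) = p + t1 * dser p.
Proof.
by apply: euler_dser; rewrite eulerM euler_gen -dser_euler -mulrDr.
Qed.

Lemma dser_linear : linear dser.
Proof.
move=> c p q; apply/funext => u; rewrite /dser !addsE !scalesE.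
by rewrite mulrDr mulrCA.
Qed.

Lemma euler_chain (z p : ser unit) : z [::] = 0 ->
  euler (seval (fun=> z) p) = euler z * seval (fun=> z) (dser p).
Proof.
move=> z0; have zz (i : unit) : z [::] = 0 by [].
pose M p := euler (seval (fun=> z) p) - euler z * seval (fun=> z) (dser p).
suff /eqP : M p = 0 by rewrite subr_eq0 => /eqP.
apply: (@lin_eq0 _ _ M (fun=> smul z)) => [i|c f g||[] f].
- exact: contrM.
- rewrite /M (linear_seval zz) euler_linear dser_linear (linear_seval zz).
  by rewrite mulrDr -scalerAr scalerBr opprD addrACA.
- rewrite /M (seval1 zz) euler1 (_ : dser 1 = 0) ?(lin0 (linear_seval zz)).
    by rewrite mulr0 subrr.
  by apply/funext => u; rewrite /dser mulr0.
- rewrite /M (sevalM zz) (seval_gen zz) dser_t1 (linD (linear_seval zz)).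
  rewrite (sevalM zz) (seval_gen zz) eulerM mulsE mulrBr mulrDr.
  rewrite opprD addrACA subrr add0r; congr (_ - _).
  by rewrite !mulrA [euler z * z]mulsC.
Qed.

(** The series of [exp (s t)]. *)
Definition pexp (s : rat) : ser unit := pw (fun m => s ^+ m / m`!%:R).

Lemma pexp_nil s : pexp s [::] = 1.
Proof. by rewrite /pexp /pw expr0 fact0 divr1. Qed.

Lemma dser_pexp s : dser (pexp s) = s *: pexp s.
Proof.
apply/funext => u; rewrite /dser /pexp /pw scalesE /= factS natrM exprS.
by rewrite invfM mulrCA [X in _ * X]mulrA divff ?pnatr_eq0 // mul1r mulrA.
Qed.

Lemma euler_pexp s : euler (pexp s) = s *: (t1 * pexp s).
Proof. by rewrite -dser_euler dser_pexp scalerAr. Qed.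

Lemma pexp_unique s F : euler F = s *: (t1 * F) -> F [::] = 1 -> F = pexp s.
Proof.
move=> eF F1; apply/eqP; rewrite -subr_eq0; apply/eqP.
apply: (@euler_eq0 _ (s *: t1)) => //.
- by rewrite scalesE mulr0.
- by rewrite addsE oppsE F1 pexp_nil subrr.
- by rewrite (linB (@euler_linear _)) eF euler_pexp -scalerBr -mulrBr scalerAl.
Qed.

Lemma pexpD s r : pexp s * pexp r = pexp (s + r).
Proof.
apply: pexp_unique; last by rewrite mul_nil !pexp_nil mulr1.
rewrite eulerM !euler_pexp scalerDl -scalerAl mulrA; congr (_ + _).
by rewrite -scalerAr mulrA [pexp s * _]mulsC.
Qed.

Lemma pexp0 : pexp 0 = 1.
Proof.
by apply/esym/pexp_unique => //; rewrite euler1 scale0r.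
Qed.

Definition geo : ser unit := pw (fun m => (-1) ^+ m).
Definition plog : ser unit :=
  pw (fun m => if m is m'.+1 then (-1) ^+ m' / m'.+1%:R else 0).

Lemma dser_plog : dser plog = geo.
Proof.
apply/funext => u; rewrite /dser /plog /geo /pw /=.
by rewrite mulrCA divff ?mulr1 // pnatr_eq0.
Qed.

Lemma geoE : geo * (1 + t1) = 1.
Proof.
rewrite mulrDr mulr1 mulsC; apply/funext => -[|[] u].
  by rewrite addsE gen_mul_nil addr0.
by rewrite addsE gen_mul_cons mul1r /geo /pw /= exprS mulN1r addNr.
Qed.

(** Both sides solve [(1 + t) t F' = t F]. *)
Lemma pexp_plog : seval (fun=> plog) (pexp 1) = 1 + t1.
Proof.
have l0 (i : unit) : plog [::] = 0 by [].
set F := seval _ _; have F0 : F [::] = 1 by rewrite /F (seval_nil l0) pexp_nil.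
have eF : (1 + t1) * euler F = t1 * F.
  rewrite euler_chain // dser_pexp scale1r -dser_euler dser_plog -/F.
  by rewrite mulrA [(1 + t1) * _]mulsC -[t1 * geo * _]mulrA geoE mulr1.
apply/eqP; rewrite -subr_eq0; apply/eqP.
apply: (@euler_eq0 _ (geo * t1)).
- by rewrite mulsC gen_mul_nil.
- by rewrite !addsE oppsE addsE F0 gen_nil addr0 subrr.
- rewrite -mulrA [in RHS]mulrBr -eF (linB (@euler_linear _)).
  rewrite (linD (@euler_linear _)) euler1 add0r euler_gen mulrBr.
  by rewrite [t1 * (_ + _)]mulsC !mulrA geoE !mul1r.
Qed.

(** The derivative of the left-hand side is [exp t / exp t]. *)
Lemma plog_pexp : seval (fun=> pexp 1 - 1) plog = t1.
Proof.
have e0 (i : unit) : (pexp 1 - 1) [::] = 0.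
  by rewrite addsE oppsE pexp_nil subrr.
apply: euler_inj; last by rewrite seval_nil // gen_nil.
rewrite euler_chain ?(e0 tt) // dser_plog euler_gen (linB (@euler_linear _)).
rewrite euler1 subr0 euler_pexp scale1r -mulrA.
suff -> : pexp 1 * seval (fun=> pexp 1 - 1) geo = 1 by rewrite mulr1.
have e1 : seval (fun=> pexp 1 - 1) (1 + t1) = pexp 1.
  by rewrite (linD (linear_seval e0)) (seval1 e0) (seval_gen e0 tt) subrKC.
by rewrite -{1}e1 -(sevalM e0) mulsC geoE (seval1 e0).
Qed.

Section ExpLog.
Variable G : finType.
Implicit Types (x y z g h : ser G).

Lemma iter_mul0 x m : iter m (smul x) 1 = x ^+ m.
Proof. by elim: m => //= m ->; rewrite exprS. Qed.

Lemma pser_pw (c : nat -> rat) x : x [::] = 0 ->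
  ssum (fun m => c m *: iter m (smul x) (sone G)) = seval (fun=> x) (pw c).
Proof. by move=> x0; rewrite opser_pw ?sevalE //; apply: contrM. Qed.

Lemma sexpE x : x [::] = 0 -> sexp x = seval (fun=> x) (pexp 1).
Proof.
move=> x0; rewrite /sexp pser_pw //; congr (@seval unit G (fun=> x) _).
by apply/funext => u; rewrite /pexp /pw expr1n mul1r.
Qed.

Lemma slogE g : g [::] = 1 -> slog g = @seval unit G (fun=> g - 1) plog.
Proof.
move=> g1; have g0 : (g - 1) [::] = 0 by rewrite addsE oppsE g1 subrr.
rewrite -pser_pw // /slog; apply: eqmP => N w wN.
have it0 m : (N <= m)%N -> iter m (smul (g - sone G)) (sone G) w = 0.
  suff: eqm m (iter m (smul (g - sone G)) (sone G)) 0.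
    by move=> im Nm; apply: im; apply: leq_trans Nm.
  by elim: m => //= m IH; apply: contr_len IH; apply: contrM.
rewrite (@ssum_natE _ _ N) => [|m Nm]; last first.
  by rewrite scalesE it0 ?mulr0 // leqW.
rewrite (@ssum_natE _ _ N.+1) => [|m Nm]; last first.
  by rewrite scalesE it0 ?mulr0 // ltnW.
by rewrite big_ord_recl scale0r add0r.
Qed.

#[local] Opaque sexp slog ssum.

Lemma sexp_nil x : x [::] = 0 -> sexp x [::] = 1.
Proof. by move=> x0; rewrite sexpE // seval_nil // pexp_nil. Qed.

Lemma slog_nil g : g [::] = 1 -> slog g [::] = 0.
Proof.
move=> g1; rewrite slogE // seval_nil // => _.
by rewrite addsE oppsE g1 subrr.
Qed.

Lemma slogK g : g [::] = 1 -> sexp (slog g) = g.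
Proof.
move=> g1; have g0 (i : unit) : (g - 1) [::] = 0.
  by rewrite addsE oppsE g1 subrr.
rewrite sexpE ?slog_nil // slogE // -(@seval_comp unit unit G (fun=> g - 1) (fun=> plog)) //.
rewrite pexp_plog (linD (linear_seval g0)) (seval1 g0) (seval_gen g0 tt).
by rewrite subrKC.
Qed.

Lemma sexpK x : x [::] = 0 -> slog (sexp x) = x.
Proof.
move=> x0; have zz (i : unit) : x [::] = 0 by [].
have e0 : (pexp 1 - 1) [::] = 0 by rewrite addsE oppsE pexp_nil subrr.
have -> : slog (sexp x) = seval (fun=> seval (fun=> x) (pexp 1 - 1)) plog.
  by rewrite slogE ?sexp_nil // (linB (linear_seval zz)) (seval1 zz) sexpE.
rewrite -(seval_comp) //.
by rewrite plog_pexp (seval_gen zz tt).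
Qed.

Lemma pexp_scale s : seval (fun=> s *: t1) (pexp 1) = pexp s.
Proof.
have z0 : (s *: t1) [::] = 0 by rewrite scalesE mulr0.
apply: pexp_unique; last by rewrite seval_nil // pexp_nil.
by rewrite euler_chain // dser_pexp scale1r (linZ (@euler_linear _)) euler_gen
  scalerAl.
Qed.

Lemma sexpZE s x : x [::] = 0 -> sexp (s *: x) = seval (fun=> x) (pexp s).
Proof.
move=> x0; have zz (i : unit) : x [::] = 0 by [].
have e : seval (fun=> x) (s *: t1) = s *: x.
  by rewrite (linZ (linear_seval zz)) (seval_gen zz tt).
rewrite sexpE ?scalesE ?x0 ?mulr0 // -(pexp_scale s) seval_comp // ?e // => _.
by rewrite scalesE mulr0.
Qed.

Lemma sexpZD s r x : x [::] = 0 ->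
  sexp (s *: x) * sexp (r *: x) = sexp ((s + r) *: x).
Proof. by move=> x0; rewrite !sexpZE // -sevalM // pexpD. Qed.

Lemma sexp0 : sexp (0 : ser G) = 1.
Proof.
by rewrite -(scale0r (0 : ser G)) sexpZE // pexp0 seval1.
Qed.

Lemma sexpNl x : x [::] = 0 -> sexp (- x) * sexp x = 1.
Proof.
move=> x0; rewrite -scaleN1r -[x in X in _ * X]scale1r sexpZD //.
by rewrite addNr scale0r sexp0.
Qed.

Lemma sexpNr x : x [::] = 0 -> sexp x * sexp (- x) = 1.
Proof.
by move=> x0; rewrite -[x in sexp x]opprK sexpNl // oppsE x0 oppr0.
Qed.

Lemma mulr1_uniq (g h h' : ser G) : g * h = 1 -> h' * g = 1 -> h' = h.
Proof. by move=> gh hg; rewrite -[h']mulr1 -gh mulrA hg mul1r. Qed.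

Lemma slog1 : slog (1 : ser G) = 0.
Proof. by rewrite -sexp0 sexpK. Qed.

Lemma slogV (g h : ser G) : g [::] = 1 -> h * g = 1 -> slog h = - slog g.
Proof.
move=> g1 hg; have l0 := slog_nil g1.
rewrite -[RHS]sexpK; last by rewrite oppsE l0 oppr0.
by congr slog; apply: (mulr1_uniq _ hg); rewrite -{1}(slogK g1) sexpNr.
Qed.

Lemma mul_sexp_nil x y : x [::] = 0 -> y [::] = 0 ->
  (sexp x * sexp y) [::] = 1.
Proof. by move=> x0 y0; rewrite mul_nil !sexp_nil // mulr1. Qed.

Lemma bchE_log x y : bch x y = slog (sexp x * sexp y). Proof. by []. Qed.

Lemma sexp_bch x y : x [::] = 0 -> y [::] = 0 ->
  sexp (bch x y) = sexp x * sexp y.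
Proof. by move=> x0 y0; rewrite bchE_log slogK // mul_sexp_nil. Qed.

Lemma bch_nil x y : x [::] = 0 -> y [::] = 0 -> bch x y [::] = 0.
Proof. by move=> x0 y0; rewrite bchE_log slog_nil // mul_sexp_nil. Qed.

Lemma bchNN x y : x [::] = 0 -> y [::] = 0 -> bch (- y) (- x) = - bch x y.
Proof.
move=> x0 y0; apply: slogV; first exact: mul_sexp_nil.
by rewrite mulsE mulrA -(mulrA (sexp (- y))) sexpNl // mulr1 sexpNl.
Qed.

Lemma bchN_self x : x [::] = 0 -> bch x (- x) = 0.
Proof. by move=> x0; rewrite bchE_log sexpNr // slog1. Qed.

Lemma sexp_inj x y : x [::] = 0 -> y [::] = 0 -> sexp x = sexp y -> x = y.
Proof. by move=> x0 y0 e; rewrite -(sexpK x0) e sexpK. Qed.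

Lemma scale_nil (c : rat) x : x [::] = 0 -> (c *: x) [::] = 0.
Proof. by move=> x0; rewrite scalesE x0 mulr0. Qed.

Lemma opp_nil x : x [::] = 0 -> (- x) [::] = 0.
Proof. by move=> x0; rewrite oppsE x0 oppr0. Qed.

Lemma bch_cancel x y z : x [::] = 0 -> y [::] = 0 -> z [::] = 0 ->
  bch (bch x (- y)) (bch y (- z)) = bch x (- z).
Proof.
move=> x0 y0 z0; have [ny0 nz0] := (opp_nil y0, opp_nil z0).
rewrite bchE_log (sexp_bch x0 ny0) (sexp_bch y0 nz0) [bch x (- z)]bchE_log.
by congr slog; rewrite mulrA -(mulrA (sexp x)) (sexpNl y0) mulr1.
Qed.

Lemma bchs4 x y z g : x [::] = 0 -> y [::] = 0 -> z [::] = 0 -> g [::] = 0 ->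
  bchs [:: x; y; z; g] = slog (sexp x * (sexp y * sexp z) * sexp g).
Proof.
move=> x0 y0 z0 g0; have i0 : (0 : ser G) [::] = 0 by [].
have g'0 := bch_nil g0 i0; have zg0 := bch_nil z0 g'0.
rewrite [bchs _]bchE_log (sexp_bch y0 zg0) (sexp_bch z0 g'0) (sexp_bch g0 i0).
by rewrite sexp0 mulr1 !mulrA.
Qed.

Lemma mu2_nil x y : x [::] = 0 -> y [::] = 0 -> mu2 x y [::] = 0.
Proof.
by move=> x0 y0; apply: bch_nil => //; apply: scale_nil; apply: bch_nil => //; apply: opp_nil.
Qed.

Lemma sexp_mu2 x y : x [::] = 0 -> y [::] = 0 ->
  sexp (mu2 x y) = sexp x * sexp ((1 / 2) *: bch (- x) y).
Proof.
move=> x0 y0; apply: sexp_bch => //.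
by apply: scale_nil; apply: bch_nil => //; apply: opp_nil.
Qed.

(** With [g = exp x] and [h = exp y], the average is [g (g^-1 h)^(1/2)], which
    is [h (h^-1 g)^(1/2)] because the two square roots are inverse to each
    other. *)
Lemma mu2C x y : x [::] = 0 -> y [::] = 0 -> mu2 x y = mu2 y x.
Proof.
move=> x0 y0; have [nx0 ny0] := (opp_nil x0, opp_nil y0).
have b0 := bch_nil nx0 y0.
apply: sexp_inj; [exact: mu2_nil|exact: mu2_nil|].
apply: etrans (sexp_mu2 x0 y0) _; apply/esym; apply: etrans (sexp_mu2 y0 x0) _.
have ey : sexp y = sexp x * sexp (bch (- x) y).
  by rewrite sexp_bch // mulrA sexpNr // mul1r.
have -> : bch (- y) x = - bch (- x) y by rewrite -bchNN // opprK.
rewrite ey -mulrA; congr (_ * _).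
have := sexpZD 1 (1 / 2 * -1) b0; rewrite scale1r -(scaleN1r (bch (- x) y)) scalerA => ->.
by rewrite (_ : 1 + 1 / 2 * -1 = 1 / 2 :> rat) //; field.
Qed.

End ExpLog.

Section SevalExp.
Variables (I G : finType) (x : I -> ser G).
Hypothesis x0 : forall i, x i [::] = 0.

Lemma seval_sexp p : p [::] = 0 -> seval x (sexp p) = sexp (seval x p).
Proof. by move=> p0; rewrite !sexpE ?seval_nil // seval_comp. Qed.

Lemma seval_slog p : p [::] = 1 -> seval x (slog p) = slog (seval x p).
Proof.
move=> p1; rewrite !slogE ?seval_nil // seval_comp //.
  by rewrite (linB (linear_seval x0)) (seval1 x0).
by rewrite addsE oppsE p1 subrr.
Qed.

Lemma seval_bch p q : p [::] = 0 -> q [::] = 0 ->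
  seval x (bch p q) = bch (seval x p) (seval x q).
Proof.
move=> p0 q0; rewrite !bchE_log seval_slog ?mul_sexp_nil //.
by rewrite sevalM // !seval_sexp.
Qed.

Lemma seval_mu2 p q : p [::] = 0 -> q [::] = 0 ->
  seval x (mu2 p q) = mu2 (seval x p) (seval x q).
Proof.
move=> p0 q0; have np0 := opp_nil p0; have b0 := bch_nil np0 q0.
rewrite /mu2 (seval_bch p0 (scale_nil _ b0)) (linZ (linear_seval x0)).
by rewrite (seval_bch np0 q0) (linN (linear_seval x0)).
Qed.

End SevalExp.

(** * The Todd series *)

Lemma size_psinv_seq c m : size (psinv_seq c m) = m.
Proof. by elim: m => //= m IH; rewrite size_rcons IH. Qed.

Lemma nth_psinv_seq c m i : (i < m)%N -> (psinv_seq c m)`_i = psinv c i.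
Proof.
elim: m => // m IH; rewrite ltnS leq_eqVlt => /orP[/eqP->//|im].
by rewrite [psinv_seq _ _]/= nth_rcons size_psinv_seq im IH.
Qed.

Lemma pwM c d : pw c * pw d =
  pw (fun m => \sum_(k < m.+1) c k * d (m - k)%N).
Proof.
apply/funext => u; rewrite mul_sE; apply: eq_bigr => k _.
rewrite /pw size_drop size_take_min (minn_idPl _) //.
by rewrite -ltnS.
Qed.

Lemma psinvM c : c 0%N != 0 -> pw (psinv c) * pw c = 1.
Proof.
move=> c0; rewrite pwM; apply/funext => u; rewrite /pw.
transitivity ((size u == 0)%:R : rat); last by case: u.
move: (size u) => {u} m; rewrite big_ord_recr /= subnn.
rewrite {2}/psinv /= nth_rcons size_psinv_seq ltnn eqxx divfK //.
rewrite addrCA (_ : \sum_(i < m) _ = \sum_(i < m) c (m - i)%N * (psinv_seq c m)`_i).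
  by rewrite subrr addr0.
by apply: eq_bigr => i _; rewrite nth_psinv_seq // mulrC.
Qed.

(** The series [(1 - exp (- E)) / E] occurring in the flow. *)
Definition flow_coef (m : nat) : rat := (-1) ^+ m / (m.+1)`!%:R.

Lemma todd_posM : pw todd_pos * pw flow_coef = 1.
Proof. by apply: psinvM; rewrite expr0 div1r invr_eq0 pnatr_eq0. Qed.

(** As [E] is not a zero divisor, it is enough to compare
    [1 - exp (- E)] with [exp (- E) (exp E - 1)]. *)
Lemma todd_negM : pw todd_neg * pw flow_coef = - pexp (-1).
Proof.
pose Ap := pw (fun m => ((m.+1)`!%:R)^-1).
have tAp : t1 * Ap = pexp 1 - 1.
  apply/funext => -[|[] u]; rewrite ?gen_mul_nil ?gen_mul_cons addsE oppsE.
    by rewrite pexp_nil subrr.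
  by rewrite subr0 mul1r /Ap /pexp /pw expr1n mul1r.
have tAm : t1 * pw flow_coef = 1 - pexp (-1).
  apply/funext => -[|[] u]; rewrite ?gen_mul_nil ?gen_mul_cons addsE oppsE.
    by rewrite pexp_nil subrr.
  by rewrite add0r mul1r /flow_coef /pexp /pw exprS mulN1r mulNr opprK.
have inv : pw todd_neg * (- Ap) = 1.
  by apply: psinvM; rewrite oppr_eq0 invr_eq0 pnatr_eq0.
have -> : pw flow_coef = pexp (-1) * Ap.
  apply: t1_lreg; rewrite tAm mulrA [t1 * _]mulsC -mulrA tAp mulrBr pexpD mulr1.
  by rewrite addNr pexp0.
rewrite mulrA [pw todd_neg * _]mulsC -mulrA -[Ap]opprK mulrN inv.
by rewrite mulrN1.
Qed.

(** * Degrees and brackets *)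

Lemma sgnD m n : sgn (m + n) = sgn m * sgn n.
Proof. by rewrite /sgn expfzDr. Qed.

Lemma sgnN m : sgn (- m) = sgn m.
Proof. by rewrite /sgn -exprz_inv invrN1. Qed.

Lemma sgn_sq m : sgn m * sgn m = 1.
Proof. by rewrite -[X in _ * X]sgnN -sgnD subrr. Qed.

Lemma sgn0 : sgn 0 = 1. Proof. by []. Qed.
Lemma sgnN1 : sgn (-1) = -1. Proof. by rewrite sgnN. Qed.

Section Graded.
Variables (G : finType) (deg : G -> int).
Implicit Types (f g h e : ser G) (x : G) (w : seq G) (m n : int).

Lemma wdeg_cat u v : wdeg deg (u ++ v) = wdeg deg u + wdeg deg v.
Proof. by rewrite /wdeg big_cat. Qed.

Lemma wdeg_nil : wdeg deg [::] = 0. Proof. exact: big_nil. Qed.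
Lemma wdeg_cons x w : wdeg deg (x :: w) = deg x + wdeg deg w.
Proof. exact: big_cons. Qed.

(** The parity automorphism, by which the Leibniz rule of an odd derivation is
    twisted. *)
Definition parity f : ser G := fun w => sgn (wdeg deg w) * f w.

Lemma parity_linear : linear parity.
Proof.
move=> c f g; apply/funext => w; rewrite /parity !addsE !scalesE.
by rewrite mulrDr mulrCA.
Qed.

Lemma parityM f g : parity (f * g) = parity f * parity g.
Proof.
apply/funext => w; rewrite /parity !mul_sE mulr_sumr; apply: eq_bigr => k _.
by rewrite -[in sgn _](cat_take_drop k w) wdeg_cat sgnD mulrACA.
Qed.

Lemma parity1 : parity 1 = 1.
Proof.
by apply/funext => -[|x w]; rewrite /parity ?wdeg_nil ?mulr0 ?mulr1.
Qed.

Lemma parity_nil f : parity f [::] = f [::].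
Proof. by rewrite /parity wdeg_nil mul1r. Qed.

Lemma homog0 m : homog deg m 0.
Proof. by move=> w; rewrite eqxx. Qed.

Lemma homogD m f g : homog deg m f -> homog deg m g -> homog deg m (f + g).
Proof.
move=> hf hg w; rewrite addsE; have [->|/hf //] := eqVneq (f w) 0.
by rewrite add0r => /hg.
Qed.

Lemma homogZ m (c : rat) f : homog deg m f -> homog deg m (c *: f).
Proof. by move=> hf w; rewrite scalesE mulf_eq0 negb_or => /andP[_ /hf]. Qed.

Lemma homog1 : homog deg 0 1.
Proof. by move=> -[|x w]; rewrite ?wdeg_nil // eqxx. Qed.

Lemma homog_gen x : homog deg (deg x) (gen x).
Proof.
move=> w; rewrite /gen; have [-> _|_] := eqVneq w [:: x]; last by rewrite eqxx.
by rewrite wdeg_cons wdeg_nil addr0.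
Qed.

Lemma homogM m n f g :
  homog deg m f -> homog deg n g -> homog deg (m + n) (f * g).
Proof.
move=> hf hg w; apply: contra_neq_eq => wmn; rewrite mul_sE big1 // => k _.
have [->|/hf um] := eqVneq (f (take k w)) 0; first by rewrite mul0r.
have [->|/hg vn] := eqVneq (g (drop k w)) 0; first by rewrite mulr0.
by case/eqP: wmn; rewrite -(cat_take_drop k w) wdeg_cat um vn.
Qed.

Lemma homogMl m f g : homog deg 0 f -> homog deg m g -> homog deg m (f * g).
Proof. by move=> hf hg; rewrite -[m]add0r; apply: homogM. Qed.

Lemma homogMr m f g : homog deg m f -> homog deg 0 g -> homog deg m (f * g).
Proof. by move=> hf hg; rewrite -[m]addr0; apply: homogM. Qed.

Lemma homog_eqm m f : (forall k, exists2 g, homog deg m g & eqm k f g) ->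
  homog deg m f.
Proof. by move=> fg w; have [g hg ->] := fg (size w).+1; [exact: hg|]. Qed.

Lemma parity_homog m f : homog deg m f -> parity f = sgn m *: f.
Proof.
move=> hf; apply/funext => w; rewrite /parity scalesE.
by have [->|/hf ->//] := eqVneq (f w) 0; rewrite !mulr0.
Qed.

Lemma homogN m f : homog deg m f -> homog deg m (- f).
Proof. by move=> hf; rewrite -scaleN1r; apply: homogZ. Qed.

Lemma parity_even f : homog deg 0 f -> parity f = f.
Proof. by move=> /parity_homog->; rewrite scale1r. Qed.

Lemma parity_odd f : homog deg (-1) f -> parity f = - f.
Proof. by move=> /parity_homog->; rewrite sgnN1 scaleN1r. Qed.

Lemma brE m n f g : homog deg m f -> homog deg n g ->
  br deg f g = f * g - sgn (m * n) *: (g * f).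
Proof.
move=> hf hg; apply/funext => w; rewrite addsE oppsE scalesE !mul_sE mulr_sumr.
rewrite -sumrN -big_split /=; apply: eq_bigr => k _; congr (_ - _).
have [->|/hg ->] := eqVneq (g (take k w)) 0; first by rewrite !mul0r !mulr0.
have [->|/hf ->] := eqVneq (f (drop k w)) 0; first by rewrite !mulr0.
by rewrite [n * m]mulrC.
Qed.

Lemma br0E e f : homog deg 0 e -> br deg e f = e * f - f * e.
Proof.
move=> he; apply/funext => w; rewrite addsE oppsE !mul_sE -sumrN -big_split /=.
apply: eq_bigr => k _; congr (_ - _).
have [->|/he ->] := eqVneq (e (drop k w)) 0; first by rewrite !mulr0.
by rewrite mulr0 sgn0 mul1r.
Qed.

Lemma brN1E e f : homog deg (-1) e -> br deg e f = e * f - parity f * e.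
Proof.
move=> he; apply/funext => w; rewrite addsE oppsE !mul_sE -sumrN -big_split /=.
apply: eq_bigr => k _; congr (_ - _); rewrite /parity -mulrA.
have [->|/he ->] := eqVneq (e (drop k w)) 0; first by rewrite !mulr0.
by rewrite mulrN1 sgnN.
Qed.

Lemma br_linl f : linear (fun e => br deg e f).
Proof.
move=> c e e'; apply/funext => w; rewrite addsE scalesE mulr_sumr -big_split /=.
apply: eq_bigr => k _; rewrite !addsE !scalesE; set s := sgn _; ring.
Qed.

Lemma br_linr e : linear (br deg e).
Proof.
move=> c f g; apply/funext => w; rewrite addsE scalesE mulr_sumr -big_split /=.
apply: eq_bigr => k _; rewrite !addsE !scalesE; set s := sgn _; ring.
Qed.

Lemma homog_br m n f g : homog deg m f -> homog deg n g ->
  homog deg (m + n) (br deg f g).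
Proof.
move=> hf hg; rewrite (brE hf hg) -scaleNr; apply: homogD (homogM hf hg) _.
by apply: homogZ; rewrite addrC; apply: homogM.
Qed.

Lemma contr_br e : homog deg 0 e -> e [::] = 0 -> contraction (br deg e).
Proof.
move=> he e0; split=> [|k f f0]; first exact: br_linr.
rewrite br0E //; apply/eqm_subr.
have := eqmM_posr e0 f0; rewrite mul0r; move/eqm_sym; apply: eqm_trans.
by have := eqmM_pos e0 f0; rewrite mulr0.
Qed.

Lemma adserE c e f : homog deg 0 e -> e [::] = 0 ->
  adser deg c e f = opeval (fun=> br deg e) (pw c) f.
Proof. by move=> he e0; apply: opser_pw; apply: contr_br. Qed.

Lemma homog_opeval (I : finType) (T : I -> ser G -> ser G) m p f :
  (forall i, contraction (T i)) ->
  (forall i g, homog deg m g -> homog deg m (T i g)) ->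
  homog deg m f -> homog deg m (opeval T p f).
Proof.
move=> cT hT hf; apply: homog_eqm => k; eexists; last exact: opeval_wordsE.
elim/big_ind: _ => [||u _]; [exact: homog0|by move=> *; apply: homogD|].
by apply: homogZ; elim: u => //= i u; apply: hT.
Qed.

Lemma homog_seval (I : finType) (x : I -> ser G) p :
  (forall i, x i [::] = 0) -> (forall i, homog deg 0 (x i)) ->
  homog deg 0 (seval x p).
Proof.
move=> x0 hx; rewrite sevalE //; apply: homog_opeval homog1 => [i|i g hg].
  exact: contrM.
exact: homogMl.
Qed.

Lemma homog_sexp e : homog deg 0 e -> e [::] = 0 -> homog deg 0 (sexp e).
Proof. by move=> he e0; rewrite sexpE //; apply: homog_seval. Qed.

End Graded.

Lemma homog_deg0 (I : finType) (f : ser I) : homog (@deg0 I) 0 f.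
Proof. by move=> w _; rewrite /wdeg big1. Qed.

(** A substitution preserving degrees commutes with the parity automorphism:
    it does so on letters. *)
Lemma seval_parity (I G : finType) (degI : I -> int) (deg : G -> int)
    (x : I -> ser G) p :
  (forall i, x i [::] = 0) -> (forall i, homog deg (degI i) (x i)) ->
  parity deg (seval x p) = seval x (parity degI p).
Proof.
move=> x0 hx; pose M p := parity deg (seval x p) - seval x (parity degI p).
suff /eqP : M p = 0 by rewrite subr_eq0 => /eqP.
have cx i : contraction (smul (x i)) by apply: contrM.
apply: (@lin_eq0 _ _ M (fun i f => sgn (degI i) *: smul (x i) f)).
- by move=> i; apply: contrZ.
- move=> c f g; rewrite /M (linear_seval x0) !parity_linear (linear_seval x0).
  by rewrite scalerBr opprD addrACA.
- by rewrite /M (seval1 x0) !parity1 (seval1 x0) subrr.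
- move=> i f; rewrite /M (sevalM x0) !parityM (sevalM x0) (seval_gen x0).
  rewrite (parity_homog (hx i)) (parity_homog (homog_gen degI (x := i))).
  rewrite (linZ (linear_seval x0)) (seval_gen x0).
  by rewrite -!scalerAl -scalerBr -mulrBr.
Qed.

(** * Lie series *)

Section LieSeries.
Variables (G : finType) (deg : G -> int).
Implicit Types (S : set G) (f g e : ser G) (m n : int) (k l : nat).

(** The bracket is given by a formula in the associative product only on
    homogeneous elements, so that inductions on Lie polynomials are better
    carried out on these; [l] is the word length. *)
Inductive lie_hom S : int -> nat -> ser G -> Prop :=
| lh_gen x : S x -> lie_hom S (deg x) 1 (gen x)
| lh_zero m l : lie_hom S m l 0
| lh_add m l f g : lie_hom S m l f -> lie_hom S m l g -> lie_hom S m l (f + g)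
| lh_scale m l (c : rat) f : lie_hom S m l f -> lie_hom S m l (c *: f)
| lh_br m n k l f g : lie_hom S m k f -> lie_hom S n l g ->
    lie_hom S (m + n) (k + l) (br deg f g).

Lemma lie_hom_poly S m l f : lie_hom S m l f -> lie_poly deg S f.
Proof.
elim=> {m l f} => [x Sx|_ _|_ _ f g _ f_ _ g_|_ _ c f _ f_|_ _ _ _ f g _ f_ _ g_].
- exact: lp_gen.
- exact: lp_zero.
- exact: lp_add.
- exact: lp_scale.
- exact: lp_br.
Qed.

Lemma lie_hom_homog S m l f : lie_hom S m l f -> homog deg m f.
Proof.
elim=> {m l f} => [x Sx|m _|m _ f g _ f_ _ g_|m _ c f _ f_|m n _ _ f g _ f_ _ g_].
- exact: homog_gen.
- exact: homog0.
- exact: homogD.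
- exact: homogZ.
- exact: homog_br.
Qed.

(** Word length is the degree for which every letter has degree 1. *)
Lemma lie_hom_size S m l f w : lie_hom S m l f -> f w != 0 -> size w = l.
Proof.
move=> hf; elim: hf w => {m l f}
  => [x Sx|m l|m l f g _ f_ _ g_|m l c f _ f_|m n k l f g hf f_ hg g_] w.
- by rewrite /gen; have [->|_] := eqVneq w [:: x]; rewrite ?eqxx.
- by rewrite eqxx.
- rewrite addsE; have [->|/f_ //] := eqVneq (f w) 0.
  by rewrite add0r => /g_.
- by rewrite scalesE mulf_eq0 negb_or => /andP[_ /f_].
- rewrite (brE (lie_hom_homog hf) (lie_hom_homog hg)).
  apply: contra_neq_eq => wkl; rewrite addsE oppsE scalesE !mul_sE.
  have z u v (a b : ser G) : (forall w, a w != 0 -> size w = u) ->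
    (forall w, b w != 0 -> size w = v) -> (u + v = k + l)%N ->
    \sum_(i < (size w).+1) a (take i w) * b (drop i w) = 0.
    move=> ha hb uv; apply: big1 => i _.
    have [->|/ha au] := eqVneq (a (take i w)) 0; first by rewrite mul0r.
    have [->|/hb bv] := eqVneq (b (drop i w)) 0; first by rewrite mulr0.
    by case/eqP: wkl; rewrite -uv -au -bv -size_cat cat_take_drop.
  by rewrite (z _ _ f g f_ g_) // (z _ _ g f g_ f_ (addnC _ _)) mulr0 subrr.
Qed.

(** A Lie polynomial need not be homogeneous; writing it in this form gives
    access to its homogeneous parts. *)
Inductive lie_sum S : ser G -> Prop :=
| ls_zero : lie_sum S 0
| ls_add m l f g : lie_hom S m l f -> lie_sum S g -> lie_sum S (f + g).

Lemma lie_sumD S f g : lie_sum S f -> lie_sum S g -> lie_sum S (f + g).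
Proof.
elim=> [|m l a b ha _ IH] hg; first by rewrite add0r.
by rewrite -addrA; apply: (ls_add ha); apply: IH.
Qed.

Lemma lie_hom_sum S m l f : lie_hom S m l f -> lie_sum S f.
Proof. by move=> hf; rewrite -[f]addr0; apply: ls_add hf (ls_zero _). Qed.

Lemma lie_poly_sum S f : lie_poly deg S f -> lie_sum S f.
Proof.
elim=> {f} [x Sx||f g _ f_ _ g_|c f _ f_|f g _ f_ _ g_].
- exact: lie_hom_sum (lh_gen Sx).
- exact: ls_zero.
- exact: lie_sumD.
- elim: f_ => [|m l a b ha _ IH]; first by rewrite scaler0; apply: ls_zero.
  by rewrite scalerDr; apply: ls_add (lh_scale c ha) IH.
- elim: f_ => [|m l a b ha _ IH].
    by rewrite (lin0 (br_linl deg g)); apply: ls_zero.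
  rewrite (linD (br_linl deg g)); apply: lie_sumD IH => {b}.
  elim: g_ => [|n k c b hc _ IH].
    by rewrite (lin0 (br_linr deg a)); apply: ls_zero.
  by rewrite (linD (br_linr deg a)); apply: ls_add (lh_br ha hc) IH.
Qed.

Lemma hpart_linear k : linear (@hpart G k).
Proof.
move=> c f g; apply/funext => w; rewrite addsE scalesE /hpart.
by case: eqP => // _; rewrite mulr0 addr0.
Qed.

Lemma hpart_eqm N f : eqm N f (\sum_(k < N) hpart k f).
Proof.
move=> w wN; rewrite sum_sE (bigD1 (Ordinal wN)) //= /hpart eqxx big1 ?addr0 //.
by move=> i /eqP iw; case: eqP => // wi; case: iw; apply: val_inj.
Qed.

Lemma hpart_homog m k f : homog deg m f -> homog deg m (hpart k f).
Proof. by move=> hf w; rewrite /hpart; case: ifP => [_ /hf|]; rewrite ?eqxx. Qed.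

Lemma hpart_hpart k l f : hpart k (hpart l f) = if k == l then hpart k f else 0.
Proof.
have [->|kl] := eqVneq k l; apply/funext => w; rewrite /hpart.
  by case: (size w == l).
by have [->|//] := eqVneq (size w) k; rewrite (negPf kl).
Qed.

Lemma lie_hom_hpart S m l k f : lie_hom S m l f ->
  hpart k f = if k == l then f else 0.
Proof.
move=> hf; apply/funext => w; rewrite /hpart.
rewrite [RHS](_ : _ = if k == l then f w else 0); last by case: ifP.
have [->|fw] := eqVneq (f w) 0; first by case: ifP; case: ifP.
by rewrite (lie_hom_size hf fw) eq_sym.
Qed.

(** The component of degree [m] of each summand is the summand or zero. *)
Lemma lie_poly_hpart S m k f : lie_poly deg S f -> homog deg m f ->
  lie_hom S m k (hpart k f).
Proof.
move=> /lie_poly_sum sf hf.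
pose part f : ser G := fun w => if wdeg deg w == m then f w else 0.
have partD (g h : ser G) : part (g + h) = part g + part h.
  by apply/funext => w; rewrite addsE /part addsE; case: ifP; rewrite ?addr0.
have -> : hpart k f = part (hpart k f).
  apply/funext => w; rewrite /part; case: ifPn => // wm; rewrite /hpart.
  by case: ifP => // _; have [//|/hf/eqP] := eqVneq (f w) 0; rewrite (negPf wm).
elim: sf => [|n l a b ha _ IH].
  have -> : part (hpart k 0) = 0.
    by apply/funext => w; rewrite /part /hpart; do 2?case: ifP.
  exact: lh_zero.
rewrite (linD (@hpart_linear k)) partD; apply: lh_add IH.
rewrite (lie_hom_hpart k ha).
have [kl|_] := eqVneq k l; last first.
  rewrite (_ : part 0 = 0); first exact: lh_zero.
  by apply/funext => w; rewrite /part; case: ifP.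
have [nm|nm] := eqVneq n m.
  rewrite (_ : part a = a); first by rewrite -nm kl.
  apply/funext => w; rewrite /part; case: eqP => // wm.
  by have [//|/(lie_hom_homog ha)] := eqVneq (a w) 0; rewrite nm.
rewrite (_ : part a = 0); first exact: lh_zero.
apply/funext => w; rewrite /part; case: eqP => // wm.
have [//|/(lie_hom_homog ha) wn] := eqVneq (a w) 0.
by case/eqP: nm; rewrite -wn.
Qed.

(** For the full set of letters this is [cfree]; for other sets it records at
    the same time in which closure of cells a series lies. *)
Definition hlie m S f : Prop := homog deg m f /\ lie_gen deg S f.

Lemma hlie_hpart m S k f : hlie m S f -> lie_hom S m k (hpart k f).
Proof.
move=> [hf lf]; have := lie_poly_hpart k (lf k) (hpart_homog (k := k) hf).
by rewrite hpart_hpart eqxx.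
Qed.

Lemma lie_hom_hlie m S l f : lie_hom S m l f -> hlie m S f.
Proof.
move=> hf; split=> [|k]; first exact: lie_hom_homog hf.
rewrite (lie_hom_hpart k hf); case: eqP => _; last exact: lp_zero.
exact: lie_hom_poly hf.
Qed.

(** The space of Lie series is closed in the topology of the completion, which
    reduces infinite sums to finite ones. *)
Lemma hlie_eqm m S f : (forall k, exists2 g, hlie m S g & eqm k f g) ->
  hlie m S f.
Proof.
move=> fg; split=> [|k].
  by apply: homog_eqm => k; have [g [hg _] fgk] := fg k; exists g.
have [g [_ lg] fgk] := fg k.+1; suff -> : hpart k f = hpart k g by [].
by apply/funext => w; rewrite /hpart; case: eqP => // wk; rewrite fgk ?wk.
Qed.

Lemma hlieD m S f g : hlie m S f -> hlie m S g -> hlie m S (f + g).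
Proof.
move=> [hf lf] [hg lg]; split=> [|k]; first exact: homogD.
by rewrite (linD (@hpart_linear k)); apply: lp_add.
Qed.

Lemma hlieZ m S (c : rat) f : hlie m S f -> hlie m S (c *: f).
Proof.
move=> [hf lf]; split=> [|k]; first exact: homogZ.
by rewrite (linZ (@hpart_linear k)); apply: lp_scale.
Qed.

Lemma hlieN m S f : hlie m S f -> hlie m S (- f).
Proof. by rewrite -scaleN1r; apply: hlieZ. Qed.

Lemma hlie0 m S : hlie m S 0.
Proof. exact: lie_hom_hlie (lh_zero _ _ 0). Qed.

Lemma hlie_sum m S (I : Type) (r : seq I) (P : pred I) (F : I -> ser G) :
  (forall i, P i -> hlie m S (F i)) -> hlie m S (\sum_(i <- r | P i) F i).
Proof.
by move=> HF; elim/big_ind: _ => // [|f g]; [exact: hlie0|exact: hlieD].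
Qed.

Lemma hlie_gen S x : S x -> hlie (deg x) S (gen x).
Proof. by move=> Sx; apply: lie_hom_hlie (lh_gen Sx). Qed.

Lemma hlie_nil m S f : hlie m S f -> f [::] = 0.
Proof.
move=> hf; rewrite -[f [::]]/(hpart 0 f [::]).
suff H l p : lie_hom S m l p -> p [::] = 0 by apply: H (hlie_hpart 0 hf).
elim=> {m l p hf} => // [_ _ f' g _ f_ _ g_|_ _ c f' _ f_|m n k l f' g hf f_ hg g_].
- by rewrite addsE f_ g_ addr0.
- by rewrite scalesE f_ mulr0.
- rewrite (brE (lie_hom_homog hf) (lie_hom_homog hg)) addsE oppsE scalesE.
  by rewrite !mul_nil f_ g_ !mulr0 subrr.
Qed.

Lemma hlie_br m n S f g : hlie m S f -> hlie n S g ->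
  hlie (m + n) S (br deg f g).
Proof.
move=> hf hg; apply: hlie_eqm => N.
pose f' := \sum_(k < N) hpart k f; pose g' := \sum_(k < N) hpart k g.
have hf' : hlie m S f'.
  by apply: hlie_sum => k _; apply: lie_hom_hlie (hlie_hpart k hf).
have hg' : hlie n S g'.
  by apply: hlie_sum => k _; apply: lie_hom_hlie (hlie_hpart k hg).
exists (br deg f' g').
  rewrite (lin_sum (br_linl deg g')); apply: hlie_sum => k _.
  rewrite (lin_sum (br_linr deg _)); apply: hlie_sum => l _.
  by apply: lie_hom_hlie; apply: lh_br (hlie_hpart k hf) (hlie_hpart l hg).
rewrite (brE hf.1 hg.1) (brE hf'.1 hg'.1).
have [ef eg] := (hpart_eqm (N := N) f, hpart_eqm (N := N) g).
by rewrite -!scaleNr; apply: eqmD; [apply: eqmM|apply/eqmZ/eqmM].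
Qed.

Lemma hlie_sub m S S' f : (forall x, S x -> S' x) -> hlie m S f -> hlie m S' f.
Proof.
move=> SS [hf lf]; split=> // k; elim: (lf k) => {hf lf} [x Sx||*|*|*].
- exact/lp_gen/SS.
- exact: lp_zero.
- exact: lp_add.
- exact: lp_scale.
- exact: lp_br.
Qed.

Lemma hlie_opeval (I : finType) (T : I -> ser G -> ser G) m S p f :
  (forall i, contraction (T i)) ->
  (forall i g, hlie m S g -> hlie m S (T i g)) ->
  hlie m S f -> hlie m S (opeval T p f).
Proof.
move=> cT hT hf; apply: hlie_eqm => k; eexists; last exact: opeval_wordsE.
apply: hlie_sum => u _; apply: hlieZ.
by elim: u => //= i u; apply: hT.
Qed.

Lemma hlie_br0 m S e f : hlie 0 S e -> hlie m S f -> hlie m S (br deg e f).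
Proof. by move=> he hf; rewrite -[m]add0r; apply: hlie_br. Qed.

Lemma hlie_contr S e : hlie 0 S e -> contraction (br deg e).
Proof. by move=> he; apply: contr_br he.1 (hlie_nil he). Qed.

Lemma hlie_adser m S c e f : hlie 0 S e -> hlie m S f ->
  hlie m S (adser deg c e f).
Proof.
move=> he hf; rewrite adserE; [|exact: he.1|exact: hlie_nil he].
apply: hlie_opeval hf => [_|_ g hg]; first exact: hlie_contr he.
exact: hlie_br0.
Qed.

End LieSeries.

Lemma hlie_map (I G : finType) (degI : I -> int) (deg : G -> int)
    (M : ser I -> ser G) m m' S S' f :
  linear M -> (forall k g h, eqm k g h -> eqm k (M g) (M h)) ->
  (forall l g, lie_hom degI S m l g -> hlie deg m' S' (M g)) ->
  hlie degI m S f -> hlie deg m' S' (M f).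
Proof.
move=> linM eqM hM hf; apply: hlie_eqm => N.
exists (M (\sum_(k < N) hpart k f)); last exact/eqM/hpart_eqm.
rewrite (lin_sum linM); apply: hlie_sum => k _.
exact: hM (hlie_hpart k hf).
Qed.

Lemma hlie_seval (I G : finType) (deg : G -> int) (x : I -> ser G) S p :
  (forall i, hlie deg 0 S (x i)) -> lie_gen (@deg0 I) [set: I] p ->
  hlie deg 0 S (seval x p).
Proof.
move=> hx lp; have x0 i := hlie_nil (hx i).
have hp : hlie (@deg0 I) 0 [set: I] p by split=> //; apply: homog_deg0.
apply: hlie_map hp => [|k g h|l g /lie_hom_poly]; first exact: linear_seval.
  exact: seval_eqm.
elim=> {l g} [i _||f g _ f_ _ g_|c f _ f_|f g _ f_ _ g_].
- by rewrite seval_gen.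
- by rewrite (lin0 (linear_seval x0)); apply: hlie0.
- by rewrite (linD (linear_seval x0)); apply: hlieD.
- by rewrite (linZ (linear_seval x0)); apply: hlieZ.
- rewrite br0E; last exact: homog_deg0.
  rewrite (linB (linear_seval x0)) !sevalM // -(br0E _ f_.1).
  exact: hlie_br0.
Qed.

(** * Conjugation by exponentials *)

Lemma cauchy_ssum (G : finType) (a b : nat -> ser G) N :
  (forall k, eqm k (a k) 0) -> (forall k, eqm k (b k) 0) ->
  eqm N (ssum a * ssum b)
        (\sum_(m < N) \sum_(k < m.+1) a k * b (m - k)%N).
Proof.
move=> a0 b0.
have trunc (c : nat -> ser G) M : (forall k, eqm k (c k) 0) ->
    eqm M (ssum c) (\sum_(k < M) c k).
  move=> c0 w wM; rewrite sum_sE; apply: ssum_natE => m Mm.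
  by apply: c0; apply: leq_trans Mm.
have -> : \sum_(m < N) \sum_(k < m.+1) a k * b (m - k)%N =
          \sum_(k < N) a k * \sum_(l < N - k) b l.
  elim: N => [|N IH]; first by rewrite !big_ord0.
  rewrite big_ord_recr IH /= [RHS]big_ord_recr /= [in LHS]big_ord_recr /=.
  rewrite subSn // subnn big_ord_recl big_ord0 addr0 addrA; congr (_ + _).
  rewrite -big_split /=; apply: eq_bigr => k _.
  by rewrite subSn ?[in RHS]big_ord_recr ?mulrDr // ltnW.
apply: eqm_trans (eqmM (trunc a N a0) (eqm_refl _)) _.
rewrite mulr_suml; apply: eqm_sum => k _.
apply/eqm_subr; rewrite -mulrBr -{1}(subnKC (ltnW (ltn_ord k))).
by apply: eqm0M => //; apply/eqm_subr/trunc.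
Qed.

Section Conjugation.
Variables (G : finType) (deg : G -> int).
Implicit Types (x y : ser G).

Definition divpow x m : ser G := (m`!%:R)^-1 *: iter m (smul x) 1.

Lemma sexp_divpow x : sexp x = ssum (divpow x). Proof. by []. Qed.

Lemma divpow0 x : divpow x 0 = 1.
Proof. by rewrite /divpow fact0 invr1 scale1r. Qed.

Lemma divpowE x m : divpow x m = (m`!%:R)^-1 *: x ^+ m.
Proof. by rewrite /divpow iter_mul0. Qed.

Lemma fact_inv m : m.+1%:R * (m.+1)`!%:R^-1 = (m`!%:R)^-1 :> rat.
Proof. by rewrite factS natrM invfM mulrA divff ?mul1r // pnatr_eq0. Qed.

Lemma divpowSr x m : m.+1%:R *: divpow x m.+1 = divpow x m * x.
Proof. by rewrite !divpowE scalerA fact_inv exprSr scalerAl. Qed.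

Lemma divpow_eqm x m : x [::] = 0 -> eqm m (divpow x m) 0.
Proof.
move=> x0; have -> : (0 : ser G) = (m`!%:R)^-1 *: 0 by rewrite scaler0.
by apply: eqmZ; elim: m => // m; apply: (contr_len (contrM x0)).
Qed.

(** The identities [y exp x = exp x (exp (- ad x) y)] and
    [D (exp x) = exp x (1 - exp (- ad x)) / ad x (D x)] both reduce to this
    convolution: the term of degree [m] on their left-hand sides satisfies the
    same recursion, with [r = 0] and [r = 1]. *)
Lemma divpow_conv x (c : nat -> ser G) r m :
  (forall l, c l * x = x * c l + (l + r.+1)%:R *: c l.+1) ->
  (\sum_(k < m.+1) divpow x k * c (m - k)%N) * x
    + r%:R *: (divpow x m.+1 * c 0%N) =
  (m + r.+1)%:R *: \sum_(k < m.+2) divpow x k * c (m.+1 - k)%N.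
Proof.
move=> cx; rewrite scaler_sumr.
under [RHS]eq_bigr => k _.
  have -> : (m + r.+1 = k + (m.+1 - k + r))%N.
    by rewrite addnA subnKC ?addSnnS // -ltnS.
  rewrite natrD scalerDl; over.
rewrite big_split /= [X in _ = X + _]big_ord_recl scale0r add0r.
rewrite [X in _ = _ + X]big_ord_recr /= subnn addrA; congr (_ + _).
rewrite mulr_suml -big_split /=; apply: eq_bigr => k _.
rewrite -mulrA cx mulrDr mulrA -divpowSr -scalerAl -scalerAr subSS.
by rewrite subSn ?addSnnS // -ltnS.
Qed.

Variable x : ser G.
Hypotheses (hx : homog deg 0 x) (x0 : x [::] = 0).

Let nx0 : (- x) [::] = 0. Proof. exact: opp_nil. Qed.
Let hnx : homog deg 0 (- x). Proof. exact: homogN. Qed.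

Lemma mul_sexp y : y * sexp x = sexp x * expad deg (- x) y.
Proof.
pose b l := (l`!%:R)^-1 *: iter l (br deg (- x)) y.
have bx l : b l * x = x * b l + (l + 1)%:R *: b l.+1.
  rewrite addn1 scalerA fact_inv iterS br0E // !scalerBr.
  rewrite mulNr mulrN !scalerN opprK addrA.
  by rewrite -scalerAr subrr add0r -scalerAl.
have b0 k : eqm k (b k) 0.
  have -> : (0 : ser G) = (k`!%:R)^-1 *: 0 by rewrite scaler0.
  by apply: eqmZ; elim: k => // k; apply: (contr_len (contr_br hnx nx0)).
have yb m : y * divpow x m = \sum_(k < m.+1) divpow x k * b (m - k)%N.
  elim: m => [|m IH].
    by rewrite big_ord_recl big_ord0 addr0 !divpow0 mul1r mulr1 /b invr1 scale1r.
  apply: (scalerI (a := m.+1%:R)); first by rewrite pnatr_eq0.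
  have := divpow_conv m bx; rewrite scale0r addr0 -IH addn1 => <-.
  by rewrite -mulrA -divpowSr scalerAr.
rewrite sexp_divpow [expad _ _ _](_ : _ = ssum b) //.
apply: eqmP => N; apply/eqm_sym.
apply: (eqm_trans (@cauchy_ssum _ _ _ N (fun k => @divpow_eqm x k x0) b0)).
under eq_bigr do rewrite -yb.
rewrite -mulr_sumr; apply: eqmM => //; apply/eqm_sym => w wN.
rewrite sum_sE; apply: ssum_natE => m Nm; apply: divpow_eqm => //.
exact: leq_trans Nm.
Qed.

End Conjugation.

(** The exponential of [ad x] is conjugation by [exp x]. *)
Lemma expadE (G : finType) (deg : G -> int) (x y : ser G) :
  homog deg 0 x -> x [::] = 0 -> expad deg x y = sexp x * y * sexp (- x).
Proof.
move=> hx x0; rewrite -mulrA (mul_sexp (homogN hx) (opp_nil x0)) opprK mulrA.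
by rewrite sexpNr // mul1r.
Qed.

(** * Odd derivations *)

(** The condition on letters makes the derivation continuous. *)
Record odd_derivation (G : finType) (deg : G -> int) (D : ser G -> ser G)
    : Prop := OddDerivation {
  od_lin : linear D;
  od_mul : forall f g, D (f * g) = D f * g + parity deg f * D g;
  od_gen : forall x, D (gen x) [::] = 0 }.

Section OddDerivation.
Variables (G : finType) (deg : G -> int) (D : ser G -> ser G).
Hypothesis oD : odd_derivation deg D.
Implicit Types (f g p q s t e : ser G) (S : set G).

Let lD := od_lin oD.

Lemma od1 : D 1 = 0.
Proof.
have := od_mul oD 1 1; rewrite parity1 !mul1r !mulr1 => D1.
by apply: (addrI (D 1)); rewrite -D1 addr0.
Qed.

Lemma od_even f g : homog deg 0 f -> D (f * g) = D f * g + f * D g.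
Proof. by move=> hf; rewrite (od_mul oD) (parity_even hf). Qed.

Lemma od_oddM f g : homog deg (-1) f -> D (f * g) = D f * g - f * D g.
Proof. by move=> hf; rewrite (od_mul oD) (parity_odd hf) mulNr. Qed.

Lemma od_eqm0 k f : eqm k f 0 -> eqm k (D f) 0.
Proof.
elim: k f => // k IH f f0; rewrite (lquo_rec f) (linD lD) (linZ lD) od1.
rewrite scaler0 add0r (lin_sum lD); apply: eqm0_sum => x _.
have fx := lquo_eqm x f0.
rewrite (od_mul oD) -[0](addr0 (0 : ser G)) -add1n.
apply: eqmD; apply: eqm0M => //; last exact: IH.
  by apply/eqm1; apply: (od_gen oD).
by apply/eqm1; rewrite parity_nil gen_nil.
Qed.

Lemma od_eqm k f g : eqm k f g -> eqm k (D f) (D g).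
Proof.
by move=> /eqm_subr/od_eqm0 fg; apply/eqm_subr; rewrite -(linB lD).
Qed.

Lemma od_br m n f g : homog deg m f -> homog deg n g ->
  homog deg (m - 1) (D f) -> homog deg (n - 1) (D g) ->
  D (br deg f g) = br deg (D f) g + sgn m *: br deg f (D g).
Proof.
move=> hf hg hDf hDg; rewrite (brE hf hg) (brE hDf hg) (brE hf hDg).
rewrite (linB lD) (linZ lD) !(od_mul oD) (parity_homog hf) (parity_homog hg).
rewrite mulrBl mulrBr mul1r mulr1 !sgnD !sgnN.
rewrite scalerBr scalerDr -!scalerAl !scalerA opprD.
have -> : sgn m * (sgn (m * n) * sgn m) = sgn (m * n).
  by rewrite mulrCA sgn_sq mulr1.
by rewrite [X in _ + X = _]addrC addrACA.
Qed.

Lemma od_hlie m S S' f :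
  (forall x, S x -> hlie deg (deg x - 1) S' (D (gen x))) ->
  (forall x, S x -> S' x) -> hlie deg m S f -> hlie deg (m - 1) S' (D f).
Proof.
move=> hS SS; apply: hlie_map => [|k g h|l g hg]; [exact: lD|exact: od_eqm|].
elim: hg => {m l f g}
  [x /hS //|m l|m l f g _ f_ _ g_|m l c f _ f_|m n k l f g hf f_ hg g_].
- by rewrite (lin0 lD); apply: hlie0.
- by rewrite (linD lD); apply: hlieD.
- by rewrite (linZ lD); apply: hlieZ.
- have [hf' hg'] := (hlie_sub SS (lie_hom_hlie hf), hlie_sub SS (lie_hom_hlie hg)).
  rewrite (od_br hf'.1 hg'.1 f_.1 g_.1); apply: hlieD.
    by rewrite addrAC; apply: hlie_br.
  by apply: hlieZ; rewrite -addrA; apply: hlie_br.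
Qed.

(** On powers of [g - 1] the derivation acts by the Leibniz rule, and it kills
    [g - 1]. *)
Lemma od_slog0 g : g [::] = 1 -> D g = 0 -> D (slog g) = 0.
Proof.
move=> g1 Dg; rewrite slogE //; set z := g - 1.
have z0 (i : unit) : z [::] = 0 by rewrite /z addsE oppsE g1 subrr.
rewrite sevalE // (opeval_intertwine (T' := fun=> smul (parity deg z))) => //.
- rewrite od1; apply: (lin0 (opeval_linear (T := fun=> _) _ _)) => _.
  by apply: contrM; rewrite parity_nil (z0 tt).
- by move=> i; apply: contrM (z0 i).
- by move=> i; apply: contrM; rewrite parity_nil (z0 tt).
- move=> i f; rewrite mulsE (od_mul oD) (linB lD) Dg od1 subrr mul0r add0r.
  by [].
Qed.

(** The square of an odd derivation is a derivation, so it vanishes on the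
    values of power series at elements on which it vanishes. *)
Lemma od_sq_seval (I : finType) (x : I -> ser G) (p : ser I) :
  (forall i, x i [::] = 0) -> (forall i, homog deg 0 (x i)) ->
  (forall i, homog deg (-1) (D (x i))) -> (forall i, D (D (x i)) = 0) ->
  D (D (seval x p)) = 0.
Proof.
move=> x0 hx hDx DDx; rewrite sevalE //.
rewrite (opeval_intertwine (M := fun f => D (D f)) (T' := fun i => smul (x i))).
- rewrite od1 (lin0 lD); apply: (lin0 (opeval_linear _ _)) => i.
  exact: contrM.
- by move=> i; apply: contrM.
- by move=> i; apply: contrM.
- by move=> c f g; rewrite !lD.
- move=> i f; rewrite mulsE (od_even _ (hx i)) (linD lD) (od_oddM _ (hDx i)).
  by rewrite (od_even _ (hx i)) DDx mul0r add0r addrA addNr add0r.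
Qed.

Lemma od_sq0 f : (forall x, homog deg (deg x - 1) (D (gen x))) ->
  (forall x, D (D (gen x)) = 0) -> D (D f) = 0.
Proof.
move=> hD DD; apply: (@lin_eq0 _ _ (fun f => D (D f)) (fun x => smul (gen x))).
- by move=> x; apply: contrM.
- by move=> c g h; rewrite !lD.
- by rewrite od1 (lin0 lD).
- move=> x g; rewrite (od_mul oD) (parity_homog (homog_gen deg (x := x))).
  rewrite -scalerAl (linD lD) (linZ lD) !(od_mul oD) DD mul0r add0r.
  rewrite (parity_homog (hD x)) (parity_homog (homog_gen deg (x := x))).
  rewrite sgnD sgnN1 mulrN1 scaleNr mulNr scalerDr -!scalerAl addKr.
  by rewrite scalerA sgn_sq scale1r.
Qed.

End OddDerivation.

Section OddDerivationExp.
Variables (G : finType) (deg : G -> int) (D : ser G -> ser G).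
Hypothesis oD : odd_derivation deg D.
Implicit Types (f g p q s t e : ser G).

Let lD := od_lin oD.

Lemma homog_divpow e m : homog deg 0 e -> homog deg 0 (divpow e m).
Proof.
move=> he; rewrite divpowE; apply: homogZ; elim: m => [|m IH].
  by rewrite expr0; apply: homog1.
by rewrite exprS; apply: homogMl.
Qed.

Lemma iter_brN e f m :
  iter m (br deg (- e)) f = (-1) ^+ m *: iter m (br deg e) f.
Proof.
elim: m => [|m IH]; first by rewrite scale1r.
rewrite iterS IH (linN (br_linl deg _)) (linZ (br_linr deg e)).
by rewrite exprS mulN1r scaleNr.
Qed.

(** The derivative of the exponential: the terms of [D (e^m / m!)] form the
    convolution of [exp e] with the series [(1 - exp (- ad e)) / ad e]. *)
Lemma od_sexp e : homog deg 0 e -> e [::] = 0 ->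
  D (sexp e) = sexp e * adser deg flow_coef e (D e).
Proof.
move=> he e0; pose c l := (l.+1`!%:R)^-1 *: iter l (br deg (- e)) (D e).
have hne := homogN he.
have ce l : c l * e = e * c l + (l + 2)%:R *: c l.+1.
  rewrite addn2 scalerA fact_inv iterS br0E // !scalerBr.
  rewrite mulNr mulrN !scalerN opprK addrA.
  by rewrite -scalerAr subrr add0r -scalerAl.
have c0 k : eqm k (c k) 0.
  have -> : (0 : ser G) = (k.+1`!%:R)^-1 *: 0 by rewrite scaler0.
  apply: eqmZ; elim: k => // k.
  exact: (contr_len (contr_br hne (opp_nil e0))).
have Dd m : D (divpow e m.+1) = \sum_(k < m.+1) divpow e k * c (m - k)%N.
  elim: m => [|m IH].
    rewrite big_ord_recl big_ord0 addr0 divpow0 mul1r /c invr1 scale1r.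
    by rewrite divpowE invr1 scale1r expr1.
  apply: (scalerI (a := m.+2%:R)); first by rewrite pnatr_eq0.
  rewrite -(linZ lD) divpowSr (od_even oD _ (@homog_divpow e m.+1 he)) IH.
  have := divpow_conv m ce; rewrite scale1r addn2 => <-.
  by rewrite /c invr1 scale1r.
have -> : adser deg flow_coef e (D e) = ssum c.
  congr ssum; apply/funext => m; rewrite /c iter_brN scalerA /flow_coef.
  by congr (_ *: _); rewrite mulrC.
rewrite sexp_divpow; apply: eqmP => N; apply/eqm_sym.
have ek k : eqm k (divpow e k) 0 by apply: divpow_eqm.
apply: (eqm_trans (@cauchy_ssum _ _ _ N ek c0)).
under eq_bigr do rewrite -Dd.
have -> : \sum_(m < N) D (divpow e m.+1) = D (\sum_(m < N.+1) divpow e m).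
  by rewrite (lin_sum lD) big_ord_recl divpow0 (od1 oD) add0r.
apply: (eqm_le (leqnSn N)); apply: (od_eqm oD); apply/eqm_sym => w wN.
rewrite sum_sE; apply: ssum_natE => m Nm; apply: ek; exact: leq_trans Nm.
Qed.

(** * Gauge transformations and twisted differentials *)

Lemma dptE s f : homog deg (-1) s ->
  dpt deg D s f = D f + (s * f - parity deg f * s).
Proof. by move=> hs; rewrite /dpt brN1E. Qed.

Lemma odd_derivation_dpt s : homog deg (-1) s -> s [::] = 0 ->
  odd_derivation deg (dpt deg D s).
Proof.
move=> hs s0; split=> [c f g|f g|x].
- by rewrite /dpt lD (br_linr deg s) scalerDr addrACA.
- rewrite !dptE // (od_mul oD) parityM mulrDl mulrDr [RHS]addrACA.
  congr (_ + _); rewrite mulrBl mulrBr !mulrA.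
  by rewrite addrA subrK.
- by rewrite dptE // !addsE oppsE !mul_nil s0 (od_gen oD) !mulr0
    subrr.
Qed.

(** [p] transforms the connection [s] into [t]: as a change of gauge it
    carries the twisted differential at [s] to the one at [t].  Such [p]
    compose like paths from [s] to [t]. *)
Definition gauge p s t := D p = p * t - s * p.

Lemma gaugeM p q r s t : homog deg 0 p ->
  gauge p r s -> gauge q s t -> gauge (p * q) r t.
Proof.
move=> hp gp gq; rewrite /gauge (od_even oD _ hp) gp gq mulrBl mulrBr !mulrA.
by rewrite addrC addrA subrK.
Qed.

Lemma gaugeV p q s t : homog deg 0 q -> q * p = 1 -> p * q = 1 ->
  gauge p s t -> gauge q t s.
Proof.
move=> hq qp pq gp; have := od_even oD p hq; rewrite qp (od1 oD) gp.
move/(congr1 ( *%R^~ q)); rewrite mul0r mulrDl -[_ * p * q]mulrA pq mulr1.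
rewrite mulrBr mulrBl !mulrA qp mul1r -[_ * p * q]mulrA pq mulr1.
by move/esym/eqP; rewrite addr_eq0 opprB => /eqP.
Qed.

(** Transport of the twisted differential along the gauge transformation [p]
    with inverse [q]. *)
Lemma gauge_conj p q s t f : homog deg 0 p -> homog deg 0 q ->
  homog deg (-1) s -> homog deg (-1) t -> q * p = 1 -> p * q = 1 ->
  gauge p s t -> dpt deg D t (q * f * p) = q * dpt deg D s f * p.
Proof.
move=> hp hq hs ht qp pq gp; have gq := gaugeV hq qp pq gp.
have hqf : parity deg (q * f) = q * parity deg f by rewrite parityM parity_even.
rewrite !dptE // (od_mul oD) (od_even oD _ hq) hqf parityM hqf (parity_even hp).
rewrite gp gq; move: (parity deg f) => f'.
rewrite !(mulrBl, mulrBr, mulrDl, mulrDr, mulrA).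
(* The terms in which [t] occurs cancel. *)
set A := q * s * f * p; set B := t * q * f * p; set C := q * D f * p.
set E := q * f' * p * t; set F := q * f' * s * p.
rewrite [E - F]addrC -addrA [- F + E + _]addrACA subrr addr0 [- F + B]addrC.
by rewrite addrA [_ + C + B]addrAC subrK addrAC addrA [C + A]addrC addrAC.
Qed.

(** The terms involving [s] combine to [D s + s s], which vanishes at a point. *)
Lemma dpt_dpt m s f : homog deg (-1) s -> D s = - (s * s) ->
  homog deg m f -> homog deg (m - 1) (D f) ->
  dpt deg D s (dpt deg D s f) = D (D f).
Proof.
move=> hs Ds hf hDf; have hsf := parity_homog hf.
have hsD : parity deg (D f) = - (sgn m *: D f).
  by rewrite (parity_homog hDf) sgnD sgnN1 mulrN1 scaleNr.
have Df' : D (parity deg f) = - parity deg (D f) by rewrite hsD opprK hsf (linZ lD).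
have ff : parity deg (parity deg f) = f.
  by rewrite hsf (linZ (parity_linear deg)) hsf scalerA sgn_sq scale1r.
rewrite !(dptE _ hs) (linD lD) (linB lD) (od_oddM oD _ hs) (od_mul oD) Ds.
rewrite (linD (parity_linear deg)) (linB (parity_linear deg)) !parityM.
rewrite (parity_odd hs) ff Df'; move: (parity deg f) (parity deg (D f)) => f1 f2.
rewrite !(mulrBl, mulrBr, mulrDl, mulrDr, mulNr, mulrN, opprD, opprK, addrA, mulrA).
rewrite [LHS](ACl (1*(2*7)*(3*6)*(4*9)*(5*11)*(8*10)))%AC /=.
by rewrite !addNr !subrr !addr0.
Qed.

Lemma gauge_loop p s : homog deg 0 p -> homog deg (-1) s ->
  gauge p s s -> dpt deg D s p = 0.
Proof.
move=> hp hs gp; rewrite dptE // (parity_even hp) gp addrA.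
by rewrite subrK subrr.
Qed.

(** A gauge transformation from [s] to itself is closed for the twisted
    differential at [s]. *)
Lemma dpt_slog p s : homog deg 0 p -> homog deg (-1) s -> s [::] = 0 ->
  p [::] = 1 -> gauge p s s -> dpt deg D s (slog p) = 0.
Proof.
move=> hp hs s0 p1 gp.
exact: (od_slog0 (odd_derivation_dpt hs s0) p1 (gauge_loop hp hs gp)).
Qed.

Section Flow.
Variables (e a : ser G).
Hypotheses (he : homog deg 0 e) (e0 : e [::] = 0).

Lemma flowE : flow deg D e a =
  sexp (- e) * a * sexp e + adser deg flow_coef e (D e).
Proof.
have := @expadE G deg (- e) a (homogN he) (opp_nil e0).
by rewrite opprK /flow => ->.
Qed.

(** By the formula for [D (exp e)], the flow is
    [exp (- e) a (exp e) + exp (- e) D (exp e)], the classical gauge action. *)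
Lemma gauge_flow : gauge (sexp e) a (flow deg D e a).
Proof.
rewrite /gauge flowE mulrDr -od_sexp // !mulrA sexpNr // mul1r.
by rewrite addrAC subrr add0r.
Qed.

(** [0 = D (D (exp e))] expands to [exp e (D y + y y)]. *)
Lemma flow_point : homog deg (-1) a -> homog deg (-1) (D e) ->
  D a = - (a * a) -> D (D (sexp e)) = 0 ->
  D (flow deg D e a) = - (flow deg D e a * flow deg D e a).
Proof.
move=> ha hDe Da; have hx := homog_sexp he e0.
have := gauge_flow; set y := flow deg D e a; set p := sexp e => gp.
rewrite {1}gp (linB lD) (od_even oD _ hx) (od_oddM oD _ ha) Da gp.
rewrite !(mulrBl, mulrBr, mulNr, mulrN, opprB, opprD, opprK, addrA, mulrA).
rewrite -/p [LHS in LHS = _ -> _](ACl ((1*3)*(2*4)*(5*6)))%AC /=.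
rewrite !addNr !addr0 -mulrA -mulrDr => /(congr1 ( *%R (sexp (- e)))).
rewrite mulr0 mulrA sexpNl // mul1r => /eqP.
by rewrite addrC addr_eq0 => /eqP.
Qed.
End Flow.

End OddDerivationExp.

Lemma half_br_odd (G : finType) (deg : G -> int) (a : ser G) :
  homog deg (-1) a -> (1 / 2) *: br deg a a = a * a.
Proof.
move=> ha; rewrite (brE ha ha) mulrNN mulr1 scaleN1r opprK.
by rewrite -mulr2n -scaler_nat scalerA divfK ?scale1r.
Qed.

Lemma is_pointP (G : finType) (deg : G -> int) (D : ser G -> ser G) a :
  cfree deg (-1) a -> D a = - (a * a) -> is_point deg D a.
Proof. by move=> ca Da; split=> //; rewrite Da half_br_odd ?addNr //; case: ca. Qed.

(** * The derivation with given values on the letters *)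

Section Extension.
Variables (G : finType) (deg : G -> int) (dv : G -> ser G).
Hypothesis dv0 : forall x, dv x [::] = 0.

(** Recursion along the first letter: [D (x f) = D x f + (-1)^|x| x D f]. *)
Fixpoint dext_word (w : seq G) (f : ser G) {struct w} : rat :=
  \sum_x (dv x * lquo x f) w +
  (if w is y :: w' then sgn (deg y) * dext_word w' (lquo y f) else 0).

Definition dext (f : ser G) : ser G := fun w => dext_word w f.

Lemma dext_linear : linear dext.
Proof.
move=> c f g; apply/funext => w; rewrite addsE scalesE /dext.
elim: w f g => [|y w IH] f g /=.
  rewrite !addr0 mulr_sumr -big_split /=; apply: eq_bigr => x _.
  by rewrite lquoD lquoZ mulrDr -scalerAr.
rewrite lquoD lquoZ IH !mulrDr !mulr_sumr addrACA; congr (_ + _).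
  rewrite -big_split /=; apply: eq_bigr => x _.
  by rewrite lquoD lquoZ mulrDr -scalerAr.
by rewrite mulrCA.
Qed.

Lemma dext_gen_mul x f :
  dext (gen x * f) = dv x * f + sgn (deg x) *: (gen x * dext f).
Proof.
have q y : lquo y (gen x * f) = (y == x)%:R * f.
  by rewrite lquoM gen_nil scale0r addr0 lquo_gen.
have s w : \sum_y (dv y * lquo y (gen x * f)) w = (dv x * f) w.
  rewrite (bigD1 x) //= q eqxx mul1r big1 ?addr0 // => y /negPf yx.
  by rewrite q yx mul0r mulr0.
apply/funext => -[|y w]; rewrite addsE scalesE {1}/dext /= s.
  by rewrite gen_mul_nil mulr0.
congr (_ + _); rewrite gen_mul_cons q; have [->|_] := eqVneq y x.
  by rewrite !mul1r.
by rewrite !mul0r mulr0 -/(dext 0 w) (lin0 dext_linear) mulr0.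
Qed.

Lemma dext1 : dext 1 = 0.
Proof.
apply/funext => w; rewrite /dext; case: w => [|y w] /=.
  by rewrite big1 ?addr0 // => x _; rewrite lquo1 mulr0.
rewrite lquo1 -/(dext 0 w) (lin0 dext_linear) mulr0 addr0.
by rewrite big1 // => x _; rewrite lquo1 mulr0.
Qed.

Lemma dext_gen x : dext (gen x) = dv x.
Proof. by rewrite -[gen x]mulr1 dext_gen_mul dext1 mulr1 mulr0 scaler0 addr0. Qed.

Lemma odd_derivation_dext : odd_derivation deg dext.
Proof.
split=> [|f g|x]; [exact: dext_linear| |by rewrite dext_gen].
pose M f := dext (f * g) - (dext f * g + parity deg f * dext g).
suff /eqP : M f = 0 by rewrite subr_eq0 => /eqP.
apply: (@lin_eq0 _ _ M (fun x f => sgn (deg x) *: smul (gen x) f)).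
- by move=> x; apply/contrZ/contrM.
- move=> c h k; rewrite /M mulrDl -scalerAl !dext_linear (parity_linear deg).
  rewrite !mulrDl -!scalerAl addrACA -scalerDr scalerBr opprD addrACA.
  by [].
- by rewrite /M dext1 parity1 mul0r add0r !mul1r subrr.
- move=> x h; rewrite /M parityM (parity_homog (homog_gen deg (x := x))).
  rewrite -mulrA !dext_gen_mul mulrDl !mulrA mulsE -!scalerAl.
  rewrite -[X in _ - X]addrA opprD addrACA subrr add0r -scalerDr -scalerBr.
  by rewrite mulrBr mulrDr !mulrA.
Qed.

End Extension.

(** * The free graded Lie algebra *)

Section GradedLie.
Variables (G : finType) (deg : G -> int).
Implicit Types (f g : ser G).

Lemma graded_lie_homog (A : int -> set (ser G)) :
  (forall m, A m 0) ->
  (forall m (c : rat) f g, A m f -> A m g -> A m (c *: f + g)) ->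
  (forall m f, A m f -> homog deg m f) ->
  (forall m n f g, A m f -> A n g -> A (m + n) (br deg f g)) ->
  graded_lie A (br deg).
Proof.
move=> A0 Alin Ahom Abr; split=> //.
- move=> s x us Ax sx0 m ms; apply/funext => w.
  have [//|xw] := eqVneq (x m w) 0.
  have /(congr1 (@^~ w)) := sx0.
  rewrite sum_sE (bigD1_seq m) //= big1 ?addr0 // => m' m'm.
  have [//|xw'] := eqVneq (x m' w) 0.
  by case/eqP: m'm; rewrite -(Ahom _ _ (Ax m') w xw') (Ahom _ _ (Ax m) w xw).
- by move=> m n c x x' y _ _ _; rewrite (br_linl deg).
- by move=> m n c x y y' _ _ _; rewrite (br_linr deg).
- move=> m n x y /Ahom hx /Ahom hy; rewrite (brE hx hy) (brE hy hx).
  by rewrite scalerBr scalerA sgn_sq scale1r [n * m]mulrC opprB.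
- move=> m n p x y z /Ahom hx /Ahom hy /Ahom hz.
  have hxy : homog deg (m + n) (br deg x y) by apply: homog_br.
  have hyz : homog deg (n + p) (br deg y z) by apply: homog_br.
  have hxz : homog deg (m + p) (br deg x z) by apply: homog_br.
  rewrite (brE hxy hz) (brE hx hyz) (brE hy hxz) (brE hx hy) (brE hy hz) (brE hx hz).
  rewrite (mulrDl m n p) (mulrDr m n p) (mulrDr n m p) !sgnD [n * m]mulrC.
  move: (sgn_sq (m * n)).
  move: (sgn (m * n)) (sgn (m * p)) (sgn (n * p)) => a b c aa.
  rewrite !(mulrBl, mulrBr) -!scalerAl -!scalerAr.
  rewrite !scalerBr !scalerA !mulrA aa mul1r !(opprB, opprD, opprK, addrA).
  rewrite [RHS](ACl (1*8*3*6*(2*5)*(4*7)))%AC /= !addNr !addr0.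
  by rewrite [b * c * a]mulrC mulrA [c * b]mulrC.
Qed.

Lemma pfree_hpart m f k : pfree deg m f -> lie_hom deg [set: G] m k (hpart k f).
Proof. by move=> [hf lf]; apply: lie_poly_hpart. Qed.

Lemma lie_hom_pfree m l f : lie_hom deg [set: G] m l f -> pfree deg m f.
Proof. by move=> hf; split; [exact: lie_hom_homog hf|exact: lie_hom_poly hf]. Qed.

Definition short N f := forall w, (N <= size w)%N -> f w = 0.

Lemma short_le N N' f : (N <= N')%N -> short N f -> short N' f.
Proof. by move=> NN sf w Nw; apply: sf; apply: leq_trans Nw. Qed.

Lemma short_lin N (c : rat) f g : short N f -> short N g -> short N (c *: f + g).
Proof. by move=> sf sg w Nw; rewrite addsE scalesE sf // sg // mulr0 addr0. Qed.

Lemma lie_hom_short S m l f : lie_hom deg S m l f -> short l.+1 f.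
Proof.
move=> hf w lw; have [//|/(lie_hom_size hf) wl] := eqVneq (f w) 0.
by rewrite wl ltnn in lw.
Qed.

Lemma lie_poly_short S f : lie_poly deg S f -> exists N, short N f.
Proof.
move=> /lie_poly_sum; elim=> [|m l a b ha _ [N sb]]; first by exists 0%N.
exists (maxn l.+1 N); rewrite -[a]scale1r; apply: short_lin.
  by apply: short_le (lie_hom_short ha); apply: leq_maxl.
by apply: short_le sb; apply: leq_maxr.
Qed.

Lemma short_hpart N f : short N f -> f = \sum_(k < N) hpart k f.
Proof.
move=> sf; apply/funext => w; case: (ltnP (size w) N) => wN.
  exact: hpart_eqm.
rewrite sf // sum_sE big1 // => k _; rewrite /hpart ifN //.
by apply: contraTneq wN => ->; rewrite -ltnNge.
Qed.

Lemma graded_lie_pfree : graded_lie (pfree deg) (br deg).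
Proof.
apply: graded_lie_homog => [m|m c f g [hf lf] [hg lg]|m f []//|m n f g [hf lf] [hg lg]].
- by split; [exact: homog0|exact: lp_zero].
- by split; [apply: homogD => //; exact: homogZ|apply: lp_add => //; exact: lp_scale].
- by split; [exact: homog_br|exact: lp_br].
Qed.

Lemma graded_lie_cfree : graded_lie (cfree deg) (br deg).
Proof.
apply: graded_lie_homog => [m|m c f g hf hg|m f []//|m n f g hf hg].
- exact: hlie0.
- by apply: hlieD => //; apply: hlieZ.
- exact: hlie_br.
Qed.

End GradedLie.

Section Evaluation.
Variables (G : finType) (W : lmodType rat).
Implicit Types (f g : ser G) (F : seq G -> W).

(** The linear extension of [F] from words to short series.  As [F] is just a
    function, this is linear in [f] without any assumption on the bracket of
    [W], which is bilinear on homogeneous elements only. *)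
Definition lsum N f F : W := \sum_(w <- words G N) f w *: F w.

Lemma lsumS N f F : lsum N.+1 f F =
  f [::] *: F [::] + \sum_x lsum N (lquo x f) (fun w => F (x :: w)).
Proof. exact: big_words. Qed.

Lemma lsum_lin N (c : rat) f g F :
  lsum N (c *: f + g) F = c *: lsum N f F + lsum N g F.
Proof.
rewrite /lsum scaler_sumr -big_split /=; apply: eq_bigr => w _.
by rewrite addsE scalesE scalerDl scalerA.
Qed.

Lemma eq_lsum N f F F' : (forall w, f w != 0 -> F w = F' w) ->
  lsum N f F = lsum N f F'.
Proof.
move=> FF; apply: eq_bigr => w _.
by have [->|/FF ->//] := eqVneq (f w) 0; rewrite !scale0r.
Qed.

Lemma lsumZ N f F (k : rat) : lsum N f (fun w => k *: F w) = k *: lsum N f F.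
Proof.
rewrite /lsum scaler_sumr; apply: eq_bigr => w _.
by rewrite !scalerA mulrC.
Qed.

Lemma short_lquo N f x : short N.+1 f -> short N (lquo x f).
Proof. by move=> sf w Nw; apply: sf. Qed.

Lemma lsum_widen N N' f F : short N f -> (N <= N')%N -> lsum N' f F = lsum N f F.
Proof.
elim: N N' f F => [|N IH] N' f F sf.
  by move=> _; rewrite /lsum big_nil big1 // => w _; rewrite sf ?scale0r.
case: N' => // N' NN; rewrite !lsumS; congr (_ + _).
by apply: eq_bigr => x _; apply: IH => //; apply: short_lquo.
Qed.

(** The words of a product are the concatenations. *)
Lemma lsum_mul K L N f g F : short K f -> short L g -> (K + L <= N)%N ->
  lsum N (f * g) F = lsum K f (fun u => lsum L g (fun v => F (u ++ v))).
Proof.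
elim: K N f F => [|K IH] N f F sf sg.
  have -> : f = 0 by apply/funext => w; apply: sf.
  by rewrite mul0r /lsum big_nil big1 // => w _; rewrite scale0r.
case: N => // N KN; rewrite !lsumS /=.
rewrite -(lsum_widen (fun v => F v) sg (N' := N.+1)); last first.
  by apply: leq_trans KN; rewrite leq_addl.
rewrite lsumS mul_nil scalerDr scalerA -addrA scaler_sumr; congr (_ + _).
rewrite -big_split /=; apply: eq_bigr => x _.
rewrite lquoM [X in lsum _ X _]addrC lsum_lin; congr (_ + _).
by rewrite IH //; apply: short_lquo.
Qed.

Lemma fsum_short N f F : short N f ->
  \sum_(w \in [set: seq G]) f w *: F w = lsum N f F.
Proof.
move=> sf; rewrite /lsum [RHS]fsbig_seq ?uniq_words //; apply/esym/fsbig_widen.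
  by [].
move=> w [_ /= /negP]; rewrite mem_words -leqNgt => /sf ->.
by rewrite scale0r.
Qed.

End Evaluation.

(** Dynkin's argument: in any graded Lie algebra, evaluating the words of a
    homogeneous Lie polynomial of length [l] as right-normed brackets gives
    [l] times its value.  So dividing each word by its length defines the
    morphism on polynomials themselves, independently of how they are written
    as brackets. *)
Section Dynkin.
Variables (G : finType) (deg : G -> int) (W : lmodType rat).
Variables (B : int -> set W) (c : W -> W -> W) (phi : G -> W).
Hypotheses (gB : graded_lie B c) (Bphi : forall x, B (deg x) (phi x)).
Implicit Types (f g : ser G) (m n p : int) (z : W) (u w : seq G).

Let B0 m : B m 0. Proof. exact: (gl_zero gB). Qed.

Let BD m y z : B m y -> B m z -> B m (y + z).
Proof. by move=> By Bz; rewrite -[y]scale1r; apply: (gl_sub gB). Qed.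

Let BZ m (k : rat) z : B m z -> B m (k *: z).
Proof. by move=> Bz; rewrite -[_ *: _]addr0; apply: (gl_sub gB). Qed.

Let Bsum m (I : eqType) (r : seq I) (k : I -> rat) (F : I -> W) :
  (forall i, k i != 0 -> B m (F i)) -> B m (\sum_(i <- r) k i *: F i).
Proof.
move=> BF; elim/big_ind: _ => [||i _]; [exact: B0|exact: BD|].
by have [->|/BF/BZ//] := eqVneq (k i) 0; rewrite scale0r.
Qed.

Let cr0 m y : B m y -> c y 0 = 0.
Proof.
move=> By; have := gl_linr gB 1 By (B0 0) (B0 0).
rewrite scaler0 addr0 scale1r => c0; apply: (addrI (c y 0)).
by rewrite -c0 addr0.
Qed.

Let cl0 m y : B m y -> c 0 y = 0.
Proof.
by move=> By; rewrite (gl_anti gB By (B0 0)) (cr0 By) scaler0 oppr0.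
Qed.

Let crD m n x y z : B m x -> B n y -> B n z -> c x (y + z) = c x y + c x z.
Proof. by move=> Bx By Bz; rewrite -[y]scale1r (gl_linr gB 1 Bx By Bz) !scale1r. Qed.

Let clD m n x y z : B m x -> B m y -> B n z -> c (x + y) z = c x z + c y z.
Proof. by move=> Bx By Bz; rewrite -[x]scale1r (gl_linl gB 1 Bx By Bz) !scale1r. Qed.

Let crZ m n (k : rat) x y : B m x -> B n y -> c x (k *: y) = k *: c x y.
Proof.
move=> Bx By; have := gl_linr gB k Bx By (B0 n).
by rewrite (cr0 Bx) !addr0.
Qed.

Let clZ m n (k : rat) x y : B m x -> B n y -> c (k *: x) y = k *: c x y.
Proof.
move=> Bx By; have := gl_linl gB k Bx (B0 m) By.
by rewrite (cl0 By) !addr0.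
Qed.

(** [rad (x1 .. xk) z = [x1, [.., [xk, z]]]], and [rnorm] is the right-normed
    bracket of a word. *)
Definition rad w z := foldr (fun x y => c (phi x) y) z w.

Fixpoint rnorm w : W :=
  if w is x :: w' then (if w' is [::] then phi x else c (phi x) (rnorm w'))
  else 0.

Definition dynkin f : W :=
  \sum_(w \in [set: seq G]) f w *: ((size w)%:R^-1 *: rnorm w).

Lemma rad_cat u w z : rad (u ++ w) z = rad u (rad w z).
Proof. exact: foldr_cat. Qed.

Lemma rnorm_cat u w : w != [::] -> rnorm (u ++ w) = rad u (rnorm w).
Proof.
move=> w0; elim: u => //= x u IH.
by rewrite -IH; case: u w0 {IH} => //=; case: w.
Qed.

Lemma rad_B p w z : B p z -> B (wdeg deg w + p) (rad w z).
Proof.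
move=> Bz; elim: w => [|x w IH] /=; first by rewrite wdeg_nil add0r.
by rewrite wdeg_cons -addrA; apply: (gl_br gB).
Qed.

Lemma rnorm_B w : B (wdeg deg w) (rnorm w).
Proof.
elim: w => [|x w IH] /=; first exact: B0.
rewrite wdeg_cons; case: w IH => [|y w] IH; last exact: (gl_br gB).
by rewrite wdeg_nil addr0.
Qed.

Lemma rad0 u : rad u 0 = 0.
Proof. by elim: u => //= x u ->; apply: (cr0 (Bphi x)). Qed.

Lemma rad_sum p u (I : eqType) (r : seq I) (k : I -> rat) (F : I -> W) :
  (forall i, k i != 0 -> B p (F i)) ->
  rad u (\sum_(i <- r) k i *: F i) = \sum_(i <- r) k i *: rad u (F i).
Proof.
move=> BF; elim: r => [|i r IH]; first by rewrite !big_nil rad0.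
rewrite !big_cons -IH {IH}; have := Bsum r BF.
move: (\sum_(j <- r) _) => s Bs.
have Bi : B p (k i *: F i).
  by have [->|/BF/BZ//] := eqVneq (k i) 0; rewrite scale0r.
elim: u => //= x u ->.
have Ri : B (wdeg deg u + p) (k i *: rad u (F i)).
  have [->|/BF Bf] := eqVneq (k i) 0; first by rewrite scale0r.
  by apply/BZ/rad_B.
rewrite (crD (Bphi x) Ri (rad_B u Bs)); congr (_ + _).
have [->|/BF Bf] := eqVneq (k i) 0; first by rewrite !scale0r (cr0 (Bphi x)).
by rewrite (crZ _ (Bphi x) (rad_B u Bf)).
Qed.

Lemma dynkin_short N f : short N f ->
  dynkin f = lsum N f (fun w => (size w)%:R^-1 *: rnorm w).
Proof. exact: fsum_short. Qed.

Lemma dynkin_lin N (k : rat) f g : short N f -> short N g ->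
  dynkin (k *: f + g) = k *: dynkin f + dynkin g.
Proof.
move=> sf sg; rewrite !(dynkin_short (N := N)) ?lsum_lin //.
exact: short_lin.
Qed.

Lemma dynkin_gen x : dynkin (gen x) = phi x.
Proof.
have sx : short 2 (gen x).
  by move=> w; rewrite /gen; case: eqP => // ->.
rewrite (dynkin_short sx) lsumS gen_nil scale0r add0r (bigD1 x) //= big1.
  rewrite addr0 lquo_gen eqxx lsumS big1 ?addr0.
    rewrite [X in X *: _](_ : _ = 1) // [X in X^-1](_ : _ = 1) //.
    by rewrite invr1 !scale1r.
  by move=> y _; rewrite /lsum /= big_nil.
move=> y /negPf yx; rewrite lquo_gen yx /lsum big1 // => w _.
by rewrite scale0r.
Qed.

(** Evaluated at the operators [ad (phi x)], the polynomial [f] becomes [ad] of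
    its value: this is the clause that makes Dynkin's induction work. *)
Definition dynkin_spec m l f :=
  B m (dynkin f) /\
  forall p z, B p z -> lsum l.+1 f (fun w => rad w z) = c (dynkin f) z.

Lemma lsum_rnorm m l f : lie_hom deg [set: G] m l f ->
  lsum l.+1 f rnorm = l%:R *: dynkin f.
Proof.
move=> hf; rewrite (dynkin_short (lie_hom_short hf)) -lsumZ.
apply: eq_lsum => w /(lie_hom_size hf) wl; rewrite wl scalerA.
case: l hf wl => [|l] _ wl; last by rewrite divff ?scale1r // pnatr_eq0.
by rewrite mul0r scale0r; case: w wl.
Qed.

Lemma dynkin0 : dynkin 0 = 0.
Proof. by rewrite (@dynkin_short 0) // /lsum big_nil. Qed.

Lemma lsum_br m n k l f g (F : seq G -> W) :
  lie_hom deg [set: G] m k f -> lie_hom deg [set: G] n l g ->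
  lsum (k + l).+1 (br deg f g) F =
    lsum k.+1 f (fun u => lsum l.+1 g (fun v => F (u ++ v)))
    - sgn (m * n) *: lsum l.+1 g (fun u => lsum k.+1 f (fun v => F (u ++ v))).
Proof.
move=> hf hg; have [sf sg] := (lie_hom_short hf, lie_hom_short hg).
have sfg : short (k + l).+1 (br deg f g) by apply: lie_hom_short (lh_br hf hg).
rewrite -(lsum_widen _ sfg (leqnSn _)).
rewrite (brE (lie_hom_homog hf) (lie_hom_homog hg)) addrC -scaleNr lsum_lin.
rewrite (lsum_mul _ sf sg) ?addSn ?addnS // (lsum_mul _ sg sf) ?addSn ?addnS.
  by rewrite addrC scaleNr.
by rewrite addnC.
Qed.

Lemma lsum_rad2 m n k l f g p z :
  lie_hom deg [set: G] m k f -> lie_hom deg [set: G] n l g ->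
  B n (dynkin g) ->
  (forall p z, B p z -> lsum k.+1 f (fun w => rad w z) = c (dynkin f) z) ->
  (forall p z, B p z -> lsum l.+1 g (fun w => rad w z) = c (dynkin g) z) ->
  B p z ->
  lsum k.+1 f (fun u => lsum l.+1 g (fun v => rad (u ++ v) z)) =
  c (dynkin f) (c (dynkin g) z).
Proof.
move=> hf hg Bg Tf Tg Bz; rewrite -(Tf _ _ (gl_br gB Bg Bz)) -(Tg _ _ Bz).
apply: eq_lsum => u _; rewrite /lsum (rad_sum (p := n + p)).
  by apply: eq_bigr => v _; rewrite rad_cat.
by move=> v /(lie_hom_homog hg) <-; apply: rad_B.
Qed.

Lemma lsum_rnorm2 m n k l f g :
  lie_hom deg [set: G] m k f -> lie_hom deg [set: G] n l g ->
  B n (dynkin g) ->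
  (forall p z, B p z -> lsum k.+1 f (fun w => rad w z) = c (dynkin f) z) ->
  lsum k.+1 f (fun u => lsum l.+1 g (fun v => rnorm (u ++ v))) =
  c (dynkin f) (l%:R *: dynkin g).
Proof.
move=> hf hg Bg Tf; rewrite -(Tf _ _ (BZ _ Bg)) -(lsum_rnorm hg).
apply: eq_lsum => u _; rewrite /lsum (rad_sum (p := n)).
  apply: eq_bigr => v _; have [g0|gv] := eqVneq (g v) 0; first by rewrite g0 !scale0r.
  rewrite rnorm_cat //; apply: contra_neq gv => ->.
  exact: hlie_nil (lie_hom_hlie hg).
by move=> v /(lie_hom_homog hg) <-; apply: rnorm_B.
Qed.

(** On the products [f g] and [g f] the right-normed brackets give
    [[f, l g]] and [[g, k f]], whence [k + l] times the bracket. *)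
Lemma dynkin_br_aux m n k l f g :
  lie_hom deg [set: G] m k f -> lie_hom deg [set: G] n l g ->
  B m (dynkin f) ->
  (forall p z, B p z -> lsum k.+1 f (fun w => rad w z) = c (dynkin f) z) ->
  B n (dynkin g) ->
  (forall p z, B p z -> lsum l.+1 g (fun w => rad w z) = c (dynkin g) z) ->
  dynkin (br deg f g) = c (dynkin f) (dynkin g).
Proof.
move=> hf hg Bf Tf Bg Tg; have := lsum_rnorm (lh_br hf hg).
rewrite (lsum_br _ hf hg) (lsum_rnorm2 hf hg Bg Tf) (lsum_rnorm2 hg hf Bf Tg).
rewrite (crZ _ Bf Bg) (crZ _ Bg Bf) (gl_anti gB Bf Bg) !scalerN opprK.
rewrite !scalerA mulrAC sgn_sq mul1r -scalerDl -natrD addnC.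
case: (posnP (k + l)) => [|kl]; last first.
  by move/scalerI => -> //; rewrite pnatr_eq0 -lt0n.
move/eqP; rewrite addn_eq0 => /andP[/eqP k0 _] _.
have -> : f = 0.
  apply/funext => w; have := lie_hom_short hf; rewrite k0 => sf.
  by case: w => [|x w]; [exact: hlie_nil (lie_hom_hlie hf)|exact: sf].
by rewrite (lin0 (br_linl deg g)) dynkin0 (cl0 Bg).
Qed.

Lemma dynkinP m l f : lie_hom deg [set: G] m l f -> dynkin_spec m l f.
Proof.
elim=> {m l f} [x _|m l|m l f g hf [Bf Tf] hg [Bg Tg]|m l k f hf [Bf Tf]|].
- split; first by rewrite dynkin_gen.
  move=> p z Bz; rewrite dynkin_gen lsumS gen_nil scale0r add0r (bigD1 x) //=.
  rewrite lquo_gen eqxx lsumS big1 => [|y _]; last by rewrite /lsum /= big_nil.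
  rewrite addr0 scale1r big1 ?addr0 // => y /negPf yx.
  by rewrite lquo_gen yx /lsum big1 // => w _; rewrite scale0r.
- split=> [|p z Bz]; rewrite dynkin0 // (cl0 Bz) /lsum big1 // => w _.
  by rewrite scale0r.
- have [sf sg] := (lie_hom_short hf, lie_hom_short hg).
  have := dynkin_lin 1 sf sg; rewrite !scale1r /dynkin_spec => ->.
  split=> [|p z Bz]; first exact: BD.
  rewrite (clD Bf Bg Bz) -(Tf _ _ Bz) -(Tg _ _ Bz).
  by rewrite -[f in LHS]scale1r lsum_lin scale1r.
- have sf := lie_hom_short hf.
  have dz : dynkin (k *: f) = k *: dynkin f.
    rewrite !(dynkin_short (N := l.+1)) //; last first.
      by move=> w lw; rewrite scalesE sf ?mulr0.
    by rewrite -[k *: f]addr0 lsum_lin [lsum _ 0 _]big1 ?addr0 // => w _; rewrite scale0r.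
  split=> [|p z Bz]; rewrite dz; first exact: BZ.
  rewrite (clZ k Bf Bz) -(Tf _ _ Bz) -[k *: f]addr0 lsum_lin.
  by rewrite [lsum _ 0 _]big1 ?addr0 // => w _; rewrite scale0r.
move=> m n k l f g hf [Bf Tf] hg [Bg Tg]; rewrite /dynkin_spec.
rewrite (dynkin_br_aux hf hg Bf Tf Bg Tg); split=> [|p z Bz].
  exact: (gl_br gB).
rewrite (gl_jacobi gB Bf Bg Bz) (lsum_br _ hf hg).
by rewrite (lsum_rad2 hf hg Bg Tf Tg Bz) (lsum_rad2 hg hf Bf Tg Tf Bz).
Qed.

Lemma dynkin_br m n k l f g :
  lie_hom deg [set: G] m k f -> lie_hom deg [set: G] n l g ->
  dynkin (br deg f g) = c (dynkin f) (dynkin g).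
Proof.
move=> hf hg; have [[Bf Tf] [Bg Tg]] := (dynkinP hf, dynkinP hg).
exact: (dynkin_br_aux hf hg Bf Tf Bg Tg).
Qed.

Lemma dynkin_sum N (I : Type) (r : seq I) (P : pred I) (F : I -> ser G) :
  (forall i, P i -> short N (F i)) ->
  dynkin (\sum_(i <- r | P i) F i) = \sum_(i <- r | P i) dynkin (F i).
Proof.
move=> sF; suff [_ ->] : short N (\sum_(i <- r | P i) F i) /\
  dynkin (\sum_(i <- r | P i) F i) = \sum_(i <- r | P i) dynkin (F i) by [].
elim/big_rec2: _ => [|i y f Pi [sf <-]].
  by split=> //; rewrite dynkin0.
have := dynkin_lin 1 (sF i Pi) sf; rewrite !scale1r => ->; split=> //.
by rewrite -[F i]scale1r; apply: short_lin => //; apply: sF.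
Qed.

Lemma dynkin_morphism : lie_morphism (pfree deg) (br deg) B c dynkin.
Proof.
split=> [m f hf|m k f g hf hg|m n f g hf hg].
- have [N sf] := lie_poly_short hf.2; rewrite (short_hpart sf).
  rewrite (dynkin_sum (N := N)) => [|j _]; last first.
    by move=> w Nw; rewrite /hpart sf // if_same.
  elim/big_ind: _ => [||j _]; [exact: B0|exact: BD|].
  exact: (dynkinP (pfree_hpart j hf)).1.
- have [[N sf] [M sg]] := (lie_poly_short hf.2, lie_poly_short hg.2).
  apply: (@dynkin_lin (maxn N M)).
    exact: short_le (leq_maxl _ _) sf.
  exact: short_le (leq_maxr _ _) sg.
- have [[N sf] [M sg]] := (lie_poly_short hf.2, lie_poly_short hg.2).
  have hp K h j : short K h -> short K (hpart j h).
    by move=> sh w Kw; rewrite /hpart sh // if_same.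
  have Bf i : B m (dynkin (hpart i f)) by apply: (dynkinP (pfree_hpart i hf)).1.
  have Bg i : B n (dynkin (hpart i g)) by apply: (dynkinP (pfree_hpart i hg)).1.
  have sbr (i : 'I_N) (j : 'I_M) :
      short (N + M).+1 (br deg (hpart i f) (hpart j g)).
    apply: short_le (lie_hom_short (lh_br (pfree_hpart i hf) (pfree_hpart j hg))).
    by rewrite ltnS leq_add // ltnW.
  have sbr1 (i : 'I_N) :
      short (N + M).+1 (\sum_(j < M) br deg (hpart i f) (hpart j g)).
    by move=> w ww; rewrite sum_sE big1 // => j _; apply: sbr.
  have df : dynkin f = \sum_(i < N) dynkin (hpart i f).
    rewrite {1}(short_hpart sf) (dynkin_sum (N := N)) // => j _; exact: hp.
  have dg : dynkin g = \sum_(j < M) dynkin (hpart j g).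
    rewrite {1}(short_hpart sg) (dynkin_sum (N := M)) // => j _; exact: hp.
  have -> : br deg f g =
      \sum_(i < N) \sum_(j < M) br deg (hpart i f) (hpart j g).
    rewrite {1}(short_hpart sf) {1}(short_hpart sg) (lin_sum (br_linl deg _)).
    by under eq_bigr do rewrite (lin_sum (br_linr deg _)).
  rewrite (dynkin_sum (N := (N + M).+1)) => [|i _]; last exact: sbr1.
  have csl : c (\sum_(i < N) dynkin (hpart i f)) (\sum_(i < M) dynkin (hpart i g))
    = \sum_(i < N) c (dynkin (hpart i f)) (\sum_(j < M) dynkin (hpart j g)).
    have Bs : B n (\sum_(j < M) dynkin (hpart j g)).
      by elim/big_ind: _ => [||j _]; [exact: B0|exact: BD|exact: Bg].
    move: (\sum_(j < M) _) Bs => y By.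
    suff [_ ->] : B m (\sum_(i < N) dynkin (hpart i f)) /\
      c (\sum_(i < N) dynkin (hpart i f)) y = \sum_(i < N) c (dynkin (hpart i f)) y.
      by [].
    elim/big_rec2: _ => [|i a b _ [Bb <-]]; first by rewrite (cl0 By).
    by rewrite (clD (Bf i) Bb By); split=> //; apply: BD.
  rewrite df dg csl; apply: eq_bigr => i _.
  rewrite (dynkin_sum (N := (N + M).+1)) => [|j _]; last exact: sbr.
  suff [_ ->] : B n (\sum_(j < M) dynkin (hpart j g)) /\
      c (dynkin (hpart i f)) (\sum_(j < M) dynkin (hpart j g)) =
      \sum_(j < M) c (dynkin (hpart i f)) (dynkin (hpart j g)).
    by apply: eq_bigr => j _; apply: dynkin_br (pfree_hpart i hf) (pfree_hpart j hg).
  elim/big_rec2: _ => [|j a b _ [Bb <-]]; first by rewrite (cr0 (Bf i)).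
  by rewrite (crD (Bf i) (Bg j) Bb); split=> //; apply: BD.
Qed.

End Dynkin.

Lemma freely_generated_pfree (G : finType) (deg : G -> int) :
  freely_generated deg.
Proof.
split=> [|W B c gB phi Bphi]; first exact: graded_lie_pfree.
exists (dynkin c phi); split=> [|x|psi' mpsi' gpsi' m f hf].
- exact: dynkin_morphism.
- exact: dynkin_gen.
have mpsi := dynkin_morphism gB Bphi.
have zpsi (psi : ser G -> W) :
    lie_morphism (pfree deg) (br deg) B c psi -> psi 0 = 0.
  move=> mp; have p0 : pfree deg 0 0 by split; [exact: homog0|exact: lp_zero].
  have := lm_lin mp 1 p0 p0; rewrite scaler0 addr0 scale1r => z.
  by apply: (addrI (psi 0)); rewrite -z addr0.
have agree n l g : lie_hom deg [set: G] n l g -> psi' g = dynkin c phi g.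
  elim=> {n l g} [x _|n l|n l g h hg IHg hh IHh|n l k g hg IHg|n n' k l g h hg IHg hh IHh].
  - by rewrite gpsi' dynkin_gen.
  - by rewrite (zpsi _ mpsi') (zpsi _ mpsi).
  - have [pg ph] := (lie_hom_pfree hg, lie_hom_pfree hh).
    have := (lm_lin mpsi 1 pg ph, lm_lin mpsi' 1 pg ph).
    by rewrite !scale1r IHg IHh => -[-> ->].
  - have [pg p0] := (lie_hom_pfree hg, lie_hom_pfree (lh_zero deg [set: G] n l)).
    have := (lm_lin mpsi k pg p0, lm_lin mpsi' k pg p0).
    by rewrite !addr0 IHg (zpsi _ mpsi') (zpsi _ mpsi) !addr0 => -[-> ->].
  - have [pg ph] := (lie_hom_pfree hg, lie_hom_pfree hh).
    by rewrite (lm_br mpsi pg ph) (lm_br mpsi' pg ph) IHg IHh.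
have [N sf] := lie_poly_short hf.2; rewrite (short_hpart sf).
suff [_ ->] : pfree deg m (\sum_(k < N) hpart k f) /\
    psi' (\sum_(k < N) hpart k f) = dynkin c phi (\sum_(k < N) hpart k f) by [].
elim/big_ind: _ => [|g h [pg eg] [ph eh]|k _].
- split; last by rewrite (zpsi _ mpsi') (zpsi _ mpsi).
  by split; [exact: homog0|exact: lp_zero].
- split; last first.
    have := (lm_lin mpsi 1 pg ph, lm_lin mpsi' 1 pg ph).
    by rewrite !scale1r eg eh => -[-> ->].
  by split; [apply: homogD pg.1 ph.1|apply: lp_add pg.2 ph.2].
- have hk := pfree_hpart k hf.
  by split; [exact: lie_hom_pfree hk|exact: agree hk].
Qed.

(** * The Baker-Campbell-Hausdorff series *)

Definition letters (G : finType) (x y : ser G) (l : bool) : ser G :=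
  if l then y else x.

Section BCH.
Variables (Q : ser bool) (hQ : bch_remainder Q).
Variables (G : finType) (deg : G -> int).
Implicit Types (x y : ser G) (S : set G).

(** Substituting in the defining property of [Q].  As its right-hand side is
    made of brackets, this shows in particular that BCH is a Lie series. *)
Lemma bch_opeval x y : homog deg 0 x -> homog deg 0 y ->
  x [::] = 0 -> y [::] = 0 ->
  bch x y = x + y + opeval (fun l => br deg (letters x y l)) Q y.
Proof.
move=> hx hy x0 y0; have z0 l : letters x y l [::] = 0 by case: l.
have hz l : homog deg 0 (letters x y l) by case: l.
have := congr1 (seval (letters x y)) (q_bch hQ).
rewrite (seval_bch z0) ?gen_nil // !(seval_gen z0) => ->.
rewrite !(linD (linear_seval z0)) !(seval_gen z0); congr (_ + _).
rewrite (opeval_intertwine (T' := fun l => br deg (letters x y l))).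
- by rewrite (seval_gen z0).
- by move=> l; apply: contr_br; [exact: homog_deg0|exact: gen_nil].
- by move=> l; apply: contr_br.
- exact: linear_seval.
- move=> l g; rewrite !br0E //; last exact: homog_deg0.
  by rewrite (linB (linear_seval z0)) !(sevalM z0) !(seval_gen z0).
Qed.

Lemma hlie_bch S x y : hlie deg 0 S x -> hlie deg 0 S y ->
  hlie deg 0 S (bch x y).
Proof.
move=> hx hy.
rewrite (bch_opeval hx.1 hy.1 (hlie_nil hx) (hlie_nil hy)).
apply: hlieD; first exact: hlieD.
have hz l : hlie deg 0 S (letters x y l) by case: l.
apply: hlie_opeval => // [l|l g]; first exact: hlie_contr (hz l).
exact: hlie_br0.
Qed.

Lemma hlie_mu2 S x y : hlie deg 0 S x -> hlie deg 0 S y ->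
  hlie deg 0 S (mu2 x y).
Proof.
move=> hx hy; apply: hlie_bch => //; apply: hlieZ; apply: hlie_bch => //.
exact: hlieN.
Qed.

Lemma bch_eqm2 x y : homog deg 0 x -> homog deg 0 y ->
  x [::] = 0 -> y [::] = 0 -> eqm 2 (bch x y) (x + y).
Proof.
move=> hx hy x0 y0; have z0 l : letters x y l [::] = 0 by case: l.
have hz l : homog deg 0 (letters x y l) by case: l.
rewrite (bch_opeval hx hy x0 y0) -[X in eqm _ _ X]addr0; apply: eqmD => //.
have cz l : contraction (br deg (letters x y l)) by apply: contr_br.
rewrite opeval_rec // (q_const hQ) scale0r add0r; apply: eqm0_sum => l _.
by apply: contr_len => //; apply/eqm1; rewrite opeval_nil // y0 mulr0.
Qed.

End BCH.

(** By the Jacobi identity [ad] is a morphism from series of degree 0 to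
    operators, hence commutes with the evaluation of Lie polynomials; both sides
    are continuous in [p]. *)
Lemma opeval_ad (I G : finType) (deg : G -> int) (x : I -> ser G) p f :
  (forall i, homog deg 0 (x i)) -> (forall i, x i [::] = 0) ->
  lie_gen (@deg0 I) [set: I] p ->
  opeval (fun i => br deg (x i)) p f = br deg (seval x p) f.
Proof.
move=> hx x0 lp; have cx i : contraction (br deg (x i)) by apply: contr_br.
have hs q : homog deg 0 (seval x q) by apply: homog_seval.
have H q : lie_poly (@deg0 I) [set: I] q -> forall g,
    opeval (fun i => br deg (x i)) q g = br deg (seval x q) g.
  elim=> {q} [i _||q r _ IHq _ IHr|c q _ IHq|q r _ IHq _ IHr] g.
  - by rewrite opeval_gen // seval_gen.
  - rewrite (lin0 (linear_opeval cx g)) (lin0 (linear_seval x0)).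
    by rewrite (lin0 (br_linl deg g)).
  - rewrite (linD (linear_opeval cx g)) (linD (linear_seval x0)) IHq IHr.
    by rewrite (linD (br_linl deg g)).
  - rewrite (linZ (linear_opeval cx g)) (linZ (linear_seval x0)) IHq.
    by rewrite (linZ (br_linl deg g)).
  rewrite br0E; last exact: homog_deg0.
  rewrite (linB (linear_opeval cx g)) !opeval_mul // !IHq !IHr.
  rewrite (linB (linear_seval x0)) !sevalM //.
  rewrite (linB (br_linl deg g)) !br0E //; try exact: homogMl.
  rewrite !(mulrBl, mulrBr, opprB, addrA, mulrA).
  by rewrite [LHS](ACl (1*6*3*8*(2*5)*(4*7)))%AC /= !addNr !addr0.
apply: eqmP => k; have ep := hpart_eqm (N := k) p.
apply: (eqm_trans (opeval_eqm cx f ep)).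
rewrite H => [|]; last first.
  by elim/big_ind: _ => [|a b|i _]; [exact: lp_zero|exact: lp_add|exact: lp].
rewrite !br0E //; have es := eqm_sym (seval_eqm x0 ep).
by rewrite -!mulrN; apply: eqmD; [exact: eqmM|apply: eqmM => // w /es; rewrite !oppsE => ->].
Qed.

Section BCHOperator.
Variables (Q : ser bool) (hQ : bch_remainder Q).
Variables (G : finType) (deg : G -> int) (x y : ser G).
Hypotheses (hx : homog deg 0 x) (hy : homog deg 0 y).
Hypotheses (x0 : x [::] = 0) (y0 : y [::] = 0).

Let z0 l : letters x y l [::] = 0. Proof. by case: l. Qed.
Let hz l : homog deg 0 (letters x y l). Proof. by case: l. Qed.

(** The operator BCH of brackets is the bracket with BCH. *)
Lemma opeval_bch_ser f :
  opeval (two_ops (br deg x) (br deg y)) bch_ser f = br deg (bch x y) f.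
Proof.
have -> : two_ops (br deg x) (br deg y) = fun l => br deg (letters x y l).
  by apply/funext => -[].
rewrite opeval_ad //; last first.
  apply: (hlie_bch hQ (deg := @deg0 bool) _ _).2 => //;
    exact: (hlie_gen (@deg0 bool) (S := [set: bool])).
by rewrite /bch_ser (seval_bch z0) ?gen_nil // !(seval_gen z0).
Qed.

Lemma opeval_remainder :
  opeval (two_ops (br deg x) (br deg y)) Q y = bch x y - x - y.
Proof.
have -> : two_ops (br deg x) (br deg y) = fun l => br deg (letters x y l).
  by apply/funext => -[].
by rewrite (bch_opeval hQ hx hy x0 y0) -addrA -opprD addrAC subrr add0r.
Qed.

End BCHOperator.

Lemma slog_conj (G : finType) (p q g : ser G) : q * p = 1 -> p * q = 1 ->
  g [::] = 1 -> p * slog g * q = slog (p * g * q).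
Proof.
move=> qp pq g1.
have pgq1 : (p * g * q) [::] = 1.
  by rewrite !mul_nil g1 mulr1 -mul_nil pq.
rewrite !slogE //; set z := g - 1; set z' := _ - 1.
have z0 (i : unit) : z [::] = 0 by rewrite /z addsE oppsE g1 subrr.
have z0' (i : unit) : z' [::] = 0 by rewrite /z' addsE oppsE pgq1 subrr.
have zz : z' = p * z * q by rewrite /z' /z mulrBr mulrBl mulr1 pq.
rewrite [seval (fun=> z) plog]sevalE //.
rewrite (opeval_intertwine (M := fun f => p * f * q) (T' := fun=> smul z')).
- by rewrite mulr1 pq -sevalE.
- by move=> i; apply: contrM (z0 i).
- by move=> i; apply: contrM (z0' i).
- by move=> c f h; rewrite mulrDr mulrDl -scalerAr -scalerAl.
- by move=> i f; rewrite !mulsE zz !mulrA -[_ * q * p]mulrA qp mulr1.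
Qed.

(** * Derivations of the completed free Lie algebra *)

Lemma cderivation_odd (G : finType) (deg : G -> int) (D : ser G -> ser G) :
  odd_derivation deg D ->
  (forall x, hlie deg (deg x - 1) [set: G] (D (gen x))) -> cderivation deg D.
Proof.
move=> oD hD.
have dD m f : cfree deg m f -> cfree deg (m - 1) (D f).
  by apply: (od_hlie oD) => // x _; apply: hD.
split=> [|m k f _ f0 w wk]; last by rewrite (od_eqm0 oD (k := k)).
split=> [m f|m c f g _ _|m n f g hf hg]; first exact: dD.
  exact: (od_lin oD).
exact: (od_br oD hf.1 hg.1 (dD _ _ hf).1 (dD _ _ hg).1).
Qed.

(** They agree on Lie polynomials by the Leibniz rule and on the remainders by
    the filtration condition. *)
Lemma cderivation_eq (G : finType) (deg : G -> int) (S : set G)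
    (d d' : ser G -> ser G) m f :
  cderivation deg d -> cderivation deg d' ->
  (forall x, S x -> d (gen x) = d' (gen x)) -> hlie deg m S f -> d f = d' f.
Proof.
move=> cd cd' dS hf.
have inT n g : hlie deg n S g -> cfree deg n g by apply: hlie_sub.
have zd (e : ser G -> ser G) : cderivation deg e -> e (0 : ser G) = 0.
  move=> [ce _]; have z := hlie0 deg 0 [set: G].
  have := der_lin ce 1 z z; rewrite scaler0 addr0 scale1r => ee.
  by apply: (addrI (e 0)); rewrite -ee addr0.
have agree n l g : lie_hom deg S n l g -> d g = d' g.
  elim=> {n l g}
    [x /dS //|n l|n l g h hg IHg hh IHh|n l c g hg IHg|n n' k l g h hg IHg hh IHh].
  - by rewrite (zd d) // (zd d').
  - have [pg ph] := (inT _ _ (lie_hom_hlie hg), inT _ _ (lie_hom_hlie hh)).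
    have := (der_lin (cder_der cd) 1 pg ph, der_lin (cder_der cd') 1 pg ph).
    by rewrite !scale1r IHg IHh => -[-> ->].
  - have [pg z] := (inT _ _ (lie_hom_hlie hg), hlie0 deg n [set: G]).
    have := (der_lin (cder_der cd) c pg z, der_lin (cder_der cd') c pg z).
    by rewrite !addr0 IHg (zd d) // (zd d') // !addr0 => -[-> ->].
  - have [pg ph] := (inT _ _ (lie_hom_hlie hg), inT _ _ (lie_hom_hlie hh)).
    rewrite (der_leibniz (cder_der cd) pg ph) (der_leibniz (cder_der cd') pg ph).
    by rewrite IHg IHh.
apply: eqmP => k; pose g := \sum_(l < k) hpart l f.
have [hg eg] : hlie deg m S g /\ d g = d' g.
  rewrite /g; elim/big_ind: _ => [|a b [ha ea] [hb eb]|l _].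
  - by split; [exact: hlie0|rewrite (zd d) // (zd d')].
  - split; first exact: hlieD.
    have := (der_lin (cder_der cd) 1 (inT _ _ ha) (inT _ _ hb),
             der_lin (cder_der cd') 1 (inT _ _ ha) (inT _ _ hb)).
    by rewrite !scale1r ea eb => -[-> ->].
  - have hl := hlie_hpart l hf.
    by split; [exact: lie_hom_hlie hl|exact: agree hl].
have tail (e : ser G -> ser G) : cderivation deg e -> eqm k (e f) (e g).
  move=> ce w wk; have hfg : cfree deg m (f - g).
    by apply: hlieD (inT _ _ hf) _; apply: hlieN; apply: inT.
  have := der_lin (cder_der ce) 1 hfg (inT _ _ hg).
  rewrite !scale1r subrK => ->; rewrite addsE (cder_filt ce hfg (k := k)) ?add0r //.
  by move=> {}w {}wk; apply: (eqm_subr k f g).2 => //; apply: hpart_eqm.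
by apply: eqm_trans (tail d cd) _; rewrite eg; apply/eqm_sym/tail.
Qed.

Section OddDerivationMore.
Variables (G : finType) (deg : G -> int) (D : ser G -> ser G).
Hypothesis oD : odd_derivation deg D.
Implicit Types (f g p q s t e a b : ser G).

Let lD := od_lin oD.

(** The Todd series are chosen so that [exp e] transforms [a] into [b]. *)
Lemma flow_todd e a b : homog deg 0 e -> e [::] = 0 ->
  D e = adser deg todd_neg e a + adser deg todd_pos e b -> flow deg D e a = b.
Proof.
move=> he e0 De; have ce (i : unit) : contraction (br deg e) by apply: contr_br.
have -> : flow deg D e a = opeval (fun=> br deg e) (pexp (-1)) a +
    adser deg flow_coef e (D e).
  congr (_ + _); rewrite -(opser_pw (fun m => (-1) ^+ m / m`!%:R) a (ce tt)).
  congr ssum; apply/funext => m; rewrite iter_brN scalerA; congr (_ *: _).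
  exact: mulrC.
rewrite De !adserE // (linD (opeval_linear ce _)) -!opeval_mul //.
rewrite [pw flow_coef * _]mulsC [X in _ + (_ + opeval _ X _)]mulsC.
rewrite todd_posM todd_negM (linN (linear_opeval ce a)) opeval1 //.
by rewrite addrA subrr add0r.
Qed.

Lemma gauge_sq p a b : homog deg 0 p -> homog deg (-1) a ->
  D a = - (a * a) -> D b = - (b * b) -> gauge D p a b -> D (D p) = 0.
Proof.
move=> hp ha Da Db gp; rewrite {1}gp (linB lD) (od_even oD _ hp).
rewrite (od_oddM oD _ ha) Da Db gp.
rewrite !(mulrBl, mulrBr, mulNr, mulrN, opprB, opprD, opprK, addrA, mulrA).
rewrite [LHS](ACl ((1*3)*(2*4)*(5*6)))%AC /=.
by rewrite subrr !addNr !addr0.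
Qed.

Lemma od_sq_slog g : homog deg 0 g -> g [::] = 1 -> homog deg (-1) (D g) ->
  D (D g) = 0 -> D (D (slog g)) = 0.
Proof.
move=> hg g1 hDg DDg; rewrite slogE //; apply: (od_sq_seval oD) => _.
- by rewrite addsE oppsE g1 subrr.
- by apply: homogD => //; apply: homogN; apply: homog1.
- by rewrite (linB lD) (od1 oD) subr0.
- by rewrite (linB lD) (od1 oD) subr0.
Qed.

Lemma od_sq_sexp e : homog deg 0 e -> e [::] = 0 -> homog deg (-1) (D e) ->
  D (D e) = 0 -> D (D (sexp e)) = 0.
Proof. by move=> he e0 hDe DDe; rewrite sexpE //; apply: (od_sq_seval oD). Qed.

(** To commute with [D], a substitution only has to do so on generators; the
    more general family [x] is useful before [D] is known on all of them. *)
Lemma od_seval_comm (I : finType) (degI : I -> int) (x : I -> ser G)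
    (s : G -> ser G) (p : ser I) :
  (forall c, s c [::] = 0) -> (forall c, homog deg (deg c) (s c)) ->
  (forall i, x i [::] = 0) -> (forall i, homog deg (degI i) (x i)) ->
  (forall i, D (seval s (x i)) = seval s (D (x i))) ->
  D (seval s (seval x p)) = seval s (D (seval x p)).
Proof.
move=> s0 hs x0 hx Dx.
pose M (r : ser I) := D (seval s (seval x r)) - seval s (D (seval x r)).
suff /eqP : M p = 0 by rewrite subr_eq0 => /eqP.
have sx0 i : seval s (x i) [::] = 0 by rewrite seval_nil.
apply: (@lin_eq0 _ _ M (fun i f => sgn (degI i) *: smul (seval s (x i)) f)).
- by move=> i; apply/contrZ/contrM.
- move=> c f g; rewrite /M (linear_seval x0) !(linear_seval s0) !lD.
  by rewrite (linear_seval s0) scalerBr opprD addrACA.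
- by rewrite /M (seval1 x0) (seval1 s0) (od1 oD) (lin0 (linear_seval s0)) subrr.
- move=> i f; rewrite /M (sevalM x0) (seval_gen x0) (sevalM s0) !(od_mul oD).
  rewrite (linD (linear_seval s0)) !(sevalM s0) Dx opprD addrACA subrr add0r.
  rewrite (seval_parity _ s0 hs) (parity_homog (hx i)) (linZ (linear_seval s0)).
  by rewrite -!scalerAl -scalerBr -mulrBr.
Qed.

End OddDerivationMore.

(** * Linear parts *)

(** Linear parts are computed modulo words of length 2, where brackets vanish
    and power series of operators reduce to their constant terms. *)

Section LinearPart.
Variables (G : finType) (deg : G -> int).
Implicit Types (e f g : ser G).

Lemma hpart1_eqm f g : eqm 2 f g -> hpart 1 f = hpart 1 g.
Proof.
move=> fg; apply/funext => w; rewrite /hpart; case: eqP => // w1.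
by rewrite fg ?w1.
Qed.

Lemma hpart1_gen (x : G) : hpart 1 (gen x) = gen x.
Proof.
apply/funext => w; rewrite /hpart /gen; case: ifPn => // w1.
by have [wx|//] := eqVneq w [:: x]; rewrite wx in w1.
Qed.

Lemma opeval_eqm2 (I : finType) (T : I -> ser G -> ser G) p f :
  (forall i, contraction (T i)) -> f [::] = 0 ->
  eqm 2 (opeval T p f) (p [::] *: f).
Proof.
move=> cT f0; rewrite opeval_rec // -[X in eqm _ _ X]addr0; apply: eqmD => //.
apply: eqm0_sum => i _; apply: contr_len => //; apply/eqm1.
by rewrite opeval_nil // f0 mulr0.
Qed.

Lemma adser_eqm2 c e f : homog deg 0 e -> e [::] = 0 -> f [::] = 0 ->
  eqm 2 (adser deg c e f) (c 0%N *: f).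
Proof.
move=> he e0 f0; rewrite adserE //; apply: opeval_eqm2 => // _.
exact: contr_br.
Qed.

Lemma expad_eqm2 e f : homog deg 0 e -> e [::] = 0 -> f [::] = 0 ->
  eqm 2 (expad deg e f) f.
Proof.
move=> he e0 f0; apply: (eqm_trans (adser_eqm2 _ he e0 f0)).
by rewrite invr1 scale1r.
Qed.

Lemma br_eqm2 m n f g : homog deg m f -> homog deg n g ->
  f [::] = 0 -> g [::] = 0 -> eqm 2 (br deg f g) 0.
Proof.
move=> hf hg f0 g0; rewrite (brE hf hg) -scaleNr.
have [ef eg] : eqm 1 f 0 /\ eqm 1 g 0 by split; apply/eqm1.
rewrite -[X in eqm _ _ X]addr0; apply: eqmD; first exact: (eqm0M ef eg).
rewrite -[X in eqm _ _ X](scaler0 _ (- sgn (m * n))); apply: eqmZ.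
exact: (eqm0M eg ef).
Qed.

End LinearPart.

Lemma todd_neg0 : todd_neg 0 = -1.
Proof. by rewrite /todd_neg /psinv /= big_ord0 subr0 invr1 divrN divr1. Qed.

Lemma todd_pos0 : todd_pos 0 = 1.
Proof. by rewrite /todd_pos /psinv /= big_ord0 subr0 expr0 !divr1. Qed.

(** * The banana *)

Lemma ordS_rev (n : nat) (i : 'I_n) : ordS (rev_ord (ordS i)) = rev_ord i.
Proof.
apply: val_inj => /=; have := ltn_ord i; rewrite leq_eqVlt => /orP[/eqP iN|iN].
  by rewrite iN modnn subn1 prednK ?modnn ?subnn // (leq_ltn_trans _ (ltn_ord i)).
rewrite (modn_small iN) -subSn // subSS modn_small //.
by rewrite ltn_subrL /= (leq_ltn_trans _ iN).
Qed.

Lemma ordS_neq (n : nat) (i : 'I_n) : (2 <= n)%N -> ordS i != i.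
Proof.
move=> n2; apply/eqP => /(congr1 val) /=.
have := ltn_ord i; rewrite leq_eqVlt => /orP[/eqP iN|iN].
  by rewrite iN modnn => i0; move: n2; rewrite -iN -i0.
by rewrite (modn_small iN) => /esym; apply/eqP; rewrite neq_ltn ltnSn.
Qed.

Section BananaSeries.
Variables (n : nat) (mu : ser 'I_n) (Q : ser bool).
Hypotheses (hmu : universal_average mu) (hQ : bch_remainder Q).
Implicit Types (i j k : 'I_n) (S : set (banana_cell n)) (f : bser n).
Local Notation deg := (@bdeg n).

Lemma hlie_ga S : S Va -> hlie deg (-1) S (ga n).
Proof. exact: (hlie_gen deg). Qed.

Lemma hlie_gb S : S Vb -> hlie deg (-1) S (gb n).
Proof. exact: (hlie_gen deg). Qed.

Lemma hlie_ge S i : S (Ve i) -> hlie deg 0 S (ge i).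
Proof. exact: (hlie_gen deg). Qed.

Lemma hlie_gf S i : S (Vf i) -> hlie deg 1 S (gf i).
Proof. exact: (hlie_gen deg). Qed.

Lemma hlie_gh S : S Vh -> hlie deg 2 S (gh n).
Proof. exact: (hlie_gen deg). Qed.

Lemma homog_ge i : homog deg 0 (ge i).
Proof. exact: (@hlie_ge [set: _] i I).1. Qed.

Lemma ge_nil i : ge i [::] = 0. Proof. exact: gen_nil. Qed.

Lemma hlie_vedge S i : S (Ve i) -> S (Ve (ordS i)) ->
  hlie deg 0 S (vedge i).
Proof. by move=> Si Si1; apply: (hlie_mu2 hQ); apply: hlie_ge. Qed.

Lemma hlie_vmean S : (forall i, S (Ve i)) -> hlie deg 0 S (vmean mu).
Proof. by move=> Se; apply: hlie_seval (ua_lie hmu) => i; apply: hlie_ge. Qed.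

(** The loop at [a] along edge [i] and back along edge [j]. *)
Definition loop i j : bser n := bch (ge i) (- ge j).

(** The holonomy around face [i], based at the centre of the face. *)
Definition hol i : bser n :=
  bchs [:: - ((1 / 2) *: vedge i); ge i; - ge (ordS i); (1 / 2) *: vedge i].

(** A correction term, with the operators BCH replaced by brackets with loops:
    for the face with edges [j] and [k], and the auxiliary edge [i]. *)
Definition rterm i j k f : bser n :=
  opeval (two_ops (bbr (loop i j)) (bbr (loop j k))) Q f.

(** The boundary of the 3-cell, transported to the vertex [a]. *)
Definition sphere : bser n :=
  \sum_(i < n) gf' i + (2 * n)%:R^-1 *:
    \sum_(i < n) \sum_(j < n | (j != i) && (j != ordS i))
      (rterm j i (ordS i) (gf' i) + rterm j (ordS i) i (gf' i)).

Lemma hlie_loop S i j : S (Ve i) -> S (Ve j) -> hlie deg 0 S (loop i j).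
Proof.
move=> Si Sj; apply: (hlie_bch hQ); first exact: hlie_ge.
by apply: hlieN; apply: hlie_ge.
Qed.

Lemma homog_loop i j : homog deg 0 (loop i j).
Proof. exact: (@hlie_loop [set: _] i j I I).1. Qed.

Lemma loop_nil i j : loop i j [::] = 0.
Proof. exact: (hlie_nil (@hlie_loop [set: _] i j I I)). Qed.

Lemma hlie_hol S i : S (Ve i) -> S (Ve (ordS i)) -> hlie deg 0 S (hol i).
Proof.
move=> Si Si1; have hv := hlieZ (1 / 2) (hlie_vedge Si Si1).
have [hi hi1] := (hlie_ge Si, hlieN (hlie_ge Si1)).
apply: (hlie_bch hQ); first exact: hlieN.
do 3?[apply: (hlie_bch hQ) => //].
exact: hlie0.
Qed.

Lemma bchE_loop i j f : bchE i j f = bbr (loop i j) f.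
Proof.
rewrite /bchE (_ : (fun g => - bbr (ge j) g) = bbr (- ge j)); last first.
  by apply/funext => g; rewrite /bbr (linN (br_linl deg g)).
have [hi hj] := (homog_ge (i := i), homogN (homog_ge (i := j))).
exact: (opeval_bch_ser hQ hi hj (ge_nil i) (opp_nil (ge_nil j))).
Qed.

Lemma bchE_rterm i j k f : opeval (two_ops (bchE i j) (bchE j k)) Q f =
  rterm i j k f.
Proof. by apply: eq_opeval => -[] g; rewrite /= bchE_loop. Qed.

Lemma contr_loop i j k l :
  contraction (two_ops (bbr (loop i j)) (bbr (loop j k)) l).
Proof. by case: l; (apply: contr_br; [exact: homog_loop|exact: loop_nil]). Qed.

Lemma hlie_rterm m S i j k f : (forall i, S (Ve i)) ->
  hlie deg m S f -> hlie deg m S (rterm i j k f).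
Proof.
move=> Se hf; apply: hlie_opeval hf => [l|[] g hg]; first exact: contr_loop.
  by apply: hlie_br0 hg; apply: hlie_loop.
by apply: hlie_br0 hg; apply: hlie_loop.
Qed.

Lemma hlie_gf' S i : S (Ve i) -> S (Ve (ordS i)) -> S (Vf i) ->
  hlie deg 1 S (gf' i).
Proof.
move=> Si Si1 Sf; apply: hlie_adser; last exact: hlie_gf.
by apply: hlieZ; apply: hlie_vedge.
Qed.

Lemma hlie_sphere S : (forall i, S (Ve i)) -> (forall i, S (Vf i)) ->
  hlie deg 1 S sphere.
Proof.
move=> Se Sf; have hf i : hlie deg 1 S (gf' i) by apply: hlie_gf'.
apply: hlieD; first by apply: hlie_sum.
apply/hlieZ/hlie_sum => i _; apply: hlie_sum => j _.
by apply: hlieD; apply: hlie_rterm.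
Qed.

Lemma loop_refl i : loop i i = 0.
Proof. by rewrite /loop bchN_self // ge_nil. Qed.

Lemma loop_opp i j : loop j i = - loop i j.
Proof.
by rewrite /loop -bchNN ?opp_nil ?ge_nil // opprK.
Qed.

Lemma bch_loop i j k : bch (loop i j) (loop j k) = loop i k.
Proof.
exact: (bch_cancel (ge_nil i) (ge_nil j) (ge_nil k)).
Qed.

(** By the defining property of [Q], the correction term of a face compares
    two ways of going from edge [i] to edge [k]. *)
Lemma rterm_loop i j k : rterm i j k (loop j k) = loop i k - loop i j - loop j k.
Proof.
have [hi hj] := (homog_loop (i := i) (j := j), homog_loop (i := j) (j := k)).
rewrite -(bch_loop i j k).
exact: (opeval_remainder hQ hi hj (loop_nil i j) (loop_nil j k)).
Qed.

Lemma rterm_linear i j k : linear (rterm i j k).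
Proof. by apply: opeval_linear => l; apply: contr_loop. Qed.

(** Both corrections for the pair [(i, j)] map the boundary loop of face [i]
    to the same series; it vanishes when [j] is an edge of that face, and its
    sum over [i] telescopes up to the boundary loops themselves. *)
Lemma rterm_pair i j k :
  rterm j i k (loop i k) + rterm j k i (loop i k) =
  2%:R *: (loop j k - loop j i - loop i k).
Proof.
rewrite rterm_loop [X in rterm j k i X]loop_opp (linN (rterm_linear j k i)).
rewrite rterm_loop (loop_opp i k) scaler_nat mulr2n; congr (_ + _).
by rewrite opprK opprD opprB.
Qed.

End BananaSeries.

Section BananaEdges.
Variables (n : nat) (mu : ser 'I_n) (Q : ser bool).
Hypotheses (hmu : universal_average mu) (hQ : bch_remainder Q).
Variable D : bser n -> bser n.
Local Notation deg := (@bdeg n).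
Hypothesis oD : odd_derivation deg D.
Hypothesis Da : D (ga n) = - ((1 / 2) *: bbr (ga n) (ga n)).
Hypothesis Db : D (gb n) = - ((1 / 2) *: bbr (gb n) (gb n)).
Hypothesis De : forall i, D (ge i) =
  adser deg todd_neg (ge i) (ga n) + adser deg todd_pos (ge i) (gb n).
Implicit Types (i j k : 'I_n) (S : set (banana_cell n)) (f v : bser n).

Let lD := od_lin oD.

Lemma homog_ga : homog deg (-1) (ga n).
Proof. exact: (@hlie_ga n [set: _] I).1. Qed.

Lemma homog_gb : homog deg (-1) (gb n).
Proof. exact: (@hlie_gb n [set: _] I).1. Qed.

Lemma point_a : D (ga n) = - (ga n * ga n).
Proof. by rewrite Da; congr (- _); apply: half_br_odd homog_ga. Qed.

Lemma point_b : D (gb n) = - (gb n * gb n).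
Proof. by rewrite Db; congr (- _); apply: half_br_odd homog_gb. Qed.

Lemma hlie_De S i : S Va -> S Vb -> S (Ve i) -> hlie deg (-1) S (D (ge i)).
Proof.
move=> Sa Sb Si; rewrite De; have hi := hlie_ge Si.
apply: hlieD; first exact: (hlie_adser _ hi (hlie_ga Sa)).
exact: (hlie_adser _ hi (hlie_gb Sb)).
Qed.

Lemma gauge_edge i : gauge D (sexp (ge i)) (ga n) (gb n).
Proof.
have := gauge_flow oD (ga n) (homog_ge (i := i)) (ge_nil i).
by rewrite (flow_todd (b := gb n) (homog_ge (i := i)) (ge_nil i) (De i)).
Qed.

(** [D (D (exp e)) = 0] because [exp e] joins two points; then take the
    logarithm. *)
Lemma dd_edge i : D (D (ge i)) = 0.
Proof.
have [hi i0] := (homog_ge (i := i), ge_nil i).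
have hg := homog_sexp hi i0; have gi := gauge_edge i.
rewrite -[ge i](sexpK i0); apply: (od_sq_slog oD) => //.
- exact: sexp_nil.
- rewrite gi; apply: homogD; first exact: homogMl homog_gb.
  by apply: homogN; apply: homogMr homog_ga hg.
- exact: (gauge_sq oD hg homog_ga point_a point_b gi).
Qed.

Lemma dpt_loop i j : dpt deg D (ga n) (loop i j) = 0.
Proof.
have [hi hj] := (homog_ge (i := i), homog_ge (i := j)).
have [i0 j0] := (ge_nil i, ge_nil j); have nj0 := opp_nil j0.
have [gi gj] := (homog_sexp hi i0, homog_sexp (homogN hj) nj0).
apply: (dpt_slog oD _ homog_ga (gen_nil _) (mul_sexp_nil i0 nj0)).
  exact: homogMl.
apply: (gaugeM oD gi (gauge_edge i)).
exact: (gaugeV oD gj (sexpNl j0) (sexpNr j0) (gauge_edge j)).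
Qed.

(** Both conditions are needed at once: the differential raises a series in the
    edges of [S] to one in the cells of [S]. *)
Definition edges_of S : set (banana_cell n) := fun c => S c /\ exists i, c = Ve i.

Section EdgePoint.
Variables (S : set (banana_cell n)) (v : bser n).
Hypotheses (Sa : S Va) (Sb : S Vb) (hv : hlie deg 0 (edges_of S) v).
Hypothesis DDv : D (D v) = 0.

Let w : bser n := (1 / 2) *: v.

Let hw : hlie deg 0 (edges_of S) w. Proof. exact: hlieZ. Qed.

Let hDw : hlie deg (-1) S (D w).
Proof.
apply: (od_hlie oD _ _ hw) => [c [Sc [i ci]]|c []//].
by rewrite ci in Sc *; apply: hlie_De.
Qed.

Lemma hlie_edge_point : hlie deg (-1) S (flow deg D w (ga n)).
Proof.
have hwS : hlie deg 0 S w by apply: hlie_sub hw => c [].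
apply: hlieD; last exact: hlie_adser.
apply: hlie_adser; [exact: hlieN|exact: hlie_ga].
Qed.

Lemma edge_point : D (flow deg D w (ga n)) =
  - (flow deg D w (ga n) * flow deg D w (ga n)).
Proof.
apply: (flow_point oD hw.1 (hlie_nil hw) homog_ga hDw.1 point_a).
apply: (od_sq_sexp oD hw.1 (hlie_nil hw) hDw.1).
by rewrite !(linZ lD) DDv scaler0.
Qed.

End EdgePoint.

Lemma dd_seval_edges (J : finType) (x : J -> 'I_n) (p : ser J) :
  D (D (seval (fun l => ge (x l)) p)) = 0.
Proof.
apply: (od_sq_seval oD) => l; first exact: ge_nil.
- exact: homog_ge.
- exact: (@hlie_De [set: _] (x l) I I I).1.
- exact: dd_edge.
Qed.

(** Written as a value of a series at the edges, the average is reached by the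
    arguments about such values. *)
Lemma vedge_seval i :
  vedge i = seval (fun l : bool => ge (if l then ordS i else i))
                  (mu2 (gen lX) (gen lY)).
Proof.
have e0 (l : bool) : ge (if l then ordS i else i) [::] = 0 by apply: ge_nil.
apply/esym; rewrite (seval_mu2 e0 (gen_nil lX) (gen_nil lY)).
by rewrite (seval_gen e0 lX) (seval_gen e0 lY).
Qed.

Lemma dd_vedge i : D (D (vedge i)) = 0.
Proof. by rewrite vedge_seval; apply: dd_seval_edges. Qed.

Lemma dd_vmean : D (D (vmean mu)) = 0.
Proof. exact: (dd_seval_edges id). Qed.

Lemma hlie_edges_vedge S i : S (Ve i) -> S (Ve (ordS i)) ->
  hlie deg 0 (edges_of S) (vedge i).
Proof.
by move=> Si Si1; apply: (hlie_vedge hQ); split=> //; eexists.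
Qed.

Lemma hlie_edges_vmean S : (forall i, S (Ve i)) ->
  hlie deg 0 (edges_of S) (vmean mu).
Proof. by move=> Se; apply: (hlie_vmean hmu) => i; split=> //; eexists. Qed.

Lemma hlie_xface S i : S Va -> S Vb -> S (Ve i) -> S (Ve (ordS i)) ->
  hlie deg (-1) S (xface D i).
Proof.
by move=> Sa Sb Si Si1; apply: hlie_edge_point => //; apply: hlie_edges_vedge.
Qed.

Lemma hlie_xcentre S : S Va -> S Vb -> (forall i, S (Ve i)) ->
  hlie deg (-1) S (xcentre mu D).
Proof.
by move=> Sa Sb Se; apply: hlie_edge_point => //; apply: hlie_edges_vmean.
Qed.

Lemma point_xface i : D (xface D i) = - (xface D i * xface D i).
Proof.
apply: (@edge_point [set: _]) => //; last exact: dd_vedge.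
exact: hlie_edges_vedge.
Qed.

Lemma point_xcentre : D (xcentre mu D) = - (xcentre mu D * xcentre mu D).
Proof.
apply: (@edge_point [set: _]) => //; last exact: dd_vmean.
exact: hlie_edges_vmean.
Qed.

End BananaEdges.

(** The pairs that the sum leaves out contribute nothing, and in the sum over
    all pairs the first two terms cancel. *)
Lemma sum_cycle (V : zmodType) (n : nat) (L : 'I_n -> 'I_n -> V) :
  (forall i, L i i = 0) -> (forall i j, L j i = - L i j) ->
  \sum_(i < n) \sum_(j < n | (j != i) && (j != ordS i))
     (L j (ordS i) - L j i - L i (ordS i)) = - ((\sum_i L i (ordS i)) *+ n).
Proof.
move=> L0 LN; pose F i j := L j (ordS i) - L j i - L i (ordS i).
have inner (i : 'I_n) : \sum_(j < n | (j != i) && (j != ordS i)) F i j =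
    \sum_(j < n) F i j.
  rewrite [RHS](bigID (fun j => (j != i) && (j != ordS i))) /=.
  rewrite [X in _ = _ + X]big1 ?addr0 // => j; rewrite negb_and !negbK /F.
  case/orP=> /eqP ->; first by rewrite L0 subr0 subrr.
  by rewrite L0 (LN i) sub0r opprK subrr.
rewrite (eq_bigr _ (fun i _ => inner i)) exchange_big /=.
have tele j : \sum_i F i j = - \sum_i L i (ordS i).
  have r : \sum_i L j (ordS i) = \sum_i L j i.
    by rewrite [RHS](reindex_inj (@ordS_inj n)).
  by rewrite /F !sumrB r subrr sub0r.
by rewrite (eq_bigr _ (fun j _ => tele j)) sumr_const card_ord mulNrn.
Qed.

Section BananaFaces.
Variables (n : nat) (mu : ser 'I_n) (Q : ser bool).
Hypotheses (n2 : (2 <= n)%N).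
Hypotheses (hmu : universal_average mu) (hQ : bch_remainder Q).
Variable D : bser n -> bser n.
Local Notation deg := (@bdeg n).
Hypothesis oD : odd_derivation deg D.
Hypothesis Da : D (ga n) = - ((1 / 2) *: bbr (ga n) (ga n)).
Hypothesis Db : D (gb n) = - ((1 / 2) *: bbr (gb n) (gb n)).
Hypothesis De : forall i, D (ge i) =
  adser deg todd_neg (ge i) (ga n) + adser deg todd_pos (ge i) (gb n).
Hypothesis Df : forall i, D (gf i) = hol i - bbr (xface D i) (gf i).
Hypothesis Dh : D (gh n) =
  expad deg (- ((1 / 2) *: vmean mu)) (sphere Q) - bbr (xcentre mu D) (gh n).
Implicit Types (i j k : 'I_n) (S : set (banana_cell n)) (f v : bser n).

Let lD := od_lin oD.
Let oDa := odd_derivation_dpt oD (@homog_ga n) (gen_nil _).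
Let all_cells : set (banana_cell n) := fun=> True.

Let v2 i : bser n := (1 / 2) *: vedge i.
Let hv2 i : hlie deg 0 all_cells (v2 i).
Proof. by apply: hlieZ; apply: (hlie_vedge hQ). Qed.
Let v20 i : v2 i [::] = 0. Proof. exact: hlie_nil (hv2 i). Qed.

Let vm : bser n := (1 / 2) *: vmean mu.
Let hvm : hlie deg 0 all_cells vm.
Proof. by apply: hlieZ; apply: (hlie_vmean hmu). Qed.
Let vm0 : vm [::] = 0. Proof. exact: hlie_nil hvm. Qed.

Let hx i : hlie deg (-1) all_cells (xface D i).
Proof. exact: (hlie_xface hQ oD De). Qed.

Let hxc : hlie deg (-1) all_cells (xcentre mu D).
Proof. exact: (hlie_xcentre hmu oD De). Qed.

(** The logarithm commutes with conjugation. *)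
Lemma hol_conj i :
  hol i = sexp (- v2 i) * loop i (ordS i) * sexp (v2 i).
Proof.
have [i0 j0] := (ge_nil i, opp_nil (ge_nil (ordS i))).
rewrite /hol (bchs4 (opp_nil (v20 i)) i0 j0 (v20 i)) /loop bchE_log.
apply/esym; apply: (slog_conj (sexpNr (v20 i)) (sexpNl (v20 i))).
exact: mul_sexp_nil.
Qed.

Lemma conjNK v f : v [::] = 0 ->
  sexp v * (sexp (- v) * f * sexp v) * sexp (- v) = f.
Proof.
move=> v0; rewrite !mulrA (sexpNr v0) mul1r -mulrA (sexpNr v0).
by rewrite mulr1.
Qed.

Lemma conjKN v f : v [::] = 0 ->
  sexp (- v) * (sexp v * f * sexp (- v)) * sexp v = f.
Proof.
move=> v0; rewrite !mulrA (sexpNl v0) mul1r -mulrA (sexpNl v0).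
by rewrite mulr1.
Qed.

Lemma gauge_conjN v a f : homog deg 0 v -> v [::] = 0 -> homog deg (-1) a ->
  homog deg (-1) (flow deg D v a) ->
  dpt deg D (flow deg D v a) (sexp (- v) * f * sexp v) =
  sexp (- v) * dpt deg D a f * sexp v.
Proof.
move=> hv v0 ha hfl; have gv := gauge_flow oD a hv v0.
have [h1 h2] := (homog_sexp hv v0, homog_sexp (homogN hv) (opp_nil v0)).
exact: (gauge_conj oD f h1 h2 ha hfl (sexpNl v0) (sexpNr v0) gv).
Qed.

Lemma dpt_hol i : dpt deg D (xface D i) (hol i) = 0.
Proof.
rewrite hol_conj /xface (gauge_conjN _ (hv2 i).1 (v20 i) (@homog_ga n) (hx i).1).
by rewrite (dpt_loop oD De) mulr0 mul0r.
Qed.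

Lemma dpt_face i : dpt deg D (xface D i) (gf i) = hol i.
Proof. by rewrite /dpt Df subrK. Qed.

Lemma hlie_Df S i : S Va -> S Vb -> S (Ve i) -> S (Ve (ordS i)) -> S (Vf i) ->
  hlie deg 0 S (D (gf i)).
Proof.
move=> Sa Sb Si Si1 Sf; rewrite Df; apply: hlieD; first exact: (hlie_hol hQ).
apply/hlieN/(hlie_br (m := -1) (n := 1)); last exact: hlie_gf.
exact: (hlie_xface hQ oD De).
Qed.

Lemma dd_face i : D (D (gf i)) = 0.
Proof.
have hf := (@hlie_gf n all_cells i I).1.
have hDf := (@hlie_Df all_cells i I I I I I).1.
have := dpt_dpt oD (hx i).1 (point_xface hQ oD Da Db De i) hf hDf.
by rewrite dpt_face dpt_hol => <-.
Qed.

(** Transport of [dpt_face] from the centre of the face to [a]. *)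
Lemma dpt_gf' i : dpt deg D (ga n) (gf' i) = loop i (ordS i).
Proof.
have [h0 z0] := ((hv2 i).1, v20 i).
have ef : gf i = sexp (- v2 i) * gf' i * sexp (v2 i).
  by rewrite /gf' (expadE _ h0 z0) conjKN.
have := gauge_conjN (gf' i) h0 z0 (@homog_ga n) (hx i).1.
rewrite -[flow _ _ _ _]/(xface D i) -ef dpt_face hol_conj.
move/(congr1 (fun f => sexp (v2 i) * f * sexp (- v2 i))).
by rewrite !conjNK.
Qed.

Lemma dpt_loop_br i j f :
  dpt deg D (ga n) (bbr (loop i j) f) = bbr (loop i j) (dpt deg D (ga n) f).
Proof.
have hl := homog_loop hQ (i := i) (j := j).
have dl := dpt_loop oD De i j.
rewrite /bbr !(br0E _ hl) (linB (od_lin oDa)) (od_even oDa _ hl) dl mul0r add0r.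
by rewrite (od_mul oDa) dl mulr0 addr0.
Qed.

(** The loops are closed for the twisted differential at [a], so brackets with
    them commute with it. *)
Lemma dpt_rterm i j k f :
  dpt deg D (ga n) (rterm Q i j k f) = rterm Q i j k (dpt deg D (ga n) f).
Proof.
have cl := contr_loop hQ i j k.
apply: (opeval_intertwine (M := dpt deg D (ga n)) _ _ cl cl (od_lin oDa)).
by case=> f'; apply: dpt_loop_br.
Qed.

Lemma dpt_sphere : dpt deg D (ga n) (sphere Q) = 0.
Proof.
have ldpt := od_lin oDa.
have E i j a b : dpt deg D (ga n) (rterm Q j a b (gf' i)) =
    rterm Q j a b (loop i (ordS i)).
  exact: etrans (dpt_rterm j a b _) (congr1 _ (dpt_gf' i)).
have E2 i j : dpt deg D (ga n)
      (rterm Q j i (ordS i) (gf' i) + rterm Q j (ordS i) i (gf' i)) =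
    2%:R *: (loop j (ordS i) - loop j i - loop i (ordS i)).
  rewrite (linD ldpt); apply: etrans (congr2 _ (E _ _ _ _) (E _ _ _ _)) _.
  exact: (rterm_pair hQ i j (ordS i)).
rewrite /sphere (linD ldpt) (linZ ldpt) !(lin_sum ldpt).
rewrite (eq_bigr _ (fun i _ => dpt_gf' i)).
rewrite (eq_bigr _ (fun i _ => etrans (lin_sum ldpt _ _ _)
  (etrans (eq_bigr _ (fun j _ => E2 i j)) (esym (scaler_sumr _ _ _ _))))).
rewrite -scaler_sumr (sum_cycle (@loop_refl n) (@loop_opp n)).
move: (\sum_i loop i (ordS i)) => y.
rewrite -scaler_nat !scalerN !scalerA -mulrA -natrM mulVf ?scale1r ?subrr //.
by rewrite pnatr_eq0 muln_eq0 negb_or /= -lt0n ltnW.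
Qed.

Lemma dpt_ball : dpt deg D (xcentre mu D) (gh n) =
  expad deg (- ((1 / 2) *: vmean mu)) (sphere Q).
Proof. by rewrite /dpt Dh subrK. Qed.

Lemma dpt_dpt_ball : dpt deg D (xcentre mu D) (dpt deg D (xcentre mu D) (gh n)) = 0.
Proof.
have hnv := homogN hvm.1.
rewrite dpt_ball (expadE _ hnv (opp_nil vm0)) -/vm opprK.
rewrite (gauge_conjN _ hvm.1 vm0 (@homog_ga n) hxc.1) dpt_sphere.
by rewrite mulr0 mul0r.
Qed.

Lemma hlie_Dh : hlie deg 1 all_cells (D (gh n)).
Proof.
rewrite Dh; apply: hlieD.
  apply: hlie_adser; [exact: hlieN|exact: (hlie_sphere hQ)].
apply/hlieN/(hlie_br (m := -1) (n := 2)); first exact: hxc.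
exact: hlie_gh.
Qed.

Lemma dd_ball : D (D (gh n)) = 0.
Proof.
have hh := (@hlie_gh n all_cells I).1.
rewrite -(dpt_dpt oD hxc.1 (point_xcentre hmu oD Da Db De) hh hlie_Dh.1).
exact: dpt_dpt_ball.
Qed.

Lemma hlie_dpt_ball S : (forall i, S (Ve i)) -> (forall i, S (Vf i)) ->
  hlie deg 1 S (dpt deg D (xcentre mu D) (gh n)).
Proof.
move=> Se Sf; rewrite dpt_ball; apply: hlie_adser; last exact: (hlie_sphere hQ).
by apply/hlieN/hlieZ/(hlie_vmean hmu).
Qed.

End BananaFaces.

(** * Symmetry *)

Section BananaSymmetry.
Variables (n : nat) (mu : ser 'I_n) (Q : ser bool).
Hypotheses (hmu : universal_average mu) (hQ : bch_remainder Q).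
Variable D : bser n -> bser n.
Local Notation deg := (@bdeg n).
Hypothesis oD : odd_derivation deg D.
Hypothesis Da : D (ga n) = - ((1 / 2) *: bbr (ga n) (ga n)).
Hypothesis Db : D (gb n) = - ((1 / 2) *: bbr (gb n) (gb n)).
Hypothesis De : forall i, D (ge i) =
  adser deg todd_neg (ge i) (ga n) + adser deg todd_pos (ge i) (gb n).
Hypothesis Df : forall i, D (gf i) = hol i - bbr (xface D i) (gf i).
Hypothesis Dh : D (gh n) =
  expad deg (- ((1 / 2) *: vmean mu)) (sphere Q) - bbr (xcentre mu D) (gh n).

(** A symmetry permutes the edges by [s] and the faces by [t]; it changes the
    orientation of the cells of dimension at least 2 by [eps], according to
    whether it preserves or exchanges the two edges of each face. *)
Variables (s t : 'I_n -> 'I_n) (flip : bool).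
Hypotheses (s_inj : injective s) (t_inj : injective t).
Hypothesis st : forall i, if flip then s i = ordS (t i) /\ s (ordS i) = t i
                          else s i = t i /\ s (ordS i) = ordS (t i).
Let eps : rat := (-1) ^+ flip.

Definition sym_gen (c : banana_cell n) : bser n :=
  match c with
  | Va => ga n
  | Vb => gb n
  | Ve i => ge (s i)
  | Vf i => eps *: gf (t i)
  | Vh => eps *: gh n
  end.

Implicit Types (i j k : 'I_n) (f v e : bser n).

Let lD := od_lin oD.
Let M : bser n -> bser n := seval sym_gen.

Let sym0 c : sym_gen c [::] = 0.
Proof. by case: c => *; rewrite /= ?scalesE ?gen_nil ?mulr0. Qed.

Let hsym c : homog deg (deg c) (sym_gen c).
Proof.
case: c => [||i|i|].
- exact: homog_ga.
- exact: homog_gb.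
- exact: homog_ge.
- by apply: homogZ; exact: (@hlie_gf n [set: _] (t i) I).1.
- by apply: homogZ; exact: (@hlie_gh n [set: _] I).1.
Qed.

Let lM : linear M := linear_seval sym0.

Let MM f g : M (f * g) = M f * M g. Proof. exact: sevalM. Qed.

Let Mpar f : parity deg (M f) = M (parity deg f).
Proof. exact: seval_parity hsym. Qed.

Lemma sym_ga : M (ga n) = ga n. Proof. exact: (seval_gen sym0 Va). Qed.
Lemma sym_gb : M (gb n) = gb n. Proof. exact: (seval_gen sym0 Vb). Qed.
Lemma sym_ge i : M (ge i) = ge (s i). Proof. exact: (seval_gen sym0 (Ve i)). Qed.
Lemma sym_gf i : M (gf i) = eps *: gf (t i).
Proof. exact: (seval_gen sym0 (Vf i)). Qed.
Lemma sym_gh : M (gh n) = eps *: gh n. Proof. exact: (seval_gen sym0 Vh). Qed.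

Lemma sym_br0 e f : homog deg 0 e -> homog deg 0 (M e) ->
  M (br deg e f) = br deg (M e) (M f).
Proof.
move=> he hMe; rewrite (br0E f he) (br0E (M f) hMe) (linB lM).
by rewrite !MM.
Qed.

Lemma sym_brN1 e f : homog deg (-1) e -> homog deg (-1) (M e) ->
  M (br deg e f) = br deg (M e) (M f).
Proof.
move=> he hMe; rewrite (brN1E f he) (brN1E (M f) hMe) (linB lM).
by rewrite !MM Mpar.
Qed.

Lemma sym_adser c e f : homog deg 0 e -> e [::] = 0 -> homog deg 0 (M e) ->
  M (adser deg c e f) = adser deg c (M e) (M f).
Proof.
move=> he e0 hMe; have Me0 : M e [::] = 0 by rewrite /M seval_nil.
rewrite (adserE c f he e0) (adserE c (M f) hMe Me0).
apply: opeval_intertwine => [_|_|//|_ g]; last exact: sym_br0.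
  exact: contr_br.
exact: contr_br.
Qed.

Lemma sym_loop i j : M (loop i j) = loop (s i) (s j).
Proof.
have MNj : M (- ge j) = - ge (s j) := etrans (linN lM _) (congr1 -%R (sym_ge j)).
apply: etrans (seval_bch sym0 (ge_nil i) (opp_nil (ge_nil j))) _.
exact: congr2 (sym_ge i) MNj.
Qed.

(** If the symmetry exchanges the edges of a face, the average is unchanged by
    its symmetry in the two arguments. *)
Lemma sym_vedge i : M (vedge i) = vedge (t i).
Proof.
apply: etrans (seval_mu2 sym0 (ge_nil i) (ge_nil (ordS i))) _.
apply: etrans (congr2 _ (sym_ge i) (sym_ge (ordS i))) _; rewrite /vedge.
have := st i; case: flip => -[-> ->]; last by [].
exact: mu2C (ge_nil _) (ge_nil _).
Qed.

Lemma sym_vmean : M (vmean mu) = vmean mu.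
Proof.
rewrite /vmean /M (seval_comp mu sym0 (@ge_nil n)) -/M.
rewrite -[in RHS](ua_sym hmu (perm s_inj)).
rewrite (seval_comp mu (@ge_nil n) (fun i => gen_nil (perm s_inj i))).
congr (seval _ mu); apply/funext => i.
by rewrite sym_ge (seval_gen (@ge_nil n)) permE.
Qed.

Let hM_ge i : homog deg 0 (M (ge i)).
Proof. by rewrite sym_ge; apply: homog_ge. Qed.

Lemma sym_De i : D (M (ge i)) = M (D (ge i)).
Proof.
have [hi i0] := (homog_ge (i := i), ge_nil i).
rewrite (De i) (linD lM) !(sym_adser _ _ hi i0 (@hM_ge i)).
by rewrite sym_ge sym_ga sym_gb De.
Qed.

Lemma sym_D_seval (J : finType) (x : J -> 'I_n) (p : ser J) :
  D (M (seval (fun l => ge (x l)) p)) = M (D (seval (fun l => ge (x l)) p)).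
Proof.
apply: (od_seval_comm (degI := fun=> 0) oD _ sym0 hsym) => l.
- exact: ge_nil.
- exact: homog_ge.
- exact: sym_De.
Qed.

Lemma sym_flow v : homog deg 0 v -> v [::] = 0 -> homog deg 0 (M v) ->
  D (M v) = M (D v) -> M (flow deg D ((1 / 2) *: v) (ga n)) =
  flow deg D ((1 / 2) *: M v) (ga n).
Proof.
move=> hv v0 hMv DMv; have w0 := scale_nil (1 / 2) v0.
have hw : homog deg 0 ((1 / 2) *: v) by apply: homogZ.
have hNw : homog deg 0 (- ((1 / 2) *: v)) by apply: homogN.
have Mw : M ((1 / 2) *: v) = (1 / 2) *: M v by rewrite (linZ lM).
have hMw : homog deg 0 (M ((1 / 2) *: v)) by rewrite Mw; apply: homogZ.
have hMNw : homog deg 0 (M (- ((1 / 2) *: v))) by rewrite (linN lM); apply: homogN.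
rewrite /flow (linD lM) (sym_adser _ _ hw w0 hMw).
rewrite (sym_adser _ _ hNw (opp_nil w0) hMNw).
rewrite sym_ga (linN lM) Mw; congr (_ + adser _ _ _ _).
by rewrite !(linZ lD) DMv (linZ lM).
Qed.

Let all_cells : set (banana_cell n) := fun=> True.

Let hv i : hlie deg 0 all_cells (vedge i).
Proof. exact: (hlie_vedge hQ). Qed.

Let hvm : hlie deg 0 all_cells (vmean mu).
Proof. exact: (hlie_vmean hmu). Qed.

Lemma sym_xface i : M (xface D i) = xface D (t i).
Proof.
rewrite /xface -(sym_vedge i); apply: sym_flow (hv i).1 (hlie_nil (hv i)) _ _.
  by rewrite sym_vedge; exact: (hv (t i)).1.
by rewrite vedge_seval; apply: sym_D_seval.
Qed.

Lemma sym_xcentre : M (xcentre mu D) = xcentre mu D.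
Proof.
rewrite /xcentre -{2}sym_vmean; apply: sym_flow hvm.1 (hlie_nil hvm) _ _.
  by rewrite sym_vmean; exact: hvm.1.
exact: (sym_D_seval id).
Qed.

(** Exchanging the two edges of a face inverts its boundary loop. *)
Lemma sym_face_loop i : M (loop i (ordS i)) = eps *: loop (t i) (ordS (t i)).
Proof.
rewrite sym_loop /eps; have := st i; case: flip => -[-> ->].
  by rewrite expr1 scaleN1r loop_opp.
by rewrite expr0 scale1r.
Qed.

Lemma sym_hol i : M (hol i) = eps *: hol (t i).
Proof.
have h0 k := hlie_nil (hlieZ (1 / 2) (hv k)).
rewrite !(hol_conj hQ) !MM sym_face_loop.
rewrite /M !(seval_sexp sym0) ?(h0 i) ?(opp_nil (h0 i)) -/M //.
by rewrite (linN lM) (linZ lM) sym_vedge -scalerAr -scalerAl.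
Qed.

Lemma sym_gf' i : M (gf' i) = eps *: gf' (t i).
Proof.
have hw k := hlieZ (1 / 2) (hv k).
have Mw : M ((1 / 2) *: vedge i) = (1 / 2) *: vedge (t i).
  by rewrite (linZ lM) sym_vedge.
have hMw : homog deg 0 (M ((1 / 2) *: vedge i)) by rewrite Mw; exact: (hw (t i)).1.
rewrite /gf' (sym_adser _ _ (hw i).1 (hlie_nil (hw i)) hMw) Mw sym_gf.
have [h z] := ((hw (t i)).1, hlie_nil (hw (t i))).
rewrite (adserE _ _ h z) (linZ (opeval_linear _ _)) => [|_]; last exact: contr_br.
by rewrite /expad (adserE _ _ h z).
Qed.

(** Brackets with loops are mapped to brackets with loops. *)
Lemma sym_rterm i j k f :
  M (rterm Q i j k f) = rterm Q (s i) (s j) (s k) (M f).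
Proof.
apply: (opeval_intertwine (M := M)); [exact: (contr_loop hQ)|exact: (contr_loop hQ)| exact: lM|].
have h a b := homog_loop hQ (i := a) (j := b).
have hM a b : homog deg 0 (M (loop a b)) by rewrite sym_loop; apply: h.
by case=> g /=; rewrite /bbr sym_br0 ?sym_loop.
Qed.

Lemma sym_sphere : M (sphere Q) = eps *: sphere Q.
Proof.
(* The two corrections are exchanged if the symmetry is a reflection. *)
pose T i j := rterm Q j i (ordS i) (gf' i) + rterm Q j (ordS i) i (gf' i).
have MT i j : M (T i j) = eps *: T (t i) (s j).
  have R a b : M (rterm Q j a b (gf' i)) =
      eps *: rterm Q (s j) (s a) (s b) (gf' (t i)).
    apply: etrans (sym_rterm _ _ _ _) _; rewrite sym_gf'.
    exact: (linZ (rterm_linear hQ _ _ _)).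
  apply: etrans (linD lM _ _) _; apply: etrans (congr2 +%R (R _ _) (R _ _)) _.
  apply: etrans (esym (scalerDr _ _ _)) _; apply: (congr1 ( *:%R eps)).
  rewrite /T; have := st i; case: flip => -[-> ->]; last by [].
  exact: addrC.
(* The two edges of a face are mapped to the two edges of its image. *)
have cond i j : (j != i) && (j != ordS i) = (s j != t i) && (s j != ordS (t i)).
  rewrite -!(inj_eq s_inj j); have := st i; case: flip => -[-> ->] //.
  exact: andbC.
rewrite /sphere (linD lM) (linZ lM) !(lin_sum lM) scalerDr; congr (_ + _).
  rewrite (eq_bigr _ (fun i _ => sym_gf' i)) -scaler_sumr.
  by rewrite [in RHS](reindex_inj t_inj).
rewrite [RHS]scalerA [eps * _]mulrC -scalerA; congr (_ *: _).
rewrite [in RHS](reindex_inj t_inj) scaler_sumr; apply: eq_bigr => i _.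
rewrite (lin_sum lM) [in RHS](reindex_inj s_inj) scaler_sumr.
rewrite (eq_bigl _ _ (cond i)); apply: eq_bigr => j _.
exact: MT.
Qed.

Lemma sym_Df i : D (M (gf i)) = M (D (gf i)).
Proof.
have hx k := (hlie_xface hQ oD De (S := all_cells) (i := k) I I I I).1.
have hMx : homog deg (-1) (M (xface D i)) by rewrite sym_xface; apply: hx.
have Mbr : M (bbr (xface D i) (gf i)) = eps *: bbr (xface D (t i)) (gf (t i)).
  apply: etrans (sym_brN1 _ (hx i) hMx) _.
  apply: etrans (congr2 (br deg) (sym_xface i) (sym_gf i)) _.
  exact: (linZ (br_linr deg _)).
apply: etrans (etrans (congr1 D (sym_gf i)) (linZ lD _ _)) _.
apply: etrans (etrans (congr1 ( *:%R eps) (Df (t i))) (scalerBr _ _ _)) _.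
apply/esym; apply: etrans (etrans (congr1 M (Df i)) (linB lM _ _)) _.
exact: (congr2 (fun a b => a - b) (sym_hol i) Mbr).
Qed.

Lemma sym_Dh : D (M (gh n)) = M (D (gh n)).
Proof.
have hx := (hlie_xcentre hmu oD De (S := all_cells) I I (fun=> I)).1.
have hMx : homog deg (-1) (M (xcentre mu D)) by rewrite sym_xcentre; apply: hx.
have Mbr : M (bbr (xcentre mu D) (gh n)) = eps *: bbr (xcentre mu D) (gh n).
  apply: etrans (sym_brN1 _ hx hMx) _.
  apply: etrans (congr2 (br deg) sym_xcentre sym_gh) _.
  exact: (linZ (br_linr deg _)).
pose w : bser n := - ((1 / 2) *: vmean mu).
have hw : hlie deg 0 all_cells w by apply/hlieN/hlieZ.
have w0 := hlie_nil hw.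
have Mw : M w = w.
  apply: etrans (linN lM _) _; apply: (congr1 -%R).
  exact: etrans (linZ lM _ _) (congr1 _ sym_vmean).
have hMw : homog deg 0 (M w) by rewrite Mw; exact: hw.1.
have Mexp : M (expad deg w (sphere Q)) = eps *: expad deg w (sphere Q).
  apply: etrans (sym_adser _ _ hw.1 w0 hMw) _.
  apply: etrans (congr2 (adser deg _) Mw sym_sphere) _.
  rewrite (adserE _ _ hw.1 w0) (linZ (opeval_linear _ _)) => [|_].
    by apply: (congr1 ( *:%R eps)); rewrite /expad (adserE _ _ hw.1 w0).
  exact: (contr_br hw.1 w0).
apply: etrans (etrans (congr1 D sym_gh) (linZ lD _ _)) _.
apply: etrans (etrans (congr1 ( *:%R eps) Dh) (scalerBr _ _ _)) _.
apply/esym; apply: etrans (etrans (congr1 M Dh) (linB lM _ _)) _.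
exact: (congr2 (fun a b => a - b) Mexp Mbr).
Qed.

Lemma sym_D f : M (D f) = D (M f).
Proof.
have Mseval g : M g = M (seval (@gen _) g) by rewrite seval_id.
rewrite (Mseval f) -[in LHS](seval_id f); apply/esym.
apply: (od_seval_comm oD _ sym0 hsym (@gen_nil _) (@homog_gen _ deg)).
have half (a : bser n) : homog deg (-1) a -> M a = a ->
    M (- ((1 / 2) *: bbr a a)) = - ((1 / 2) *: bbr a a).
  move=> ha Ma; rewrite (linN lM) (linZ lM) /bbr sym_brN1 ?Ma //.
case=> [||i|i|].
- by rewrite -/M -[gen _]/(ga n) sym_ga Da half // ?sym_ga //; apply: homog_ga.
- by rewrite -/M -[gen _]/(gb n) sym_gb Db half // ?sym_gb //; apply: homog_gb.
- exact: sym_De.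
- exact: sym_Df.
- exact: sym_Dh.
Qed.

End BananaSymmetry.

(** * The cell complex *)

Section BananaComplex.
Variable n : nat.
Hypothesis n2 : (2 <= n)%N.
Implicit Types (i j : 'I_n).

Lemma big_banana (V : nmodType) (F : banana_cell n -> V) :
  \sum_c F c = F Va + F Vb + \sum_i F (Ve i) + \sum_i F (Vf i) + F Vh.
Proof.
have decK : cancel (@banana_dec n) (@banana_enc n) by case=> [[[]|[]]|[]].
rewrite (reindex (@banana_dec n)); last first.
  by apply: onW_bij; exists (@banana_enc n); [exact: decK|exact: banana_encK].
rewrite !big_sumType /= big_bool /= [F Vb + _]addrC -!addrA; congr (_ + (_ + (_ + (_ + _)))).
by rewrite (big_pred1 tt) => // -[].
Qed.

Lemma banana_regular : regular_cw (banana n).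
Proof.
have Si i : (i == ordS i) = false by rewrite eq_sym (negPf (ordS_neq i n2)).
split.
- by case=> [||i|i|] [||j|j|].
- by case=> [||i|i|] [||j|j|] //=; case: (j == i); case: (j == ordS i).
- case=> [||i|i|] // _; [by exists Va|exists (Ve i)|].
    by rewrite /= eqxx Si.
  by exists (Vf (Ordinal n2)).
- case=> [||i|i|] // _; split; last first.
    by rewrite big_banana /= !big1.
  by rewrite (eq_card (B := pred2 Va Vb)) ?card2 // => -[||j|j|].
- have neq i : Ve i != Ve (ordS i) :> banana_cell n.
    by apply/eqP => -[/eqP]; rewrite Si.
  have inc2 i j : (((j == i)%:Z - (j == ordS i)%:Z) != 0) = (j == i) || (j == ordS i).
    have [->|ji] := eqVneq j i; last by case: (j == ordS i).
    by rewrite Si.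
  case=> [||i|i|] [||j|j|] //= _ _.
  + rewrite (eq_card (B := pred2 (Ve i) (Ve (ordS i)))) ?card2 ?neq //.
    by move=> [||j|j|] //; rewrite !inE /= inc2 andbT.
  + rewrite (eq_card (B := pred2 (Ve i) (Ve (ordS i)))) ?card2 ?neq //.
    by move=> [||j|j|] //; rewrite !inE /= inc2 andbT.
  + rewrite (eq_card (B := pred2 (Vf j) (Vf (ord_pred j)))) ?card2.
      by rewrite (_ : _ != _) //; apply/eqP => -[]; rewrite -{1}(ord_predK j) => /esym/eqP; rewrite Si.
    move=> [||k|k|] //; rewrite !inE /= inc2 eq_sym; congr (_ || _).
    rewrite -[RHS]/(k == ord_pred j).
    by rewrite -[RHS](inj_eq (@ordS_inj n)) ord_predK eq_sym.
- have s1 i : \sum_(k < n) (k == i)%:Z = 1.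
    by rewrite (bigD1 i) //= eqxx big1 ?addr0 // => k /negPf ->.
  have s2 j : \sum_(i < n) (j == i)%:Z = 1.
    by rewrite -(s1 j); apply: eq_bigr => i _; rewrite eq_sym.
  case=> [||i|i|] z; rewrite big_banana /= ?mul0r ?add0r;
    try by rewrite !big1 ?addr0 // => *; rewrite ?mul0r.
  + rewrite -mulr_suml sumrB !s1 subrr mul0r add0r addr0.
    by rewrite big1 // => k _; rewrite mul0r.
  + rewrite big1_eq add0r addr0; case: z => [||j|j|]; try by rewrite big1.
    rewrite (eq_bigr _ (fun i _ => mul1r _)) sumrB s2.
    have -> : \sum_(i < n) (j == ordS i)%:Z = \sum_(i < n) (j == i)%:Z.
      by rewrite [RHS](reindex_inj (@ordS_inj n)).
    by rewrite s2 subrr.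
Qed.

Let sum0 (V : lmodType rat) (F : 'I_n -> V) : \sum_i (0 : int)%:~R *: F i = 0.
Proof. by apply: big1 => i _; rewrite scale0r. Qed.

Lemma bdry_edge i : @bdry (banana n) (Ve i) = gb n - ga n.
Proof.
have L (V : lmodType rat) (a b c : V) :
    (-1)%:~R *: a + 1%:~R *: b + 0 + 0 + 0%:~R *: c = b - a.
  by rewrite scaleN1r scale1r scale0r !addr0 addrC.
rewrite /bdry big_banana; apply: etrans (L _ _ _ (gh n)).
by congr (_ + _ + _ + _); apply: sum0.
Qed.

Lemma bdry_face i : @bdry (banana n) (Vf i) = ge i - ge (ordS i).
Proof.
have L (V : lmodType rat) (a b c : V) (E F : 'I_n -> V) :
    0%:~R *: a + 0%:~R *: b + \sum_j ((j == i)%:Z - (j == ordS i)%:Z)%:~R *: E j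
      + \sum_j (0 : int)%:~R *: F j + 0%:~R *: c = E i - E (ordS i).
  rewrite !scale0r sum0 !addr0 add0r.
  have s k : \sum_(j < n) (j == k)%:Z%:~R *: E j = E k.
    rewrite (bigD1 k) //= eqxx scale1r big1 ?addr0 // => j /negPf ->.
    by rewrite scale0r.
  rewrite -(s i) -(s (ordS i)) -sumrB; apply: eq_bigr => j _.
  by rewrite intrB scalerBl.
by rewrite /bdry big_banana; apply: L.
Qed.

Lemma bdry_ball : @bdry (banana n) Vh = \sum_(i < n) gf i.
Proof.
have L (V : lmodType rat) (a b c : V) (E F : 'I_n -> V) :
    0%:~R *: a + 0%:~R *: b + \sum_j (0 : int)%:~R *: E j
      + \sum_j (1 : int)%:~R *: F j + 0%:~R *: c = \sum_j F j.
  rewrite !scale0r sum0 !addr0 add0r.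
  by apply: eq_bigr => j _; rewrite scale1r.
by rewrite /bdry big_banana; apply: L.
Qed.

Let clo_step (y z : banana n) : inc y z != 0 -> closure_of y z.
Proof. exact: connect1. Qed.

Let clo_trans (y z x : banana n) :
  closure_of y z -> closure_of z x -> closure_of y x.
Proof. exact: connect_trans. Qed.

Lemma closure_edge i : [/\ @closure_of (banana n) (Ve i) Va,
  @closure_of (banana n) (Ve i) Vb & @closure_of (banana n) (Ve i) (Ve i)].
Proof. by split; [exact: clo_step|exact: clo_step|exact: connect0]. Qed.

Lemma inc_face i : inc (Vf i : banana n) (Ve i) != 0 /\
  inc (Vf i : banana n) (Ve (ordS i)) != 0.
Proof.
have Si := negPf (ordS_neq i n2).
by rewrite /= !eqxx Si eq_sym [i == _]eq_sym Si.
Qed.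

Lemma closure_face i : [/\ @closure_of (banana n) (Vf i) Va,
  @closure_of (banana n) (Vf i) Vb, @closure_of (banana n) (Vf i) (Ve i),
  @closure_of (banana n) (Vf i) (Ve (ordS i)) &
  @closure_of (banana n) (Vf i) (Vf i)].
Proof.
have [/clo_step i1 /clo_step i2] := inc_face i.
have [a b _] := closure_edge i.
by split=> //; [exact: clo_trans a|exact: clo_trans b|exact: connect0].
Qed.

Lemma closure_ball c : @closure_of (banana n) Vh c.
Proof.
have hf i : @closure_of (banana n) Vh (Vf i) by apply: clo_step.
have i0 : 'I_n := Ordinal n2.
case: c => [||i|i|]; last exact: connect0.
- by apply: clo_trans (hf i0) _; case: (closure_face i0).
- by apply: clo_trans (hf i0) _; case: (closure_face i0).
- by apply: clo_trans (hf i) _; case: (closure_face i).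
- exact: hf.
Qed.

Lemma bdry_closure_face i : @bdry_closure (banana n) (Vf i) (Ve i) /\
  @bdry_closure (banana n) (Vf i) (Ve (ordS i)).
Proof.
have [i1 i2] := inc_face i; split.
  by exists (Ve i) => //; apply: connect0.
by exists (Ve (ordS i)) => //; apply: connect0.
Qed.

Lemma bdry_closure_ball i : @bdry_closure (banana n) Vh (Ve i) /\
  @bdry_closure (banana n) Vh (Vf i).
Proof.
split; exists (Vf i) => //; last exact: connect0.
by case: (closure_face i).
Qed.

End BananaComplex.

(** * The differential *)

Section BananaExistence.
Variables (n : nat) (mu : ser 'I_n) (Q : ser bool).
Hypotheses (n2 : (2 <= n)%N).
Hypotheses (hmu : universal_average mu) (hQ : bch_remainder Q).
Local Notation deg := (@bdeg n).
Implicit Types (i j k : 'I_n) (f v e : bser n).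

Let all_cells : set (banana_cell n) := [set: _].

Definition edge_value (c : banana_cell n) : bser n :=
  match c with
  | Va => - ((1 / 2) *: bbr (ga n) (ga n))
  | Vb => - ((1 / 2) *: bbr (gb n) (gb n))
  | Ve i => adser deg todd_neg (ge i) (ga n) + adser deg todd_pos (ge i) (gb n)
  | Vf _ | Vh => 0
  end.

(** The values on faces and on [h] involve points whose definition needs the
    differential of series in the edges only; so it is constructed there
    first. *)
Definition edge_diff : bser n -> bser n := dext deg edge_value.

Definition banana_value (c : banana_cell n) : bser n :=
  match c with
  | Vf i => hol i - bbr (xface edge_diff i) (gf i)
  | Vh => expad deg (- ((1 / 2) *: vmean mu)) (sphere Q)
          - bbr (xcentre mu edge_diff) (gh n)
  | _ => edge_value c
  end.

Definition banana_diff : bser n -> bser n := dext deg banana_value.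

Lemma hlie_edge_value c : hlie deg (deg c - 1) all_cells (edge_value c).
Proof.
case: c => [||i|i|]; try exact: hlie0.
- apply/hlieN/hlieZ/(hlie_br (m := -1) (n := -1)); exact: hlie_ga.
- apply/hlieN/hlieZ/(hlie_br (m := -1) (n := -1)); exact: hlie_gb.
- apply: hlieD; first exact: (hlie_adser _ (hlie_ge I) (hlie_ga I)).
  exact: (hlie_adser _ (hlie_ge I) (hlie_gb I)).
Qed.

Lemma odd_edge_diff : odd_derivation deg edge_diff.
Proof. by apply: odd_derivation_dext => c; apply: hlie_nil (hlie_edge_value c). Qed.

Let De0 i : edge_diff (ge i) =
  adser deg todd_neg (ge i) (ga n) + adser deg todd_pos (ge i) (gb n).
Proof. exact: dext_gen. Qed.

Lemma hlie_banana_value c : hlie deg (deg c - 1) all_cells (banana_value c).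
Proof.
case: c => [||i|i|]; try exact: hlie_edge_value.
- apply: hlieD; first exact: (hlie_hol hQ).
  apply/hlieN/(hlie_br (m := -1) (n := 1)); last exact: hlie_gf.
  exact: (hlie_xface hQ odd_edge_diff De0).
- apply: hlieD.
    apply: hlie_adser; last exact: (hlie_sphere hQ).
    by apply/hlieN/hlieZ/(hlie_vmean hmu).
  apply/hlieN/(hlie_br (m := -1) (n := 2)); last exact: hlie_gh.
  exact: (hlie_xcentre hmu odd_edge_diff De0).
Qed.

Lemma odd_banana_diff : odd_derivation deg banana_diff.
Proof.
by apply: odd_derivation_dext => c; apply: hlie_nil (hlie_banana_value c).
Qed.

Lemma banana_diff_gen c : banana_diff (gen c) = banana_value c.
Proof. exact: dext_gen. Qed.

Lemma cder_banana_diff : cderivation deg banana_diff.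
Proof.
apply: cderivation_odd odd_banana_diff _ => c.
by rewrite banana_diff_gen; apply: hlie_banana_value.
Qed.

Lemma cder_edge_diff : cderivation deg edge_diff.
Proof.
apply: cderivation_odd odd_edge_diff _ => c.
by rewrite /edge_diff dext_gen; apply: hlie_edge_value.
Qed.

Definition is_edge (c : banana_cell n) : Prop := exists i, c = Ve i.

(** The centres are flows along series in the edges, on which the differentials
    agree when they do so on the edges. *)
Lemma xface_eq (d d' : bser n -> bser n) i :
  cderivation deg d -> cderivation deg d' ->
  (forall j, d (ge j) = d' (ge j)) -> xface d i = xface d' i.
Proof.
move=> cd cd' dd; have hv : hlie deg 0 is_edge ((1 / 2) *: vedge i).
  by apply: hlieZ; apply: (hlie_vedge hQ); eexists.
have e : d ((1 / 2) *: vedge i) = d' ((1 / 2) *: vedge i).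
  by apply: (cderivation_eq cd cd' _ hv) => c [j ->]; apply: dd.
by rewrite /xface /flow e.
Qed.

Lemma xcentre_eq (d d' : bser n -> bser n) :
  cderivation deg d -> cderivation deg d' ->
  (forall j, d (ge j) = d' (ge j)) -> xcentre mu d = xcentre mu d'.
Proof.
move=> cd cd' dd; have hv : hlie deg 0 is_edge ((1 / 2) *: vmean mu).
  by apply: hlieZ; apply: (hlie_vmean hmu) => j; exists j.
have e : d ((1 / 2) *: vmean mu) = d' ((1 / 2) *: vmean mu).
  by apply: (cderivation_eq cd cd' _ hv) => c [j ->]; apply: dd.
by rewrite /xcentre /flow e.
Qed.

Let De i : banana_diff (ge i) =
  adser deg todd_neg (ge i) (ga n) + adser deg todd_pos (ge i) (gb n).
Proof. exact: banana_diff_gen. Qed.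

Let dd i : edge_diff (ge i) = banana_diff (ge i).
Proof. by rewrite De De0. Qed.

Let Da : banana_diff (ga n) = - ((1 / 2) *: bbr (ga n) (ga n)).
Proof. exact: banana_diff_gen. Qed.

Let Db : banana_diff (gb n) = - ((1 / 2) *: bbr (gb n) (gb n)).
Proof. exact: banana_diff_gen. Qed.

Let Df i : banana_diff (gf i) = hol i - bbr (xface banana_diff i) (gf i).
Proof.
rewrite -(xface_eq i cder_edge_diff cder_banana_diff dd).
exact: banana_diff_gen.
Qed.

Let Dh : banana_diff (gh n) =
  expad deg (- ((1 / 2) *: vmean mu)) (sphere Q)
  - bbr (xcentre mu banana_diff) (gh n).
Proof.
rewrite -(xcentre_eq cder_edge_diff cder_banana_diff dd).
exact: banana_diff_gen.
Qed.

Let vm : bser n := (1 / 2) *: vmean mu.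
Let hvm : hlie deg 0 all_cells vm.
Proof. by apply: hlieZ; apply: (hlie_vmean hmu). Qed.
Let vm0 : vm [::] = 0. Proof. exact: hlie_nil hvm. Qed.

Lemma expadK f : expad deg vm (expad deg (- vm) f) = f.
Proof.
rewrite (expadE _ hvm.1 vm0) (expadE _ (homogN hvm.1) (opp_nil vm0)) opprK.
exact: conjNK.
Qed.

Lemma expad_inj f g : expad deg vm f = expad deg vm g -> f = g.
Proof.
rewrite !(expadE _ hvm.1 vm0).
move/(congr1 (fun f => sexp (- vm) * f * sexp vm)).
by rewrite !conjKN.
Qed.

Lemma sphereE : \sum_(i < n) gf' i + (2 * n)%:R^-1 *:
      \sum_(i < n) \sum_(j < n | (j != i) && (j != ordS i))
        (opeval (two_ops (bchE j i) (bchE i (ordS i))) Q (gf' i)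
         + opeval (two_ops (bchE j (ordS i)) (bchE (ordS i) i)) Q (gf' i)) =
  sphere Q.
Proof.
congr (_ + _ *: _); apply: eq_bigr => i _; apply: eq_bigr => j _.
exact: congr2 (bchE_rterm hQ _ _ _ _) (bchE_rterm hQ _ _ _ _).
Qed.

Lemma banana_diffP : banana_differential mu Q banana_diff.
Proof.
split; [exact: cder_banana_diff|exact: Da|exact: Db|exact: De|exact: Df|].
rewrite sphereE (dpt_ball Dh); exact: expadK.
Qed.

Lemma banana_diff_unique d : banana_differential mu Q d ->
  forall m f, cfree deg m f -> d f = banana_diff f.
Proof.
case=> cd da db de df dh m f hf.
have cD := cder_banana_diff; have eqe i : d (ge i) = banana_diff (ge i).
  by rewrite de De.
apply: (cderivation_eq cd cD _ hf) => -[||i|i|] _.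
- exact: etrans da (esym Da).
- exact: etrans db (esym Db).
- exact: eqe.
- have := df i; rewrite (xface_eq i cd cD eqe) => e.
  exact: etrans e (esym (Df i)).
- have := dh; rewrite sphereE (xcentre_eq cd cD eqe) => e.
  have := bd_h banana_diffP; rewrite sphereE -e => /expad_inj.
  by rewrite /dpt => /addIr.
Qed.

Lemma dd_banana f : banana_diff (banana_diff f) = 0.
Proof.
apply: (od_sq0 odd_banana_diff) => c.
  by rewrite banana_diff_gen; exact: (hlie_banana_value c).1.
have oD := odd_banana_diff.
case: c => [||i|i|].
- have ha := @homog_ga n; have pa := point_a Da.
  rewrite -[gen _]/(ga n) pa (linN (od_lin oD)) (od_oddM oD _ ha) pa.
  by rewrite mulNr mulrN opprK mulrA addNr oppr0.
- have hb := @homog_gb n; have pb := point_b Db.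
  rewrite -[gen _]/(gb n) pb (linN (od_lin oD)) (od_oddM oD _ hb) pb.
  by rewrite mulNr mulrN opprK mulrA addNr oppr0.
- exact: (dd_edge oD Da Db De).
- exact: (dd_face hQ oD Da Db De Df).
- exact: (dd_ball n2 hmu hQ oD Da Db De Df Dh).
Qed.

Let hx i : hlie deg (-1) all_cells (xface banana_diff i).
Proof. exact: (hlie_xface hQ odd_banana_diff De). Qed.

Let hxc : hlie deg (-1) all_cells (xcentre mu banana_diff).
Proof. exact: (hlie_xcentre hmu odd_banana_diff De). Qed.

(** Transport does not affect the linear part. *)
Lemma hol_eqm2 i : eqm 2 (hol i) (ge i - ge (ordS i)).
Proof.
have hw : hlie deg 0 all_cells (- ((1 / 2) *: vedge i)).
  by apply/hlieN/hlieZ/(hlie_vedge hQ).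
have -> : hol i = expad deg (- ((1 / 2) *: vedge i)) (loop i (ordS i)).
  by rewrite (expadE _ hw.1 (hlie_nil hw)) opprK; apply: (hol_conj hQ).
apply: (eqm_trans (expad_eqm2 hw.1 (hlie_nil hw) (loop_nil hQ i (ordS i)))).
have [hi hj] := (homog_ge (i := i), homogN (homog_ge (i := ordS i))).
exact: (bch_eqm2 hQ hi hj (ge_nil i) (opp_nil (ge_nil (ordS i)))).
Qed.

Lemma eqm_expad (k : nat) f g : eqm k f g ->
  eqm k (expad deg (- vm) f) (expad deg (- vm) g).
Proof.
move=> fg; rewrite !(expadE _ (homogN hvm.1) (opp_nil vm0)).
by apply: eqmM => //; apply: eqmM.
Qed.

Lemma eqm_subr2 (k : nat) f g h : eqm k f h -> eqm k g 0 -> eqm k (f - g) h.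
Proof.
move=> fh g0; rewrite -[h]addr0; apply: eqmD => // w wk.
by rewrite oppsE g0 ?oppr0.
Qed.

Lemma sphere_eqm2 : eqm 2 (sphere Q) (\sum_(i < n) gf i).
Proof.
have hf i : hlie deg 1 all_cells (gf' i) by apply: (hlie_gf' hQ).
rewrite -[X in eqm _ _ X]addr0; apply: eqmD.
  apply: eqm_sum => i _; have hw : hlie deg 0 all_cells ((1 / 2) *: vedge i).
    by apply/hlieZ/(hlie_vedge hQ).
  exact: (expad_eqm2 hw.1 (hlie_nil hw) (gen_nil _)).
rewrite -[X in eqm _ _ X](scaler0 _ (2 * n)%:R^-1); apply: eqmZ.
apply: eqm0_sum => i _; apply: eqm0_sum => j _.
have r0 a b c : eqm 2 (rterm Q a b c (gf' i)) 0.
  apply: (eqm_trans (opeval_eqm2 Q (contr_loop hQ a b c) (hlie_nil (hf i)))).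
  by rewrite (q_const hQ) scale0r.
by rewrite -[X in eqm _ _ X]addr0; apply: eqmD; apply: r0.
Qed.

Lemma linear_banana (c : banana_cell n) : (0 < banana_dim c)%N ->
  hpart 1 (banana_diff (gen c)) = @bdry (banana n) c.
Proof.
have lin c' f : hpart 1 f = f -> eqm 2 (banana_diff (gen c')) f ->
    hpart 1 (banana_diff (gen c')) = f.
  by move=> hf ef; rewrite (hpart1_eqm ef) hf.
have hpB := linB (@hpart_linear (banana_cell n) 1).
case: c => [||i|i|] // _.
- rewrite bdry_edge; apply: lin; first by rewrite hpB !hpart1_gen.
  rewrite [banana_diff _]De addrC.
  have [hi i0] := (homog_ge (i := i), ge_nil i).
  apply: eqmD.
    apply: (eqm_trans (adser_eqm2 todd_pos hi i0 (gen_nil _))).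
    by rewrite todd_pos0 scale1r.
  apply: (eqm_trans (adser_eqm2 todd_neg hi i0 (gen_nil _))).
  by rewrite todd_neg0 scaleN1r.
- apply: etrans (lin (Vf i) (ge i - ge (ordS i)) _ _) (esym (bdry_face i)).
    apply: etrans (hpB _ _) _.
    exact: (congr2 (fun f g : bser n => f - g) (hpart1_gen (Ve i))
                                               (hpart1_gen (Ve (ordS i)))).
  rewrite [banana_diff _]Df; refine (eqm_subr2 (hol_eqm2 i) _).
  have hf := (@hlie_gf n all_cells i I).1.
  exact: (br_eqm2 (hx i).1 hf (hlie_nil (hx i)) (gen_nil _)).
- apply: etrans (lin Vh (\sum_(i < n) gf i) _ _) (esym (bdry_ball n)).
    rewrite (lin_sum (@hpart_linear _ 1)); apply: eq_bigr => i _.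
    exact: hpart1_gen.
  rewrite [banana_diff _]Dh; refine (eqm_subr2 _ _).
    apply: (eqm_trans (eqm_expad sphere_eqm2)).
    apply: (expad_eqm2 (homogN hvm.1) (opp_nil vm0)).
    by rewrite sum_sE big1.
  have hh := (@hlie_gh n all_cells I).1.
  exact: (br_eqm2 hxc.1 hh (hlie_nil hxc) (gen_nil _)).
Qed.

Lemma local_banana (c : banana_cell n) :
  lie_gen deg (@closure_of (banana n) c) (banana_diff (gen c)).
Proof.
have oD := odd_banana_diff.
case: c => [||i|i|].
- rewrite [banana_diff _]Da.
  have h : hlie deg (-1) (@closure_of (banana n) Va) (ga n).
    by apply: hlie_ga; apply: connect0.
  by have [] := hlieN (hlieZ (1 / 2) (hlie_br h h)).
- rewrite [banana_diff _]Db.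
  have h : hlie deg (-1) (@closure_of (banana n) Vb) (gb n).
    by apply: hlie_gb; apply: connect0.
  by have [] := hlieN (hlieZ (1 / 2) (hlie_br h h)).
- have [a b e] := closure_edge i.
  by have [] := hlie_De De a b e.
- have [a b e1 e2 f] := closure_face n2 i.
  by have [] := hlie_Df hQ oD De Df a b e1 e2 f.
- have h : hlie deg 1 (@closure_of (banana n) Vh) (banana_diff (gh n)).
    apply: hlie_sub (hlie_Dh hmu hQ oD De Dh) => c _.
    exact: (closure_ball n2 c).
  by case: h.
Qed.

Lemma model_banana : @is_model (banana n) banana_diff.
Proof.
have cD := cder_banana_diff.
have pt (x : bser n) : hlie deg (-1) all_cells x ->
    banana_diff x = - (x * x) -> is_point deg banana_diff x.
  by move=> hx' Dx; apply: is_pointP.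
split; [exact: banana_regular|exact: freely_generated_pfree| |exact: cD| | |].
- split; [exact: graded_lie_cfree|exact: (cder_der cD)|].
  by move=> m x _; apply: dd_banana.
- case=> // _; apply: pt.
  + exact: hlie_ga.
  + exact: (point_a Da).
  + exact: hlie_gb.
  + exact: (point_b Db).
- exact: linear_banana.
- exact: local_banana.
Qed.

Lemma localised_face i :
  @localised (banana n) banana_diff (Vf i) (xface banana_diff i).
Proof.
split=> //.
  apply: is_pointP; first exact: (hx i).
  exact: (point_xface hQ odd_banana_diff Da Db De).
have [e1 e2] := bdry_closure_face n2 i.
have -> : dpt (@cdeg (banana n)) banana_diff (xface banana_diff i)
  (@gen (banana n) (Vf i)) = hol i by exact: (dpt_face Df).
by have [] := hlie_hol hQ e1 e2.
Qed.

Lemma localised_ball :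
  @localised (banana n) banana_diff Vh (xcentre mu banana_diff).
Proof.
split=> //.
  apply: is_pointP; first exact: hxc.
  exact: (point_xcentre hmu odd_banana_diff Da Db De).
have [] // := hlie_dpt_ball (S := @bdry_closure (banana n) Vh) hmu hQ Dh.
  by move=> i; have [] := bdry_closure_ball n2 i.
by move=> i; have [] := bdry_closure_ball n2 i.
Qed.

Lemma symmetric_banana (g : bser n -> bser n) : Dn g ->
  forall f, g (banana_diff f) = banana_diff (g f).
Proof.
have sym := sym_D hmu hQ odd_banana_diff Da Db De Df Dh.
elim=> {g} [||//|g g' _ IHg _ IHg' f|g g' _ IHg gK g'K f].
(* The reflection sends edge [i] to [n - i] and face [i] to [n - i - 1]. *)
- have -> : @sigma_gen n =
      sym_gen (fun i => ordS (rev_ord i)) (fun i => rev_ord i) true.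
    by apply/funext => -[||i|i|] //=; rewrite expr1 scaleN1r.
  apply: sym => [i j /ordS_inj/rev_ord_inj //|i j /rev_ord_inj //|i].
  by rewrite ordS_rev.
- have -> : @tau_gen n = sym_gen (@ordS n) (@ordS n) false.
    by apply/funext => -[||i|i|] //=; rewrite expr0 scale1r.
  by apply: sym => //; apply: ordS_inj.
- by rewrite /= IHg' IHg.
- by rewrite -{1}(g'K f) -IHg gK.
Qed.

End BananaExistence.

Theorem theorem1 (n : nat) (hn : (2 <= n)%N)
    (mu : ser 'I_n) (hmu : universal_average mu)
    (Q : ser bool) (hQ : bch_remainder Q) :
  exists d : bser n -> bser n,
    [/\ banana_differential mu Q d
          /\ (forall d' : bser n -> bser n, banana_differential mu Q d' ->
                forall (m : int) (f : bser n), cfree (@bdeg n) m f ->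
                d' f = d f),
        @is_model (banana n) d,
        forall g : bser n -> bser n, Dn g ->
          forall (m : int) (f : bser n), cfree (@bdeg n) m f ->
          g (d f) = d (g f),
        @localised (banana n) d Vh (xcentre mu d)
      & forall i : 'I_n, @localised (banana n) d (Vf i) (xface d i)].
Proof.
exists (banana_diff mu Q); split.
- split; first exact: banana_diffP.
  exact: banana_diff_unique.
- exact: model_banana.
- by move=> g Dg m f _; apply: symmetric_banana.
- exact: localised_ball.
- exact: localised_face.
Qed.
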